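(* Let $k\in\mathbb{Z}$ with $k\leq n_1-n_2+1-\delta_{n_1,n_2}$. Then $\mathcal{H}'_{\langle k\rangle}$ is an irreducible $o(2n+1,\mathbb{F})$-submodule and $$\mathcal{B}'_{\langle k\rangle}=\bigoplus_{i=0}^\infty(\eta')^i(\mathcal{H}'_{\langle k-2i\rangle})$$ is a decomposition into irreducible submodules. In particular, $\mathcal{B}'_{\langle k\rangle}=\mathcal{H}'_{\langle k\rangle}\oplus\eta'(\mathcal{B}'_{\langle k-2\rangle})$. Under this assumption on $k$, the module $\mathcal{H}'_{\langle k\rangle}$ is of highest-weight type only if $n_2=n$. When $n_1=n_2=n$, all the irreducible modules $\mathcal{H}'_{\langle k\rangle}$ with $0\geq k\in\mathbb{Z}$ are of $(\mathcal{G},\mathcal{K})$-type, where $\mathcal{G}=o(2n+1,\mathbb{F})$.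
   Context: $\mathbb{F}$ is a field of characteristic $0$, $n\geq 2$ is an integer, and $n_1,n_2$ are fixed integers with $1\leq n_1\leq n_2\leq n$. $\mathbb{N}$ is the set of nonnegative integers, $\overline{i,j}=\{i,\dots,j\}$, $\delta$ is the Kronecker delta, and $E_{i,j}$ ($i,j\in\overline{0,2n}$) are matrix units. Let $\mathcal{B}=\mathbb{F}[x_1,\dots,x_n,y_1,\dots,y_n]$, $\mathcal{B}'=\mathbb{F}[x_0,x_1,\dots,x_n,y_1,\dots,y_n]$, $x^\alpha y^\beta=\prod_{i=1}^n x_i^{\alpha_i}y_i^{\beta_i}$. Define operators on $\mathcal{B}'$, for $i,j\in\overline{1,n}$: - $E^x_{i,j}=-x_j\partial_{x_i}-\delta_{i,j}$ if $i,j\in\overline{1,n_1}$; $\ \partial_{x_i}\partial_{x_j}$ if $i\in\overline{1,n_1},\,j\in\overline{n_1+1,n}$; $\ -x_ix_j$ if $i\in\overline{n_1+1,n},\,j\in\overline{1,n_1}$; $\ x_i\partial_{x_j}$ if $i,j\in\overline{n_1+1,n}$. - $E^y_{i,j}=y_i\partial_{y_j}$ if $i,j\in\overline{1,n_2}$; $\ -y_iy_j$ if $i\in\overline{1,n_2},\,j\in\overline{n_2+1,n}$; $\ \partial_{y_i}\partial_{y_j}$ if $i\in\overline{n_2+1,n},\,j\in\overline{1,n_2}$; $\ -y_j\partial_{y_i}-\delta_{i,j}$ if $i,j\in\overline{n_2+1,n}$. - $E_{i,n+j}$ acts as $\partial_{x_i}\partial_{y_j}$ if $i\in\overline{1,n_1},\,j\in\overline{1,n_2}$;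 $\ -y_j\partial_{x_i}$ if $i\in\overline{1,n_1},\,j\in\overline{n_2+1,n}$; $\ x_i\partial_{y_j}$ if $i\in\overline{n_1+1,n},\,j\in\overline{1,n_2}$; $\ -x_iy_j$ if $i\in\overline{n_1+1,n},\,j\in\overline{n_2+1,n}$. - $E_{n+i,j}$ acts as $-x_jy_i$ if $j\in\overline{1,n_1},\,i\in\overline{1,n_2}$; $\ -x_j\partial_{y_i}$ if $j\in\overline{1,n_1},\,i\in\overline{n_2+1,n}$; $\ y_i\partial_{x_j}$ if $j\in\overline{n_1+1,n},\,i\in\overline{1,n_2}$; $\ \partial_{x_j}\partial_{y_i}$ if $j\in\overline{n_1+1,n},\,i\in\overline{n_2+1,n}$. - $E_{0,i}$ acts as $-x_0x_i$ if $i\in\overline{1,n_1}$ and $x_0\partial_{x_i}$ if $i\in\overline{n_1+1,n}$; $E_{0,n+i}$ acts as $x_0\partial_{y_i}$ if $i\in\overline{1,n_2}$ and $-x_0y_i$ if $i\in\overline{n_2+1,n}$. - $E_{i,0}$ acts as $\partial_{x_0}\partial_{x_i}$ if $i\in\overline{1,n_1}$ and $x_i\partial_{x_0}$ if $i\in\overline{n_1+1,n}$; $E_{n+i,0}$ acts as $y_i\partial_{x_0}$ if $i\in\overline{1,n_2}$ and $\partial_{x_0}\partial_{y_i}$ if $i\in\overline{n_2+1,n}$. The split orthogonal Lie algebras are $$o(2n,\mathbb{F})=\sum_{i,j=1}^n\mathbb{F}(E_{i,j}-E_{n+j,n+i})+\sum_{1\leq i<j\leq n}[\mathbb{F}(E_{i,n+j}-E_{j,n+i})+\mathbb{F}(E_{n+j,i}-E_{n+i,j})],$$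 $$o(2n+1,\mathbb{F})=o(2n,\mathbb{F})\oplus\bigoplus_{i=1}^n[\mathbb{F}(E_{0,i}-E_{n+i,0})+\mathbb{F}(E_{0,n+i}-E_{i,0})].$$ $o(2n+1,\mathbb{F})$ acts on $\mathcal{B}'$ with $E_{i,j}-E_{n+j,n+i}$ acting as $E^x_{i,j}-E^y_{j,i}$ and all other displayed basis elements acting as the corresponding differences of the operators above. Put $$\mathcal{D}'=\partial_{x_0}^2-2\sum_{i=1}^{n_1}x_i\partial_{y_i}+2\sum_{r=n_1+1}^{n_2}\partial_{x_r}\partial_{y_r}-2\sum_{s=n_2+1}^n y_s\partial_{x_s},$$ $$\eta'=x_0^2+2\sum_{i=1}^{n_1}y_i\partial_{x_i}+2\sum_{r=n_1+1}^{n_2}x_ry_r+2\sum_{s=n_2+1}^n x_s\partial_{y_s}.$$ For $k\in\mathbb{Z}$, $\mathcal{B}_{\langle k\rangle}$ is the span of the monomials $x^\alpha y^\beta$ ($\alpha,\beta\in\mathbb{N}^n$) with $-\sum_{i=1}^{n_1}\alpha_i+\sum_{r=n_1+1}^n\alpha_r+\sum_{i=1}^{n_2}\beta_i-\sum_{r=n_2+1}^n\beta_r=k$; $\mathcal{B}'_{\langle k\rangle}=\sum_{i=0}^\infty\mathcal{B}_{\langle k-i\rangle}x_0^i$; and $\mathcal{H}'_{\langle k\rangle}=\{f\in\mathcal{B}'_{\langle k\rangle}\mid\mathcal{D}'(f)=0\}$. These last two are $o(2n+1,\mathbb{F})$-submodules. $\mathcal{K}=\sum_{i,j=1}^n\mathbb{F}(E_{i,j}-E_{n+j,n+i})$.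 An infinite-dimensional irreducible $\mathcal{G}$-module is of $(\mathcal{G},\mathcal{K})$-type if it is a direct sum of finite-dimensional irreducible $\mathcal{K}$-submodules. Highest-weight type is meant with respect to the Cartan subalgebra $\sum_i\mathbb{F}(E_{i,i}-E_{n+i,n+i})$ and the standard positive root vectors $E_{i,j}-E_{n+j,n+i}$, $E_{i,n+j}-E_{j,n+i}$ ($i<j$), $E_{0,n+i}-E_{i,0}$. *)

(* Defs.v *)
From HB Require Import structures.
From mathcomp Require Import all_boot all_order all_algebra.
From mathcomp.multinomials Require Export mpoly.

Set Implicit Arguments.
Unset Strict Implicit.
Unset Printing Implicit Defensive.

Import GRing.Theory.
Local Open Scope ring_scope.

(* Subspaces of a possibly infinite-dimensional vector space are represented by
   Prop-valued predicates. *)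
Section Subspaces.
Variables (F : fieldType) (V : lmodType F).
Implicit Types (W : V -> Prop).

Definition is_subspace W :=
  W 0 /\ forall (c : F) (u v : V), W u -> W v -> W (c *: u + v).

Definition lin_span (S : V -> Prop) (f : V) :=
  exists2 s : seq (F * V),
    (forall p, p \in s -> S p.2) & f = \sum_(p <- s) p.1 *: p.2.

Definition finite_dim W :=
  exists s : seq V, forall f, W f -> lin_span (fun g => g \in s) f.

Definition image_of (h : V -> V) W (f : V) := exists2 g, W g & f = h g.

Definition subspace_sum (I : eqType) (U : I -> V -> Prop) (f : V) :=
  exists (s : seq I) (g : I -> V),
    (forall i, i \in s -> U i (g i)) /\ f = \sum_(i <- s) g i.

Definition independent (I : eqType) (U : I -> V -> Prop) :=
  forall (s : seq I) (g : I -> V), uniq s ->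
    (forall i, i \in s -> U i (g i)) -> \sum_(i <- s) g i = 0 ->
    forall i, i \in s -> g i = 0.

Definition direct_sum W (I : eqType) (U : I -> V -> Prop) :=
  [/\ forall i, is_subspace (U i),
      forall f, W f <-> subspace_sum U f & independent U].

End Subspaces.

Section OddOrthogonal.
Variables (F : fieldType) (n : nat).

(* The index set {0, ..., 2n} serves both for the matrix units and for the
   variables: 0 |-> x_0, i |-> x_i, n + i |-> y_i.  The ordinal i : 'I_n stands
   for the index i + 1 in {1, ..., n}, so that i < n1 means that this index is
   in {1, ..., n1}. *)
Definition ix0 : 'I_(n + n).+1 := ord0.
Definition ix (i : 'I_n) : 'I_(n + n).+1 := lift ord0 (lshift n i).
Definition iy (i : 'I_n) : 'I_(n + n).+1 := lift ord0 (rshift n i).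

Definition ix_split (a : 'I_(n + n).+1) : option ('I_n + 'I_n) :=
  omap (@split n n) (unlift ord0 a).

Local Notation mat := 'M[F]_((n + n).+1).
Local Notation E := (@delta_mx F (n + n).+1 (n + n).+1).

Definition so_gl i j : mat := E (ix i) (ix j) - E (iy j) (iy i).
Definition so_up i j : mat := E (ix i) (iy j) - E (ix j) (iy i).
Definition so_dn i j : mat := E (iy j) (ix i) - E (iy i) (ix j).
Definition so_0x i : mat := E ix0 (ix i) - E (iy i) ix0.
Definition so_0y i : mat := E ix0 (iy i) - E (ix i) ix0.

(* The subalgebra written K in (G,K)-type. *)
Definition Kalg : {vspace mat} :=
  (\sum_(i < n) \sum_(j < n) <[so_gl i j]>)%VS.

Definition so_even : {vspace mat} :=
  (Kalg + \sum_(i < n) \sum_(j < n | (i < j)%N) (<[so_up i j]> + <[so_dn i j]>))%VS.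

Definition so_odd : {vspace mat} :=
  (so_even + \sum_(i < n) (<[so_0x i]> + <[so_0y i]>))%VS.

Variables n1 n2 : nat.

Local Notation B := {mpoly F[(n + n).+1]}.

Local Notation x0 := ('X_ix0 : B).
Local Notation x i := ('X_(ix i) : B).
Local Notation y i := ('X_(iy i) : B).
Local Notation d0 := (@mderiv (n + n).+1 F ix0).
Local Notation dx i := (@mderiv (n + n).+1 F (ix i)).
Local Notation dy i := (@mderiv (n + n).+1 F (iy i)).

Definition opEx (i j : 'I_n) (f : B) : B :=
  match (i < n1)%N, (j < n1)%N with
  | true,  true  => - (x j * dx i f) - (i == j)%:R *: f
  | true,  false => dx i (dx j f)
  | false, true  => - (x i * x j * f)
  | false, false => x i * dx j f
  end.

Definition opEy (i j : 'I_n) (f : B) : B :=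
  match (i < n2)%N, (j < n2)%N with
  | true,  true  => y i * dy j f
  | true,  false => - (y i * y j * f)
  | false, true  => dy i (dy j f)
  | false, false => - (y j * dy i f) - (i == j)%:R *: f
  end.

Definition opExy (i j : 'I_n) (f : B) : B :=
  match (i < n1)%N, (j < n2)%N with
  | true,  true  => dx i (dy j f)
  | true,  false => - (y j * dx i f)
  | false, true  => x i * dy j f
  | false, false => - (x i * y j * f)
  end.

Definition opEyx (i j : 'I_n) (f : B) : B :=
  match (j < n1)%N, (i < n2)%N with
  | true,  true  => - (x j * y i * f)
  | true,  false => - (x j * dy i f)
  | false, true  => y i * dx j f
  | false, false => dx j (dy i f)
  end.

Definition opE0x (i : 'I_n) (f : B) : B :=
  if (i < n1)%N then - (x0 * x i * f) else x0 * dx i f.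
Definition opE0y (i : 'I_n) (f : B) : B :=
  if (i < n2)%N then x0 * dy i f else - (x0 * y i * f).
Definition opEx0 (i : 'I_n) (f : B) : B :=
  if (i < n1)%N then d0 (dx i f) else x i * d0 f.
Definition opEy0 (i : 'I_n) (f : B) : B :=
  if (i < n2)%N then y i * d0 f else d0 (dy i f).

(* The operator of E_{a,b}.  In particular E_{n+i,n+j} acts as E^y_{i,j}.  The
   value at a = b = 0 is immaterial: the (0,0) entry of every matrix in so_odd
   vanishes. *)
Definition opE (a b : 'I_(n + n).+1) (f : B) : B :=
  match ix_split a, ix_split b with
  | None,         None         => x0 * d0 f
  | None,         Some (inl i) => opE0x i f
  | None,         Some (inr i) => opE0y i f
  | Some (inl i), None         => opEx0 i f
  | Some (inr i), None         => opEy0 i f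
  | Some (inl i), Some (inl j) => opEx i j f
  | Some (inl i), Some (inr j) => opExy i j f
  | Some (inr i), Some (inl j) => opEyx i j f
  | Some (inr i), Some (inr j) => opEy i j f
  end.

(* Used only for A in so_odd (or in a subalgebra of it). *)
Definition act (A : mat) (f : B) : B := \sum_a \sum_b A a b *: opE a b f.

Definition Dop (f : B) : B :=
  d0 (d0 f)
  - 2%:R *: (\sum_(i < n | (i < n1)%N) x i * dy i f)
  + 2%:R *: (\sum_(r < n | (n1 <= r < n2)%N) dx r (dy r f))
  - 2%:R *: (\sum_(s < n | (n2 <= s)%N) y s * dx s f).

Definition etaop (f : B) : B :=
  x0 ^+ 2 * f
  + 2%:R *: (\sum_(i < n | (i < n1)%N) y i * dx i f)
  + 2%:R *: (\sum_(r < n | (n1 <= r < n2)%N) x r * y r * f)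
  + 2%:R *: (\sum_(s < n | (n2 <= s)%N) x s * dy s f).

Definition xydeg (m : 'X_{1..(n + n).+1}) : int :=
  - (\sum_(i < n | (i < n1)%N) (m (ix i))%:Z)
  + \sum_(r < n | (n1 <= r)%N) (m (ix r))%:Z
  + \sum_(i < n | (i < n2)%N) (m (iy i))%:Z
  - \sum_(r < n | (n2 <= r)%N) (m (iy r))%:Z.

(* B_<k>, seen inside the polynomial ring that also contains x_0. *)
Definition Bk (k : int) : B -> Prop :=
  lin_span (fun p : B =>
    exists m : 'X_{1..(n + n).+1}, [/\ m ix0 = 0%N, xydeg m = k & p = 'X_[m]]).

Definition B'k (k : int) : B -> Prop :=
  subspace_sum (fun i : nat => image_of (fun f => f * x0 ^+ i) (Bk (k - i%:Z))).

Definition H'k (k : int) (f : B) : Prop := B'k k f /\ Dop f = 0.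

Implicit Types (G : {vspace mat}) (M N : B -> Prop).

Definition is_submodule G M :=
  is_subspace M /\ forall A f, A \in G -> M f -> M (act A f).

Definition irreducible_module G M :=
  [/\ is_submodule G M, exists2 f, M f & f != 0 &
      forall N, is_submodule G N -> (forall f, N f -> M f) ->
        (forall f, N f -> f = 0) \/ (forall f, M f -> N f)].

Definition is_weight_vector (v : B) :=
  v != 0 /\ forall i : 'I_n, exists c : F, act (so_gl i i) v = c *: v.

Definition is_singular (v : B) :=
  [/\ forall i j : 'I_n, (i < j)%N -> act (so_gl i j) v = 0,
      forall i j : 'I_n, (i < j)%N -> act (so_up i j) v = 0 &
      forall i : 'I_n, act (so_0y i) v = 0].

Definition highest_weight_type M :=
  is_submodule so_odd M /\
  exists v, [/\ M v, is_weight_vector v, is_singular v &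
    forall N, is_submodule so_odd N -> N v -> forall f, M f -> N f].

Definition GK_type M :=
  [/\ ~ finite_dim M, irreducible_module so_odd M &
      exists (I : eqType) (U : I -> B -> Prop),
        (forall i, finite_dim (U i) /\ irreducible_module Kalg (U i)) /\
        direct_sum M U].

End OddOrthogonal.

Arguments so_odd F n : clear implicits.
Arguments Kalg F n : clear implicits.
Arguments Bk F n n1 n2 k : clear implicits.
Arguments B'k F n n1 n2 k : clear implicits.
Arguments H'k F n n1 n2 k : clear implicits.
Arguments irreducible_module {F n} n1 n2 G M.
Arguments highest_weight_type {F n} n1 n2 M.
Arguments GK_type {F n} n1 n2 M.
Arguments etaop {F n} n1 n2 f.
Arguments Dop {F n} n1 n2 f.
Arguments act {F n} n1 n2 A f.

(* Main.v *)
(* Write the action as E_{a,b} = u_a d_b, where the u_a, d_a satisfy the canonical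
   commutation relations and (u_a, d_a) is (x_a, d/dx_a) or (d/dx_a, - x_a).  With a'
   the index dual to a, D' = sum_a d_a d_a' and eta' = sum_a u_a u_a' commute with
   o(2n+1) and [D', eta'] = 4 (k + n2 - n1) + 2 on B'_<k>.  No partial sum of these
   scalars vanishes, and D' is locally nilpotent, so sl2-theory gives
   B'_<k> = (+)_i eta'^i H'_<k-2i>.

   For the irreducibility, grade by a degree that is lowered by suitable elements of
   the Lie algebra.  A vector of H'_<k> of minimal degree in a submodule is killed by
   them, and contracting these equations with D' f = 0 forces, for k in the given
   range, f to be a multiple of x_1^(-k).  Hence any two nonzero submodules share this
   vector.  It is anisotropic for the contravariant form in which d_a is adjoint to
   u_a; applied to a submodule and its orthogonal, this shows that the orthogonal is
   zero, so that the submodule fills all (finite-dimensional) graded pieces.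

   If n1 = n2 = n, a harmonic polynomial is determined by its 1-jet along x_0 = 0.
   Polynomials in x, y decompose under the sl2 spanned by P = - sum_i x_i d/dy_i and
   Q = sum_i (d/dx_i) y_i, which commutes with K, and each bihomogeneous piece of
   ker P is irreducible under K by the same criterion. *)
Require Import Defs.
From Stdlib Require Import Classical FunctionalExtensionality PropExtensionality.
From HB Require Import structures.
From mathcomp Require Import all_boot all_order all_algebra.
From mathcomp Require Import zify ring.

Set Implicit Arguments.
Unset Strict Implicit.
Unset Printing Implicit Defensive.

Import Order.TTheory GRing.Theory Num.Theory.
Local Open Scope ring_scope.

(** Over an arbitrary field of characteristic 0 the contravariant form has no positivity, so a
    submodule could meet its orthogonal. Hence irreducibility is tested on one explicit vector
    shared by all nonzero submodules, whose norm is a nonzero integer times a nonzero square. Since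
    [H'_<k>] has infinite dimension, a submodule and its orthogonal are compared inside the
    eigenspaces of one element of the Lie algebra, where the degree is bounded. The hypothesis on
    [k] says exactly that [k <= 0] and [2k + d <= 3], where [d = 2(n2 - n1) + 1] is the number of
    middle variables ([x_0] and the [x_r], [y_r] with [n1 < r <= n2]). A lowest vector involving a
    variable dual to a swapped one would force [2k + d >= 4]; this is the origin of the bound.
    Oddness of [d] keeps the sl2 scalars nonzero. For [n2 < n] a positive root vector acts
    injectively, so that no singular vector exists. *)

Lemma pchar0_natr_eq0 (F : fieldType) : [pchar F] =i pred0 ->
  forall n : nat, (n%:R == 0 :> F) = (n == 0)%N.
Proof. by move/pcharf0P. Qed.

Lemma pchar0_intr_eq0 (F : fieldType) : [pchar F] =i pred0 ->
  forall z : int, (z%:~R == 0 :> F) = (z == 0).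
Proof.
move=> h [n|n]; first exact: pchar0_natr_eq0.
by rewrite NegzE mulrNz oppr_eq0 oppr_eq0; apply: pchar0_natr_eq0.
Qed.

Lemma natr_inj_char0 (F : fieldType) : [pchar F] =i pred0 ->
  injective (fun n : nat => n%:R : F).
Proof.
move=> h p q /eqP; rewrite -subr_eq0 => /eqP pq.
have : (p%:Z - q%:Z)%:~R == 0 :> F by rewrite rmorphB /= pq.
by rewrite pchar0_intr_eq0 // subr_eq0 => /eqP[].
Qed.

(** * Subspaces and sl2-decompositions *)

Section SubspaceTheory.
Variables (F : fieldType) (V : lmodType F).
Implicit Types (W : V -> Prop).

Lemma subspaceD W u v : is_subspace W -> W u -> W v -> W (u + v).
Proof. by move=> [_ h] Wu Wv; rewrite -[u]scale1r; apply: h. Qed.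

Lemma subspaceZ W (c : F) u : is_subspace W -> W u -> W (c *: u).
Proof. by move=> [h0 h] Wu; rewrite -[_ *: _]addr0; apply: h. Qed.

Lemma subspaceB W u v : is_subspace W -> W u -> W v -> W (u - v).
Proof.
by move=> hW Wu Wv; rewrite -scaleN1r; apply: subspaceD => //; apply: subspaceZ.
Qed.

Lemma subspace_bigsum W (I : eqType) (s : seq I) (P : pred I) (g : I -> V) :
  is_subspace W -> (forall i, i \in s -> P i -> W (g i)) -> W (\sum_(i <- s | P i) g i).
Proof.
move=> hW hg; rewrite big_seq_cond; elim/big_ind: _ => [|u v|i /andP[]].
- by case: hW.
- exact: subspaceD.
- exact: hg.
Qed.

Lemma image_subspace (h : {linear V -> V}) W :
  is_subspace W -> is_subspace (image_of h W).
Proof.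
move=> hW; split; first by exists 0; [case: hW | rewrite linear0].
move=> c _ _ [u Wu ->] [v Wv ->]; exists (c *: u + v); last by rewrite linearP.
by apply: (hW.2).
Qed.

Lemma pairs_uniq_sum (I : eqType) (U : I -> V -> Prop) (s : seq (I * V)) :
  (forall i, is_subspace (U i)) -> (forall p, p \in s -> U p.1 p.2) ->
  exists (t : seq I) (g : I -> V),
    [/\ uniq t, forall i, i \in t -> U i (g i) & \sum_(p <- s) p.2 = \sum_(i <- t) g i].
Proof.
move=> hU hs; exists (undup (map fst s)), (fun i => \sum_(p <- s | p.1 == i) p.2); split.
- exact: undup_uniq.
- move=> i _; apply: subspace_bigsum (hU i) _ => p sp /eqP <-; exact: hs.
rewrite (exchange_big_dep predT) //=; apply: eq_big_seq => p sp.
rewrite big_mkcond (bigD1_seq p.1) ?undup_uniq ?mem_undup ?map_f //= eqxx.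
by rewrite big1 ?addr0 // => i; rewrite eq_sym => /negPf->.
Qed.

(** [subspace_sum] allows a single vector per index, which does not survive concatenation of two
    lists. Lists of pairs do, and this form makes closure under addition immediate. *)
Lemma subspace_sumP (I : eqType) (U : I -> V -> Prop) (f : V) :
  (forall i, is_subspace (U i)) ->
  (subspace_sum U f <-> exists2 s : seq (I * V),
     (forall p, p \in s -> U p.1 p.2) & f = \sum_(p <- s) p.2).
Proof.
move=> hU; split=> [[s [g [hg ->]]]|[s hs ->]].
  exists [seq (i, g i) | i <- s]; last by rewrite big_map.
  by move=> _ /mapP[i si ->]; apply: hg.
by have [t [g [_ hg ->]]] := pairs_uniq_sum hU hs; exists t, g.
Qed.

Lemma subspace_sum_uniq (I : eqType) (U : I -> V -> Prop) (f : V) :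
  (forall i, is_subspace (U i)) -> subspace_sum U f ->
  exists (s : seq I) (g : I -> V),
    [/\ uniq s, forall i, i \in s -> U i (g i) & f = \sum_(i <- s) g i].
Proof.
by move=> hU /(subspace_sumP _ hU)[s hs ->]; exact: pairs_uniq_sum.
Qed.

Lemma subspace_sum0 (I : eqType) (U : I -> V -> Prop) : subspace_sum U 0.
Proof. by exists [::], (fun=> 0); split=> //; rewrite big_nil. Qed.

Lemma subspace_sumD (I : eqType) (U : I -> V -> Prop) f g :
  (forall i, is_subspace (U i)) ->
  subspace_sum U f -> subspace_sum U g -> subspace_sum U (f + g).
Proof.
move=> hU /(subspace_sumP _ hU)[s hs ->] /(subspace_sumP _ hU)[t ht ->].
apply/(subspace_sumP _ hU); exists (s ++ t); last by rewrite big_cat.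
by move=> p; rewrite mem_cat => /orP[/hs|/ht].
Qed.

Lemma subspace_sum1 (I : eqType) (U : I -> V -> Prop) i f :
  U i f -> subspace_sum U f.
Proof.
move=> hf; exists [:: i], (fun=> f); split; last by rewrite big_seq1.
by move=> j; rewrite inE => /eqP->.
Qed.

Lemma subspace_sum_big (I J : eqType) (U : I -> V -> Prop) (s : seq J) (g : J -> V) :
  (forall i, is_subspace (U i)) ->
  (forall j, j \in s -> subspace_sum U (g j)) ->
  subspace_sum U (\sum_(j <- s) g j).
Proof.
move=> hU hg; rewrite big_seq; elim/big_ind: _ => //.
- exact: subspace_sum0.
- by move=> u v; apply: subspace_sumD.
Qed.

Lemma iter_linear (h : {linear V -> V}) i : linear (iter i h).
Proof. by elim: i => [|i IH] c u v //; rewrite !iterS IH linearP. Qed.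

HB.instance Definition _ (h : {linear V -> V}) i :=
  GRing.isLinear.Build F V V _ (iter i h) (iter_linear h i).

End SubspaceTheory.

(** * sl2-theory for a locally nilpotent lowering operator *)

Section Sl2.
Variables (F : fieldType) (V : lmodType F).
Variables (W : int -> V -> Prop) (D E : {linear V -> V}) (lam : int -> F).
Hypothesis W_sub : forall k, is_subspace (W k).
Hypothesis D_W : forall k f, W k f -> W (k - 2) (D f).
Hypothesis E_W : forall k f, W k f -> W (k + 2) (E f).
Hypothesis comm_DE : forall k f, W k f -> D (E f) = E (D f) + lam k *: f.
Hypothesis D_nilp : forall k f, W k f -> exists L, iter L D f = 0.

Definition ker_in k f := W k f /\ D f = 0.

(** The scalar picked up when [D] is moved through [i] factors [E] onto a vector of the kernel.
    Nonvanishing is assumed only for the scalars met below a weight [k <= 0]: for the second sl2,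
    that of [polP] and [polQ], it fails at positive weights. *)
Definition lamsum k i := \sum_(j < i) lam (k + 2 * j%:Z).

Hypothesis lamsum_neq0 : forall k i, k <= 0 -> lamsum (k - 2 * i.+1%:Z) i.+1 != 0.

Lemma ker_in_sub k : is_subspace (ker_in k).
Proof.
split=> [|c u v [Wu Du] [Wv Dv]].
  by split; [case: (W_sub k) | rewrite linear0].
by split; [apply: (W_sub k).2 | rewrite linearP Du Dv scaler0 addr0].
Qed.

Lemma iterE_W i k f : W k f -> W (k + 2 * i%:Z) (iter i E f).
Proof.
elim: i => [|i IH] hf /=; first by rewrite mulr0 addr0.
have -> : k + 2 * i.+1%:Z = k + 2 * i%:Z + 2 by lia.
by apply: E_W; apply: IH.
Qed.

Lemma D_iterE k i f : ker_in k f ->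
  D (iter i.+1 E f) = lamsum k i.+1 *: iter i E f.
Proof.
move=> [Wf Df]; elim: i => [|i IH].
  by rewrite /lamsum big_ord1 mulr0 addr0 /= (comm_DE Wf) Df linear0 add0r.
rewrite iterS (comm_DE (iterE_W i.+1 Wf)) IH linearZ /= -scalerDl.
by rewrite [lamsum _ i.+2]/lamsum big_ord_recr.
Qed.

Lemma iterD_iterE k i f : k <= 0 -> ker_in (k - 2 * i%:Z) f ->
  exists2 c, c != 0 & iter i D (iter i E f) = c *: f.
Proof.
elim: i k f => [|i IH] k f k0 hf.
  by exists 1; rewrite ?oner_eq0 // scale1r.
have [c c0 hc] : exists2 c, c != 0 & iter i D (iter i E f) = c *: f.
  apply: (IH (k - 2)); first lia.
  by move: hf; congr (ker_in _ f); lia.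
exists (lamsum (k - 2 * i.+1%:Z) i.+1 * c).
  by rewrite mulf_neq0 // lamsum_neq0.
rewrite iterSr (D_iterE i hf) linearZ /= hc scalerA //.
Qed.

Lemma iterD_iterE_gt k i j f : ker_in k f -> (i < j)%N -> iter j D (iter i E f) = 0.
Proof.
move=> hf; elim: j i => // j IH [|i] lij; rewrite iterSr.
  by rewrite hf.2 linear0.
by rewrite (D_iterE i hf) linearZ /= IH ?scaler0.
Qed.

Lemma iterE_inj k i f : k <= 0 -> ker_in (k - 2 * i%:Z) f -> iter i E f = 0 -> f = 0.
Proof.
move=> k0 hf f0; have [c c0] := iterD_iterE k0 hf.
by rewrite f0 linear0 => /esym/eqP; rewrite scaler_eq0 (negPf c0) => /eqP.
Qed.

Local Notation piece k := (fun i : nat => image_of (iter i E) (ker_in (k - 2 * i%:Z))).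

(** Induction on the nilpotency order of [D] at [f]. Each term [E^i h] of [D f] is the image under
    [D] of [E^(i+1) h] divided by a nonzero scalar; after subtracting these preimages from [f], a
    vector of the kernel is left. *)
Lemma iterE_pieces_sum k f : k <= 0 -> W k f -> subspace_sum (piece k) f.
Proof.
move=> k0 Wf; have [L hL] := D_nilp Wf.
have hsub j i : is_subspace (piece j i) by exact/image_subspace/ker_in_sub.
elim: L k f k0 Wf hL => [|L IH] k f k0 Wf.
  by move=> /= ->; exact: subspace_sum0.
rewrite iterSr => hL.
have [] := (subspace_sumP (D f) (hsub (k - 2))).1 (IH (k - 2) (D f) _ (D_W Wf) hL).
  by lia.
move=> s hs Df.
pose P (p : nat * V) (q : V) := piece k p.1.+1 q /\ D q = p.2.
have hP p : p \in s -> exists q, P p q.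
  move=> /hs[h hh hp]; have hh' : ker_in (k - 2 * p.1.+1%:Z) h.
    by move: hh; congr (ker_in _ h); lia.
  have l0 := lamsum_neq0 p.1 k0.
  exists ((lamsum (k - 2 * p.1.+1%:Z) p.1.+1)^-1 *: iter p.1.+1 E h); split.
    apply: subspaceZ => //; by exists h.
  by rewrite linearZ /= -/(iter p.1.+1 E h) (D_iterE _ hh') scalerA mulVf // scale1r.
(* The preimages are collected into a function by recursion on the finite list [s], without an axiom
   of choice. *)
have {hP} [g hg] : exists g : nat * V -> V, forall p, p \in s -> P p (g p).
  elim: s hP {hs Df} => [|p s IHs] hP; first by exists (fun=> 0).
  have [|g hg] := IHs; first by move=> q sq; apply: hP; rewrite inE sq orbT.
  have [q hq] := hP p (mem_head _ _).
  exists (fun r => if r == p then q else g r) => r; rewrite inE.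
  by case: eqP => [->|_ /= sr] //; exact: hg.
rewrite -[f](subrK (\sum_(p <- s) g p)); apply: subspace_sumD => //; last first.
  apply: subspace_sum_big => // p sp; apply: (@subspace_sum1 _ _ _ _ p.1.+1).
  exact: (hg p sp).1.
apply: (@subspace_sum1 _ _ _ _ 0%N); exists (f - \sum_(p <- s) g p) => //.
rewrite mulr0 subr0; split.
  apply: subspaceB => //; apply: subspace_bigsum => // p sp _.
  have [[h [Wh _] ->] _] := hg p sp.
  by have := iterE_W p.1.+1 Wh; rewrite subrK.
rewrite linearB linear_sum Df /= -sumrB big_seq big1 // => p sp.
by rewrite (hg p sp).2 subrr.
Qed.

Lemma iterE_pieces_direct k : k <= 0 -> direct_sum (W k) (piece k).
Proof.
move=> k0; split=> [i||s g us hg s0 i si].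
- exact/image_subspace/ker_in_sub.
- move=> f; split; first exact: iterE_pieces_sum.
  move=> [s [g [hg ->]]]; apply: subspace_bigsum => // i si _.
  by have [h [Wh _] ->] := hg i si; have := iterE_W i Wh; rewrite subrK.
(* Descending induction on [j]: [D^j] kills the terms of smaller index, and those of larger index
   vanish by induction. The sum of [s] serves as an upper bound for its members. *)
- have H M : forall j, j \in s -> (\sum_(i <- s) i < j + M)%N -> g j = 0.
    elim: M => [|M IH] j sj.
      by rewrite addn0 (big_rem j) //= ltnNge leq_addr.
    move=> hj; have [h hh gh] := hg j sj.
    have : iter j D (\sum_(i <- s) g i) = 0 by rewrite s0 linear0.
    rewrite linear_sum (bigD1_seq j) //= big_seq_cond big1 ?addr0; last first.
      move=> l /andP[sl]; rewrite neq_ltn => /orP[llj|ltj].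
        by have [h' hh' ->] := hg l sl; apply: iterD_iterE_gt hh' llj.
      by rewrite IH ?linear0 //; lia.
    rewrite gh; have [c c0 ->] := iterD_iterE k0 hh.
    by move/eqP; rewrite scaler_eq0 (negPf c0) /= => /eqP->; rewrite linear0.
  by apply: (H (\sum_(i <- s) i).+1 i si); lia.
Qed.

(** The point is that [E f] in the kernel of [D] must vanish. The pieces of [E f] are those of [f]
    shifted by one, hence of index at least 1, while the kernel is the piece of index 0. *)
Lemma ker_in_image_direct k : k <= 0 ->
  direct_sum (W k) (fun b : bool => if b then ker_in k else image_of E (W (k - 2))).
Proof.
move=> k0; have hsub (b : bool) :
    is_subspace (if b then ker_in k else image_of E (W (k - 2))).
  by case: b; [exact: ker_in_sub | exact: image_subspace].
have E_inj f : W (k - 2) f -> D (E f) = 0 -> E f = 0.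
  move=> Wf DEf; have k2 : k - 2 <= 0 :> int by lia.
  have [hU /(_ f)[/(_ Wf) /(subspace_sum_uniq hU) [s [g [us hg ef]]] _] _] :=
    iterE_pieces_direct k2.
  have [_ _ ind] := iterE_pieces_direct k0.
  (* The relation [- E f + \sum_j E (g j) = 0] is read as one between pieces of weight [k], with
     [- E f] in position 0. *)
  pose g1 i := if i is j.+1 then E (g j) else - E f.
  apply: oppr_inj; rewrite oppr0 -[- E f]/(g1 0%N).
  apply: (ind (0%N :: map S s) g1); last exact: mem_head.
  - by rewrite /= map_inj_uniq ?us ?andbT //; [apply/mapP => -[] | exact: succn_inj].
  - move=> i; rewrite inE => /predU1P[->|/mapP[j sj ->]] /=.
      exists (- E f) => //; rewrite mulr0 subr0; split; last by rewrite linearN DEf oppr0.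
      rewrite -scaleN1r; apply: subspaceZ => //.
      by have := E_W Wf; rewrite subrK.
    have [h hh ->] := hg j sj; exists h => //.
    by move: hh; congr (ker_in _ h); lia.
  - by rewrite big_cons big_map /= -linear_sum -ef addNr.
split=> // [f|s g us hg s0 i si].
  split=> [Wf|[s [g [hg ->]]]]; last first.
    apply: subspace_bigsum => // b sb _; have := hg b sb.
    by case: (b) => [[]//|[h Wh ->]]; have := E_W Wh; rewrite subrK.
  have [hU _ _] := iterE_pieces_direct k0.
  have [s [g [hg ->]]] := iterE_pieces_sum k0 Wf.
  apply: subspace_sum_big => // [] [|j] /hg[h hh ->].
    by apply: (@subspace_sum1 _ _ _ _ true); move: hh; rewrite mulr0 subr0.
  apply: (@subspace_sum1 _ _ _ _ false); exists (iter j E h) => //.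
  have := iterE_W j hh.1; congr (W _ _); lia.
pose sg b := if b \in s then g b else 0.
have sgU b : if b then ker_in k (sg b) else image_of E (W (k - 2)) (sg b).
  rewrite /sg; case: (boolP (b \in s)) => [bs|_]; first by have := hg b bs; case: (b).
  have [] := hsub b; by case: (b).
have sg0 : sg true + sg false = 0.
  by rewrite -s0 (big_uniq _ us) big_mkcond big_bool.
have Dsg : D (sg false) = 0.
  have /(congr1 D) := sg0; rewrite linearD linear0 (sgU true).2 add0r //.
have sgF : sg false = 0.
  by case: (sgU false) Dsg => u Wu -> /(E_inj _ Wu).
have sgT : sg true = 0 by move: sg0; rewrite sgF addr0.
have : sg i = 0 by case: (i).
by rewrite /sg si.
Qed.

End Sl2.

Lemma ex_minimal (P : nat -> Prop) :
  (exists n, P n) -> exists2 n, P n & forall i, P i -> (n <= i)%N.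
Proof.
move=> [n0 hn0]; apply: NNPP => h.
have H n : forall i, (i < n)%N -> ~ P i.
  elim: n => // n IH i; rewrite ltnS => lin Pi; apply: h; exists i => // j Pj.
  by rewrite leqNgt; apply/negP => lji; apply: (IH j) => //; lia.
exact: (H n0.+1 n0).
Qed.

(** Take a matrix of maximal rank among those whose row space lies in [W]; a vector of [W] outside
    the row space would raise the rank. This gives Prop-valued subspaces access to matrix ranks. *)
Lemma subspace_rowspace (F : fieldType) (r : nat) (W : 'rV[F]_r -> Prop) :
  is_subspace W -> exists A : 'M[F]_r, forall v, W v <-> (v <= A)%MS.
Proof.
move=> hW; pose ok (A : 'M[F]_r) := forall v, (v <= A)%MS -> W v.
have [|d [A [okA dA]] dmin] :=
    @ex_minimal (fun d => exists A, ok A /\ d = (r - \rank A)%N).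
  exists (r - \rank (0%R : 'M[F]_r))%N, (0%R : 'M[F]_r); split=> // v.
  by rewrite submx0 => /eqP->; case: hW.
exists A => v; split; last exact: okA.
move=> Wv; apply/negPn/negP => nvA.
have /dmin : exists B, ok B /\ (r - \rank (A + v)%MS = r - \rank B)%N.
  exists (A + v)%MS; split=> // w /sub_addsmxP[[u1 u2] ->].
  apply: subspaceD => //; first by apply: okA; exact: submxMl.
  by rewrite [u2]mx11_scalar mul_scalar_mx; exact: subspaceZ.
have := rank_leq_row (A + v)%MS.
suff : (\rank A < \rank (A + v)%MS)%N by lia.
rewrite ltnNge; apply: contra nvA => h.
apply: submx_trans (addsmxSr A v) _.
by have := mxrank_leqif_sup (addsmxSl A v) => /leqifP; case: ifP => // _; lia.
Qed.

(** * Oscillator operators and the contravariant form *)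

Section Projection.
Variables (F : fieldType) (N : nat).
Local Notation B := {mpoly F[N]}.
Implicit Types (f g : B) (P : pred 'X_{1..N}).

Definition mproj P f : B := \sum_(m <- msupp f | P m) f@_m *: 'X_[m].

Lemma mcoeff_mproj P f m : (mproj P f)@_m = if P m then f@_m else 0.
Proof.
rewrite /mproj raddf_sum /=; have [mf|mf] := boolP (m \in msupp f); last first.
  rewrite big_seq_cond big1 => [|m' /andP[m'f _]].
    by rewrite (memN_msupp_eq0 mf) if_same.
  by rewrite mcoeffZ mcoeffX; case: eqP mf => [<-|]; rewrite ?m'f ?mulr0.
rewrite big_mkcond (bigD1_seq m) ?msupp_uniq //= mcoeffZ mcoeffX eqxx mulr1.
rewrite big1 ?addr0 // => m' /negPf m'm.
by case: ifP => // _; rewrite mcoeffZ mcoeffX m'm mulr0.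
Qed.

Lemma mproj_is_linear P : linear (mproj P).
Proof.
move=> c f g; apply/mpolyP => m; rewrite mcoeffD mcoeffZ !mcoeff_mproj.
by case: ifP; rewrite ?mcoeffD ?mcoeffZ ?mulr0 ?addr0.
Qed.

HB.instance Definition _ P :=
  GRing.isLinear.Build F B B _ (mproj P) (mproj_is_linear P).

Lemma mproj_supp P f m : m \in msupp (mproj P f) -> P m /\ m \in msupp f.
Proof. by rewrite !mcoeff_msupp mcoeff_mproj; case: ifP => //; rewrite eqxx. Qed.

Lemma mproj_id P f : (forall m, m \in msupp f -> P m) -> mproj P f = f.
Proof.
move=> hP; apply/mpolyP => m; rewrite mcoeff_mproj; case: ifP => // Pm.
by rewrite memN_msupp_eq0 //; apply/negP => /hP; rewrite Pm.
Qed.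

Lemma mproj_sum (T : eqType) (h : 'X_{1..N} -> T) f :
  f = \sum_(c <- undup [seq h m | m <- msupp f]) mproj (fun m => h m == c) f.
Proof.
apply/mpolyP => m; rewrite raddf_sum /=; have [mf|mf] := boolP (m \in msupp f).
  rewrite (bigD1_seq (h m)) ?undup_uniq ?mem_undup ?map_f //=.
  rewrite mcoeff_mproj eqxx big1 ?addr0 // => c /negPf.
  by rewrite mcoeff_mproj eq_sym => ->.
rewrite big1 ?memN_msupp_eq0 // => c _.
by rewrite mcoeff_mproj memN_msupp_eq0 // if_same.
Qed.

Definition supported P f := forall m, m \in msupp f -> P m.

Lemma supported_sub P : is_subspace (supported P).
Proof.
split=> [m|c u v hu hv m]; first by rewrite msupp0.
rewrite mcoeff_msupp mcoeffD mcoeffZ => h.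
have [/hu//|mu] := boolP (m \in msupp u).
have [/hv//|mv] := boolP (m \in msupp v).
by move: h; rewrite !(memN_msupp_eq0 mu, memN_msupp_eq0 mv) mulr0 addr0 eqxx.
Qed.

Lemma supportedP P f : supported P f <-> forall m, ~~ P m -> f@_m = 0.
Proof.
split=> [hf m Pm|hf m]; first by apply: memN_msupp_eq0; apply/negP => /hf; apply/negP.
by apply: contraTT => /hf h; rewrite mcoeff_msupp h eqxx.
Qed.

End Projection.

Section Weyl.
Variables (F : fieldType) (N : nat) (sw : 'I_N -> bool).
Hypothesis charF : [pchar F] =i pred0.
Local Notation B := {mpoly F[N]}.
Implicit Types (f g : B) (m : 'X_{1..N}) (a b : 'I_N).

(* Creation and annihilation operators; the Fourier-type substitution
   [x_a |-> d_a], [d_a |-> - x_a] is performed on the variables in [sw]. *)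
Definition up a f : B := if sw a then mderiv a f else 'X_a * f.
Definition dn a f : B := if sw a then - ('X_a * f) else mderiv a f.

Lemma up_is_linear a : linear (up a).
Proof.
move=> c f g; rewrite /up; case: (sw a); first by rewrite linearP.
by rewrite mulrDr scalerAr.
Qed.

HB.instance Definition _ a := GRing.isLinear.Build F B B _ (up a) (up_is_linear a).

Lemma dn_is_linear a : linear (dn a).
Proof.
move=> c f g; rewrite /dn; case: (sw a); last by rewrite linearP.
by rewrite mulrDr opprD scalerN scalerAr.
Qed.

HB.instance Definition _ a := GRing.isLinear.Build F B B _ (dn a) (dn_is_linear a).

Lemma mderivXU a b : mderiv a ('X_b : B) = (a == b)%:R.
Proof.
rewrite mderivX mnm1E eq_sym; case: eqP => [->|_]; last by rewrite scale0r.
rewrite scale1r; have -> : (U_(b) - U_(b))%MM = 0%MM :> 'X_{1..N}.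
  by apply/mnmP => i; rewrite mnmBE subnn mnm0E.
by rewrite mpolyX0.
Qed.

Lemma up_comm a b f : up a (up b f) = up b (up a f).
Proof.
rewrite /up; have [ha|ha] := boolP (sw a); have [hb|hb] := boolP (sw b); rewrite /=.
- exact: mderiv_comm.
- rewrite mderivM mderivXU; case: eqP => [e|]; last by rewrite mul0r add0r.
  by move: hb; rewrite -e ha.
- rewrite mderivM mderivXU; case: eqP => [e|]; last by rewrite mul0r add0r.
  by move: ha; rewrite -e hb.
- exact: mulrCA.
Qed.

Lemma dn_comm a b f : dn a (dn b f) = dn b (dn a f).
Proof.
rewrite /dn; have [ha|ha] := boolP (sw a); have [hb|hb] := boolP (sw b); rewrite /=.
- by rewrite !mulrN; congr (- - _); exact: mulrCA.
- rewrite linearN /= mderivM mderivXU; case: eqP => [e|]; last by rewrite mul0r add0r.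
  by move: hb; rewrite e ha.
- rewrite linearN /= mderivM mderivXU; case: eqP => [e|]; last by rewrite mul0r add0r.
  by move: ha; rewrite e hb.
- exact: mderiv_comm.
Qed.

Lemma dn_up a b f : dn b (up a f) = up a (dn b f) + (b == a)%:R *: f.
Proof.
rewrite /up /dn; have [ha|ha] := boolP (sw a); have [hb|hb] := boolP (sw b); rewrite /=.
- rewrite linearN /= mderivM mderivXU eq_sym; case: eqP => [->|_].
    by rewrite mul1r scale1r opprD addrAC addNr add0r.
  by rewrite mul0r add0r scale0r addr0.
- rewrite mderiv_comm; case: eqP => [e|]; last by rewrite scale0r addr0.
  by move: hb; rewrite e ha.
- rewrite mulrN mulrCA; case: eqP => [e|]; last by rewrite scale0r addr0.
  by move: ha; rewrite -e hb.
- rewrite mderivM mderivXU addrC; case: eqP => _.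
    by rewrite mul1r scale1r.
  by rewrite mul0r scale0r.
Qed.

Lemma mcoeff_Xmul a f m :
  ('X_a * f)@_m = if (0 < m a)%N then f@_(m - U_(a)) else 0.
Proof.
case: ifP => ma.
  have e : m = (m - U_(a) + U_(a))%MM.
    by apply/mnmP => i; rewrite mnmDE mnmBE mnm1E; case: eqP => [<-|]; lia.
  by rewrite [in LHS]e mulrC addmC mcoeffMX.
rewrite mulrC; apply: memN_msupp_eq0; rewrite (perm_mem (msuppMX f U_(a))).
by apply/mapP => -[m' _ e]; move: ma; rewrite e mnmDE mnm1E eqxx; lia.
Qed.

Lemma mcoeff_Xmulr a f m : ('X_a * f)@_(m + U_(a)) = f@_m.
Proof. by rewrite mulrC addmC mcoeffMX. Qed.

Lemma mcoeff_up_dn a f m :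
  (up a (dn a f))@_m = (if sw a then - (m a).+1%:R else (m a)%:R) * f@_m.
Proof.
rewrite /up /dn; case: (sw a).
  by rewrite linearN mcoeffN mcoeff_mderiv mcoeff_Xmulr mulNr mulr_natl.
rewrite mcoeff_Xmul mcoeff_mderiv; case: ifP => ma.
  have -> : (m - U_(a) + U_(a) = m)%MM.
    by apply/mnmP => i; rewrite mnmDE mnmBE mnm1E; case: eqP => [<-|]; lia.
  rewrite mulr_natl mnmBE mnm1E eqxx; congr (_ *+ _); lia.
by have -> : m a = 0%N by [lia]; rewrite mul0r.
Qed.

Lemma mcoeff_dn_up a f m :
  (dn a (up a f))@_m = (if sw a then - (m a)%:R else (m a).+1%:R) * f@_m.
Proof.
rewrite dn_up eqxx scale1r mcoeffD mcoeff_up_dn -[X in _ + X]mul1r -mulrDl.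
by congr (_ * _); case: (sw a); rewrite -natr1; ring.
Qed.

(* The weights are chosen so that [dn a] is adjoint to [up a]. *)
Definition mweightF m : F := \prod_i (((-1) ^+ sw i) ^+ m i * (m i)`!%:R).

Definition bform f g : F := \sum_(m <- msupp f) mweightF m * f@_m * g@_m.

Lemma mweightF_neq0 m : mweightF m != 0.
Proof.
apply/prodf_neq0 => i _; rewrite mulf_neq0 //; first by rewrite !expf_neq0 // oppr_eq0 oner_eq0.
by rewrite pchar0_natr_eq0 // -lt0n fact_gt0.
Qed.

Lemma mweightFU m a :
  mweightF (m + U_(a)) = (-1) ^+ sw a * (m a).+1%:R * mweightF m.
Proof.
rewrite /mweightF (bigD1 a) //= [in RHS](bigD1 a) //= mnmDE mnm1E eqxx addn1.
rewrite exprS factS natrM.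
under eq_bigr => i /negPf ia do rewrite mnmDE mnm1E eq_sym ia addn0.
ring.
Qed.

Lemma bformE (s : seq 'X_{1..N}) f g : uniq s -> {subset msupp f <= s} ->
  bform f g = \sum_(m <- s) mweightF m * f@_m * g@_m.
Proof.
move=> us sub; rewrite /bform [RHS](bigID (fun m => m \in msupp f)) /=.
rewrite [X in _ + X]big1 ?addr0; last first.
  by move=> m /memN_msupp_eq0 ->; rewrite mulr0 mul0r.
rewrite -[RHS]big_filter; apply: perm_big; apply: uniq_perm.
- exact: msupp_uniq.
- exact: filter_uniq.
by move=> m; rewrite mem_filter; case: (boolP (m \in msupp f)) => // /sub ->.
Qed.

Lemma bformC f g : bform f g = bform g f.
Proof.
pose s := undup (msupp f ++ msupp g).
rewrite !(@bformE s) ?undup_uniq //.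
- by apply: eq_bigr => m _; ring.
- by move=> m mg; rewrite mem_undup mem_cat mg orbT.
- by move=> m mf; rewrite mem_undup mem_cat mf.
Qed.

Lemma bform_is_linear f : linear_for *%R (bform f).
Proof.
move=> c u v; rewrite /bform mulr_sumr -big_split; apply: eq_bigr => m _.
by rewrite mcoeffD mcoeffZ /=; ring.
Qed.

HB.instance Definition _ f :=
  GRing.isLinear.Build F B F *%R (bform f) (bform_is_linear f).

Lemma bformX m g : bform 'X_[m] g = mweightF m * g@_m.
Proof. by rewrite /bform msuppX big_seq1 mcoeffX eqxx mulr1. Qed.

Lemma bform_adjoint (r s : {linear B -> B}) :
  (forall m m', bform (r 'X_[m]) 'X_[m'] = bform 'X_[m] (s 'X_[m'])) ->
  forall f g, bform (r f) g = bform f (s g).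
Proof.
move=> h f g; rewrite (mpolyE g) !linear_sum; apply: eq_bigr => m' _.
rewrite !linearZ /=; congr (_ * _).
rewrite [LHS]bformC [RHS]bformC (mpolyE f) !linear_sum; apply: eq_bigr => m _.
by rewrite !linearZ /=; congr (_ * _); rewrite [LHS]bformC [RHS]bformC h.
Qed.

Lemma bform_up a f g : bform (up a f) g = bform f (dn a g).
Proof.
apply: bform_adjoint => {f g} m m' /=; rewrite bformC !bformX /up /dn.
have X a' n n' : ('X_a' * 'X_[n] : B)@_n' = (n + U_(a') == n')%MM%:R.
  by rewrite mulrC -mpolyXD mcoeffX.
case: (boolP (sw a)) => sa /=.
  rewrite mcoeffN X mcoeff_mderiv mcoeffX eq_sym; case: eqP => [<-|]; last by rewrite mul0rn oppr0 !mulr0.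
  by rewrite mweightFU sa -mulr_natr; ring.
rewrite X mcoeff_mderiv mcoeffX [m' == _]eq_sym; case: eqP => [<-|]; last by rewrite mul0rn !mulr0.
by rewrite mweightFU (negPf sa) expr0 mul1r mulr1 mulrC.
Qed.

Lemma bform_dn a f g : bform (dn a f) g = bform f (up a g).
Proof. by rewrite bformC -bform_up bformC. Qed.

Lemma bform_supported (P Q : pred 'X_{1..N}) f g :
  supported P f -> supported Q g -> (forall m, P m -> ~~ Q m) -> bform f g = 0.
Proof.
move=> hf hg PQ; rewrite /bform big_seq big1 // => m /hf /PQ h.
by rewrite (proj1 (supportedP Q g) hg m h) mulr0.
Qed.

End Weyl.

(** * Irreducibility from a contravariant form *)

Section Duality.
Variables (F : fieldType) (N : nat) (sw : 'I_N -> bool).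
Hypothesis charF : [pchar F] =i pred0.
Local Notation B := {mpoly F[N]}.
Local Notation bform := (@bform F N sw).
Implicit Types (f g : B) (W H M : B -> Prop).

Definition mpoly_of_row K (v : 'rV[F]_#|{: 'X_{1..N < K}}|) : B :=
  \sum_i v 0 i *: 'X_[(enum_val i : 'X_{1..N < K})].

Lemma mpoly_of_row_is_linear K : linear (@mpoly_of_row K).
Proof.
move=> c u v; rewrite /mpoly_of_row scaler_sumr -big_split; apply: eq_bigr => i _ /=.
by rewrite !mxE scalerDl scalerA.
Qed.

HB.instance Definition _ K := GRing.isLinear.Build F 'rV[F]_#|{: 'X_{1..N < K}}| B _
  (@mpoly_of_row K) (@mpoly_of_row_is_linear K).

Local Notation phi := (@mpoly_of_row _).

(** A dimension count in the space of polynomials of bounded degree: if [W] had smaller dimension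
    than [H], the linear conditions of being orthogonal to [W] would have a nonzero solution in
    [H]. *)
Lemma bounded_perp_trivial K W H : is_subspace W -> is_subspace H ->
  (forall f, W f -> H f) -> (forall f, H f -> (msize f <= K)%N) ->
  (forall f, H f -> (forall w, W w -> bform f w = 0) -> f = 0) ->
  forall f, H f -> W f.
Proof.
move=> hW hH WH HK perp.
have phiP f : (msize f <= K)%N -> phi (\row_i f@_(enum_val i : 'X_{1..N < K})) = f.
  move=> /mpolywE {2}->; rewrite /mpoly_of_row (reindex (@enum_rank 'X_{1..N < K})) /=; last first.
    by apply: onW_bij; exact: enum_rank_bij.
  by apply: eq_bigr => i _; rewrite mxE enum_rankK.
have phi_inj (v : 'rV[F]_#|{: 'X_{1..N < K}}|) : phi v = 0 -> v = 0.
  move=> pv0; apply/rowP => j; rewrite mxE.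
  have := congr1 (mcoeff (enum_val j : 'X_{1..N < K})) pv0.
  rewrite raddf_sum mcoeff0 (bigD1 j) //= mcoeffZ mcoeffX eqxx mulr1.
  rewrite big1 ?addr0 // => i ij; rewrite mcoeffZ mcoeffX.
  case: eqP => [/val_inj /enum_val_inj e|]; last by rewrite mulr0.
  by move: ij; rewrite e eqxx.
have phi_sub W' : is_subspace W' -> is_subspace (fun v => W' (@mpoly_of_row K v)).
  move=> [h0 h]; split=> [|c u v Wu Wv]; first by rewrite linear0.
  by rewrite linearP; apply: h.
have [A hA] := subspace_rowspace (phi_sub _ hW).
have [C hC] := subspace_rowspace (phi_sub _ hH).
suff CA : (C <= A)%MS.
  move=> f Hf; have fK := HK f Hf; rewrite -(phiP f fK).
  by apply/hA; apply: submx_trans CA; apply/hC; rewrite phiP.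
have AC : (A <= C)%MS.
  by apply/row_subP => i; apply/hC; apply: WH; apply/hA; exact: row_sub.
rewrite -(mxrank_leqif_sup AC).2 eqn_leq mxrankS //= leqNgt; apply/negP => rk.
(* The Gram matrix between bases of [H] and [W] has more rows than columns; a vector of its left
   kernel is a nonzero element of [H] orthogonal to [W]. *)
pose G := \matrix_(i < \rank C, j < \rank A)
  bform (phi (row i (row_base C))) (phi (row j (row_base A))).
have : kermx G != 0.
  rewrite kermx_eq0 /row_free neq_ltn; apply/orP; left.
  exact: leq_ltn_trans (rank_leq_col G) rk.
case/rowV0Pn => u /sub_kermxP uG u0.
pose v := u *m row_base C.
have vC : (v <= C)%MS by rewrite -(eq_row_base C); exact: submxMl.
have v0 : v = 0.
  apply: phi_inj; apply: perp => [|w Ww]; first exact/hC.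
  have wK : (msize w <= K)%N by apply/HK/WH.
  rewrite -(phiP w wK); set w' := \row_i _.
  have : (w' <= row_base A)%MS by rewrite eq_row_base; apply/hA; rewrite phiP.
  case/submxP => t ->; rewrite (mulmx_sum_row t) (linear_sum (@mpoly_of_row K)).
  rewrite linear_sum big1 // => j _; rewrite linearZ /= linearZ /= bformC /v mulmx_sum_row.
  rewrite (linear_sum (@mpoly_of_row K)) linear_sum.
  suff -> : \sum_i bform (phi (row j (row_base A))) (phi (u 0 i *: row i (row_base C))) = (u *m G) 0 j.
    by rewrite uG mxE mulr0.
  rewrite mxE; apply: eq_bigr => i _.
  by rewrite (linearZ_LR (@mpoly_of_row K)) linearZ /= [in RHS]mxE bformC.
case/eqP: u0; apply: (row_free_inj (row_base_free C)).
by rewrite -/v v0 mul0mx.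
Qed.

Definition stable (R : (B -> B) -> Prop) M :=
  is_subspace M /\ forall r f, R r -> M f -> M (r f).

(** Lagrange interpolation: on [f], the projection to the eigenvalue [c] is the product of the
    [(T - b) / (c - b)] over the finitely many other eigenvalues [b] occurring in [f]. *)
Lemma stable_mproj (R : (B -> B) -> Prop) (T : B -> B) (tau : 'X_{1..N} -> F) M c f :
  R T -> (forall f m, (T f)@_m = tau m * f@_m) -> stable R M ->
  M f -> M (mproj (fun m => tau m == c) f).
Proof.
move=> RT tauP [hM MR] Mf.
have H (s : seq F) : c \notin s -> exists2 g, M g &
    forall m, g@_m = (\prod_(b <- s) ((tau m - b) / (c - b))) * f@_m.
  elim: s => [|b s IH].
    by exists f => // m; rewrite big_nil mul1r.
  rewrite inE negb_or => /andP[cb /IH[g Mg hg]].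
  exists ((c - b)^-1 *: (T g - b *: g)).
    by apply: subspaceZ => //; apply: subspaceB => //; [exact: MR | exact: subspaceZ].
  move=> m; rewrite mcoeffZ mcoeffB mcoeffZ tauP hg big_cons; ring.
pose s := [seq b <- [seq tau m | m <- msupp f] | b != c].
have [|g Mg hg] := H s; first by rewrite mem_filter eqxx.
suff -> : mproj (fun m => tau m == c) f = g by [].
apply/mpolyP => m; rewrite mcoeff_mproj hg.
have [mf|mf] := boolP (m \in msupp f); last by rewrite memN_msupp_eq0 // mulr0 if_same.
case: eqP => [->|/eqP tc].
  rewrite big_seq big1 ?mul1r // => b; rewrite mem_filter => /andP[bc _].
  by rewrite divff // subr_eq0 eq_sym.
suff -> : \prod_(b <- s) ((tau m - b) / (c - b)) = 0 by rewrite mul0r.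
apply/eqP; rewrite prodf_seq_eq0; apply/hasP; exists (tau m).
  by rewrite mem_filter tc map_f.
by rewrite /= subrr mul0r.
Qed.

(* The orthogonal of [S] in [M] is stable, so it meets [S] in an anisotropic
   vector unless it vanishes; in the latter case [S] fills every bounded
   eigenspace of [T]. *)
Lemma stable_irreducible (R : (B -> B) -> Prop) (T : B -> B) (tau : 'X_{1..N} -> F) M :
  (forall r, R r -> exists2 r', R r' & forall f g, bform (r f) g = bform f (r' g)) ->
  R T -> (forall f m, (T f)@_m = tau m * f@_m) -> stable R M ->
  (forall c, exists K, forall f m, M f -> m \in msupp f -> tau m = c -> (mdeg m < K)%N) ->
  (forall S1 S2, stable R S1 -> stable R S2 ->
     (forall f, S1 f -> M f) -> (forall f, S2 f -> M f) ->
     (exists2 f, S1 f & f != 0) -> (exists2 f, S2 f & f != 0) ->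
     exists v, [/\ S1 v, S2 v & bform v v != 0]) ->
  forall S, stable R S -> (forall f, S f -> M f) ->
    (forall f, S f -> f = 0) \/ (forall f, M f -> S f).
Proof.
move=> adj RT tauP stM bound meet S stS SM.
have [S0|/not_all_ex_not[f0 nf0]] := classic (forall f, S f -> f = 0); [by left|right].
have [Sf0 f00] : S f0 /\ f0 != 0.
  by split; [apply: NNPP => h | apply/eqP => h]; apply: nf0 => // /h.
have [[hS SR] [hM MR]] := (stS, stM).
pose P f := M f /\ forall g, S g -> bform f g = 0.
have stP : stable R P.
  split; first split=> [|c u v [Mu hu] [Mv hv]].
  - by split=> [|g _]; [case: hM | rewrite bformC linear0].
  - split=> [|g Sg]; first exact: hM.2.
    by rewrite bformC linearP /= [bform g u]bformC [bform g v]bformC hu // hv // mulr0 addr0.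
  move=> r f Rr [Mf hf]; split=> [|g Sg]; first exact: MR.
  by have [r' Rr' ->] := adj r Rr; apply: hf; apply: SR.
have P0 f : P f -> f = 0.
  move=> Pf; apply/eqP; apply: contraT => f0_; exfalso.
  have [] := meet P S stP stS (fun f h => h.1) SM.
  - by exists f.
  - by exists f0.
  by move=> v [[_ hv] Sv]; rewrite hv ?eqxx.
move=> f Mf; rewrite (mproj_sum tau f); apply: subspace_bigsum => // c _ _.
pose Ic : B -> Prop := supported (fun m => tau m == c).
have sIc : is_subspace Ic by exact: supported_sub.
have [K hK] := bound c.
suff : S (mproj (fun m => tau m == c) f) /\ Ic (mproj (fun m => tau m == c) f) by case.
apply: (@bounded_perp_trivial K (fun f => S f /\ Ic f) (fun f => M f /\ Ic f)).
- by split=> [|d u v [Su Iu] [Sv Iv]]; split; [apply hS.1|apply sIc.1|apply hS.2|apply sIc.2].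
- by split=> [|d u v [Su Iu] [Sv Iv]]; split; [apply hM.1|apply sIc.1|apply hM.2|apply sIc.2].
- by move=> g [/SM Mg Ig].
- move=> g [Mg Ig]; rewrite msizeE; apply/bigmax_leqP_seq => m mg _.
  by apply: (hK g) => //; apply/eqP/Ig.
(* Here [h] is known to be orthogonal only to the eigenvectors of [S] for [c]. The other
   eigencomponents of [g] share no monomial with [h], and distinct monomials are orthogonal. *)
- move=> h [Mh Ih] hperp; apply: P0; split=> // g Sg.
  rewrite (mproj_sum tau g) linear_sum big1 // => b _.
  have [->|bc] := eqVneq b c.
    apply: hperp; split; first exact: (stable_mproj c RT tauP stS).
    by move=> m /mproj_supp[].
  apply: (@bform_supported _ _ _ (fun m => tau m == c) (fun m => tau m == b)) => //.
    by move=> m /mproj_supp[].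
  by move=> m /eqP->; rewrite eq_sym.
- split; first exact: (stable_mproj c RT tauP stM).
  by move=> m /mproj_supp[].
Qed.

End Duality.

(** * The invariant Laplacian and vectors of lowest degree *)

Section Weights.
Variables (F : fieldType) (N : nat) (sw : 'I_N -> bool).
Hypothesis charF : [pchar F] =i pred0.
Local Notation B := {mpoly F[N]}.
Local Notation up := (@up F N sw).
Local Notation dn := (@dn F N sw).
Implicit Types (f g : B) (m : 'X_{1..N}) (a b : 'I_N) (c : 'I_N -> int) (P Q : pred 'X_{1..N}).

Lemma supported_Xmul P Q a f : supported P f -> (forall m, P m -> Q (m + U_(a))%MM) ->
  supported Q ('X_a * f).
Proof.
move=> hf PQ m; rewrite mcoeff_msupp mcoeff_Xmul; case: ifP => [ma|]; last by rewrite eqxx.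
rewrite -mcoeff_msupp => /hf /PQ; congr Q; apply/mnmP => i.
by rewrite mnmDE mnmBE mnm1E; case: eqP => [<-|]; lia.
Qed.

Lemma supported_deriv P Q a f : supported P f -> (forall m, P (m + U_(a))%MM -> Q m) ->
  supported Q (mderiv a f).
Proof.
move=> hf PQ m; rewrite mcoeff_msupp mcoeff_mderiv => h; apply/PQ/hf.
by rewrite mcoeff_msupp; apply: contraNneq h => ->; rewrite mul0rn.
Qed.

Definition wt c m : int := \sum_a c a * (m a)%:Z.

Lemma wtU c m a : wt c (m + U_(a)) = wt c m + c a.
Proof.
rewrite /wt (bigD1 a) //= [in RHS](bigD1 a) //= mnmDE mnm1E eqxx.
under eq_bigr => i /negPf ia do rewrite mnmDE mnm1E eq_sym ia addn0.
by rewrite PoszD mulrDr mulr1 addrAC.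
Qed.

(** The amount by which [up a] shifts the weight, negative where [up a] is a derivative. *)
Definition swt c a := if sw a then - c a else c a.

Definition whom c (k : int) f := supported (fun m => wt c m == k) f.

Definition wbound c (L : int) f := supported (fun m => wt c m < L) f.

Lemma whom_sub c k : is_subspace (whom c k).
Proof. exact: supported_sub. Qed.

Lemma wbound_sub c L : is_subspace (wbound c L).
Proof. exact: supported_sub. Qed.

Lemma whom_up c k a f : whom c k f -> whom c (k + swt c a) (up a f).
Proof.
rewrite /up /swt => h; case: (sw a); first apply: supported_deriv h _ => m.
  by rewrite wtU => /eqP<-; lia.
by apply: supported_Xmul h _ => m /eqP h; rewrite wtU h.
Qed.

Lemma supportedN P f : supported P f -> supported P (- f).
Proof. by move=> h m; rewrite (perm_mem (msuppN f)) => /h. Qed.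

Lemma whom_dn c k a f : whom c k f -> whom c (k - swt c a) (dn a f).
Proof.
rewrite /dn /swt => h; case: (sw a).
  apply: supportedN; apply: supported_Xmul h _ => m /eqP h; rewrite wtU; lia.
by apply: supported_deriv h _ => m; rewrite wtU => /eqP<-; lia.
Qed.

Lemma wbound_up c L a f : wbound c L f -> wbound c (L + swt c a) (up a f).
Proof.
rewrite /up /swt => h; case: (sw a); first apply: supported_deriv h _ => m.
  by rewrite wtU; lia.
by apply: supported_Xmul h _ => m h; rewrite wtU; lia.
Qed.

Lemma wbound_dn c L a f : wbound c L f -> wbound c (L - swt c a) (dn a f).
Proof.
rewrite /dn /swt => h; case: (sw a).
  apply: supportedN; apply: supported_Xmul h _ => m h; rewrite wtU; lia.
by apply: supported_deriv h _ => m; rewrite wtU; lia.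
Qed.

Lemma wbound_le c L L' f : L <= L' -> wbound c L f -> wbound c L' f.
Proof. by move=> hL h m /h /=; lia. Qed.

Lemma wbound_ex c f : exists L : nat, wbound c L%:Z f.
Proof.
exists (\sum_(m <- msupp f) `|wt c m|.+1)%N => m mf.
rewrite (big_rem m mf) /=; lia.
Qed.

Lemma wbound0 c f : (forall a, 0 <= c a) -> wbound c 0 f -> f = 0.
Proof.
move=> hc h; apply/mpolyP => m; rewrite mcoeff0; apply: memN_msupp_eq0.
apply/negP => /h /=; apply/negP; rewrite -leNgt.
by apply: sumr_ge0 => a _; rewrite mulr_ge0.
Qed.

Definition lowers c (r : B -> B) := forall L f, wbound c L f -> wbound c (L - 1) (r f).

Lemma lowers_nilp c (r : B -> B) f : (forall a, 0 <= c a) -> lowers c r ->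
  exists L, iter L r f = 0.
Proof.
move=> hc hr; have [L hL] := wbound_ex c f; exists L.
elim: L f hL => [|L IH] f hL; first exact: wbound0 hL.
by rewrite iterSr; apply: IH; have := hr _ _ hL; congr (wbound _ _ _); lia.
Qed.

(** Choose [f] whose strict weight bound is least among the nonzero elements of [S]; a nonzero [r f]
    in [S] would have a smaller one. Nonnegative weights make these bounds well-founded. *)
Lemma lowest_vector c (S : B -> Prop) : (forall a, 0 <= c a) ->
  (exists2 f, S f & f != 0) -> exists f, [/\ S f, f != 0 &
    forall r, lowers c r -> S (r f) -> r f = 0].
Proof.
move=> hc [f0 Sf0 f00]; have [L0 hL0] := wbound_ex c f0.
have [|L [f [Sf fn0 fL]] Lmin] :=
  @ex_minimal (fun L => exists f, [/\ S f, f != 0 & wbound c L%:Z f]).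
  by exists L0, f0.
exists f; split=> // r hr Srf; apply/eqP; apply: contraT => rf0; exfalso.
case: L fL Lmin => [|L] fL Lmin; first by rewrite (wbound0 hc fL) eqxx in fn0.
suff : (L.+1 <= L)%N by rewrite ltnn.
apply: Lmin; exists (r f); split=> //.
by have := hr _ _ fL; congr (wbound _ _ _); lia.
Qed.

Lemma mderiv_eq0_supp a f m : mderiv a f = 0 -> m \in msupp f -> m a = 0%N.
Proof.
move=> f0; rewrite mcoeff_msupp => mf; apply/eqP; rewrite -leqn0 leqNgt.
apply/negP => ma; have := congr1 (mcoeff (m - U_(a))%MM) f0.
rewrite mcoeff0 mcoeff_mderiv.
have -> : (m - U_(a) + U_(a) = m)%MM.
  by apply/mnmP => i; rewrite mnmDE mnmBE mnm1E; case: eqP => [<-|]; lia.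
rewrite -mulr_natr => /eqP; rewrite mulf_eq0 (negPf mf) /=.
by rewrite (pchar0_natr_eq0 charF).
Qed.

End Weights.

Section Orthogonal.
Variables (F : fieldType) (N : nat) (sw : 'I_N -> bool) (inv : 'I_N -> 'I_N).
Hypothesis charF : [pchar F] =i pred0.
Hypothesis invK : involutive inv.
Hypothesis sw_inv : forall a, sw a -> ~~ sw (inv a).
Local Notation B := {mpoly F[N]}.
Local Notation up := (@up F N sw).
Local Notation dn := (@dn F N sw).
Implicit Types (f g : B) (m : 'X_{1..N}) (a b : 'I_N) (c : 'I_N -> int).

(* In the theorem: the indices of x_0 and of x_r, y_r for n1 < r <= n2. *)
Definition mid a := ~~ sw a && ~~ sw (inv a).

Lemma mid_inv a : mid (inv a) = mid a.
Proof. by rewrite /mid invK andbC. Qed.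

Lemma sum_split (V : nmodType) (u : 'I_N -> V) :
  \sum_a u a = \sum_(a | sw a) u a + \sum_(a | sw a) u (inv a) + \sum_(a | mid a) u a.
Proof.
rewrite (bigID sw) /= -addrA; congr (_ + _).
rewrite (bigID (fun a => sw (inv a))) /=; congr (_ + _).
rewrite (reindex_inj (inv_inj invK)) /=; apply: eq_bigl => a; rewrite invK.
by case: (boolP (sw a)) => [/sw_inv->|]; rewrite ?andbF.
Qed.

Definition lap f := \sum_a dn a (dn (inv a) f).
Definition colap f := \sum_a up a (up (inv a) f).

Lemma lap_is_linear : linear lap.
Proof.
move=> k f g; rewrite /lap scaler_sumr -big_split; apply: eq_bigr => a _ /=.
by rewrite !linearP.
Qed.
HB.instance Definition _ := GRing.isLinear.Build F B B _ lap lap_is_linear.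

Lemma colap_is_linear : linear colap.
Proof.
move=> k f g; rewrite /colap scaler_sumr -big_split; apply: eq_bigr => a _ /=.
by rewrite !linearP.
Qed.
HB.instance Definition _ := GRing.isLinear.Build F B B _ colap colap_is_linear.

Lemma sum_delta (V : lmodType F) b (u : 'I_N -> V) : \sum_a (a == b)%:R *: u a = u b.
Proof.
rewrite (bigD1 b) //= eqxx scale1r big1 ?addr0 // => a /negPf->.
by rewrite scale0r.
Qed.

Lemma sum_delta_inv (V : lmodType F) b (u : 'I_N -> V) :
  \sum_a (inv a == b)%:R *: u a = u (inv b).
Proof.
rewrite -(sum_delta (inv b)); apply: eq_bigr => a _; congr (_%:R *: _).
by rewrite (can2_eq invK invK).
Qed.

Lemma lap_up a f : lap (up a f) = up a (lap f) + 2%:R *: dn (inv a) f.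
Proof.
rewrite /lap linear_sum scaler_nat mulr2n.
rewrite -{1}(sum_delta a (fun b => dn (inv b) f)) -(sum_delta_inv a (fun b => dn b f)).
rewrite -!big_split; apply: eq_bigr => b _ /=.
by rewrite dn_up linearD linearZ /= dn_up -addrA.
Qed.

Lemma lap_dn a f : lap (dn a f) = dn a (lap f).
Proof.
rewrite /lap linear_sum; apply: eq_bigr => b _ /=.
by rewrite [RHS]dn_comm; congr (dn b _); rewrite dn_comm.
Qed.

Lemma colap_up a f : colap (up a f) = up a (colap f).
Proof.
rewrite /colap linear_sum; apply: eq_bigr => b _ /=.
by rewrite [RHS]up_comm; congr (up b _); rewrite up_comm.
Qed.

Lemma colap_dn a f : colap (dn a f) = dn a (colap f) - 2%:R *: up (inv a) f.
Proof.
apply/eqP; rewrite eq_sym subr_eq; apply/eqP.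
rewrite /colap linear_sum scaler_nat mulr2n.
rewrite -{1}(sum_delta a (fun b => up (inv b) f)) -(sum_delta_inv a (fun b => up b f)).
rewrite -!big_split; apply: eq_bigr => b _ /=.
by rewrite dn_up dn_up linearD linearZ /= -addrA [a == _]eq_sym [a == b]eq_sym [X in _ + X]addrC.
Qed.

Definition dcoef a : int := if sw a then -1 else 1.
Definition deg m := wt dcoef m.
Local Notation dhom := (whom dcoef).

Lemma swt_dcoef a : swt sw dcoef a = 1.
Proof. by rewrite /swt /dcoef; case: (sw a). Qed.

Lemma dhom_lap k f : dhom k f -> dhom (k - 2) (lap f).
Proof.
move=> h; apply: subspace_bigsum => [|a _ _]; first exact: whom_sub.
have := whom_dn (sw := sw) (a := a) (whom_dn (sw := sw) (a := inv a) h).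
by rewrite !swt_dcoef; congr (whom _ _ _); lia.
Qed.

Lemma dhom_colap k f : dhom k f -> dhom (k + 2) (colap f).
Proof.
move=> h; apply: subspace_bigsum => [|a _ _]; first exact: whom_sub.
have := whom_up (sw := sw) (a := a) (whom_up (sw := sw) (a := inv a) h).
by rewrite !swt_dcoef; congr (whom _ _ _); lia.
Qed.

(** A swapped variable contributes [-(m a + 1)] to the Euler operator [\sum_a up a dn a], which is
    therefore [deg - #|sw|]. The commutator of [lap] and [colap] is four times this operator plus
    [2N]. *)
Definition lam (k : int) : F := (4 * (k - #|sw|%:Z) + 2 * N%:Z)%:~R.

Lemma mcoeff_euler f m :
  (\sum_a up a (dn a f))@_m = (deg m - #|sw|%:Z)%:~R * f@_m.
Proof.
have -> : deg m - #|sw|%:Z =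
    \sum_a (if sw a then - (m a).+1%:Z else (m a)%:Z).
  rewrite -sum1_card -natz natr_sum [X in _ - X]big_mkcond /= -sumrB.
  by apply: eq_bigr => a _; rewrite /dcoef unfold_in; case: (sw a); lia.
rewrite raddf_sum /= rmorph_sum mulr_suml; apply: eq_bigr => a _ /=.
by rewrite mcoeff_up_dn; congr (_ * _); case: (sw a); rewrite ?rmorphN.
Qed.

Lemma lap_colap k f : dhom k f -> lap (colap f) = colap (lap f) + lam k *: f.
Proof.
move=> hf; have -> : lap (colap f) =
    colap (lap f) + 4%:R *: (\sum_a up a (dn a f)) + (2 * N)%:R *: f.
  have step a : lap (up a (up (inv a) f)) = up a (up (inv a) (lap f))
      + 2%:R *: up a (dn a f) + 2%:R *: up (inv a) (dn (inv a) f) + 2%:R *: f.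
    by rewrite !lap_up invK linearD linearZ /= dn_up eqxx scale1r scalerDr !addrA.
  rewrite {1}/colap linear_sum (eq_bigr _ (fun a _ => step a)) !big_split /=.
  congr (_ + _); last first.
    by rewrite sumr_const card_ord -scaler_nat scalerA -natrM mulnC.
  rewrite -addrA; congr (_ + _); rewrite -!scaler_sumr.
  rewrite [X in _ + _ *: X](reindex_inj (inv_inj invK)) /=.
  under [X in _ + _ *: X]eq_bigr => a _ do rewrite invK.
  by rewrite -scalerDl -natrD.
apply/mpolyP => m; rewrite !mcoeffD !mcoeffZ mcoeff_euler -addrA; congr (_ + _).
have [mf|mf] := boolP (m \in msupp f); last by rewrite memN_msupp_eq0 // !mulr0 addr0.
move/eqP: (hf m mf) => dm; rewrite /lam -dm /deg mulrA -mulrDl; congr (_ * _).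
by rewrite [RHS]intrD [X in _ = X + _]intrM -PoszM.
Qed.

Lemma card_mid : N = (#|sw|.*2 + #|mid|)%N.
Proof.
rewrite -{1}(card_ord N) -sum1_card (sum_split (fun=> 1%N)) -addnn.
by rewrite !sum1_card.
Qed.

(** The weight is the degree in the unswapped variables. As [a] and [inv a] are never both swapped,
    each term of [lap] differentiates at least one unswapped variable and multiplies by none. *)
Lemma lap_lowers : lowers (fun a => (~~ sw a)%:Z) lap.
Proof.
move=> L f hf; apply: subspace_bigsum => [|a _ _]; first exact: wbound_sub.
have := wbound_dn (sw := sw) (a := a) (wbound_dn (sw := sw) (a := inv a) hf).
apply: wbound_le; rewrite /swt; have := @sw_inv a.
by case: (sw a) => [/(_ isT)/negPf->|]; case: (sw (inv a)) => //=; lia.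
Qed.

Lemma lap_nilp f : exists L, iter L lap f = 0.
Proof. by apply: lowers_nilp lap_lowers => a; case: (sw a). Qed.

Definition harm k f := dhom k f /\ lap f = 0.

Definition lieZ a b f := up a (dn b f) - up (inv b) (dn (inv a) f).

(** Since duality negates [swt], both terms of [lieZ a b] shift the weight by [swt a - swt b]. *)
Lemma lieZ_lowers c a b : (forall a, swt sw c (inv a) = - swt sw c a) ->
  swt sw c a < swt sw c b -> lowers c (lieZ a b).
Proof.
move=> hc hab L f hf; rewrite /lieZ; apply: (subspaceB (wbound_sub F c (L - 1))).
  have := wbound_up (sw := sw) (a := a) (wbound_dn (sw := sw) (a := b) hf).
  by apply: wbound_le; lia.
have := wbound_up (sw := sw) (a := inv b) (wbound_dn (sw := sw) (a := inv a) hf).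
by apply: wbound_le; rewrite !hc; lia.
Qed.

(* Summing the relations [dn a (lieZ a (inv i) f) = 0] over the middle indices
   and eliminating [lap f] leaves a diagonal operator on [dn (inv i) f]. *)
Lemma lieZ_killed_weight i f m : sw i -> lap f = 0 ->
  (forall a, mid a || sw a -> lieZ a (inv i) f = 0) ->
  m \in msupp (dn (inv i) f) ->
  (\sum_(a | mid a) (m a).+1 = 2 * (\sum_(a | sw a) m a).+1)%N.
Proof.
move=> swi lf0 kill; set g := dn (inv i) f.
have Emid : \sum_(a | mid a) dn a (up a g) =
    up i (\sum_(a | mid a) dn a (dn (inv a) f)).
  rewrite linear_sum; apply: eq_bigr => a ma /=.
  have := kill a; rewrite ma => /(_ isT)/(congr1 (dn a)).
  rewrite /lieZ invK linearB linear0 /= -/g => /eqP; rewrite subr_eq0 => /eqP->.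
  rewrite dn_up; case: eqP => [e|_]; last by rewrite scale0r addr0.
  by move: ma; rewrite e /mid swi.
(* The correction [- g] comes from [a = i], the one index for which [dn a] and [up i] do not
   commute. *)
have Esw : up i (\sum_(a | sw a) dn a (dn (inv a) f)) =
    \sum_(a | sw a) dn a (up a g) - g.
  rewrite linear_sum /= [X in _ = _ - X](_ : g = \sum_(a | sw a) (a == i)%:R *: dn (inv a) f).
    rewrite -sumrB; apply: eq_bigr => a sa.
    have := kill a; rewrite sa orbT => /(_ isT)/(congr1 (dn a)).
    rewrite /lieZ invK linearB linear0 /= -/g => /eqP; rewrite subr_eq0 => /eqP->.
    by rewrite dn_up addrK.
  rewrite (bigD1 i) //= eqxx scale1r big1 ?addr0 // => a /andP[_ /negPf->].
  by rewrite scale0r.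
have : up i (lap f) = 0 by rewrite lf0 linear0.
rewrite /lap sum_split.
under [X in _ + X + _]eq_bigr => a _ do rewrite invK dn_comm.
rewrite !linearD /= -Emid Esw => /(congr1 (mcoeff m)).
rewrite !mcoeffD mcoeffN !raddf_sum /= mcoeff0.
under eq_bigr => a sa do rewrite mcoeff_dn_up sa.
under [X in _ + X = _]eq_bigr => a /andP[/negPf sa _] do rewrite mcoeff_dn_up sa.
rewrite -!mulr_suml sumrN -!natr_sum.
(* The swapped indices enter [lap] twice, as [a] and as [inv a], each time with coefficient
   [- p - 1]; the middle indices contribute [q]. *)
set p := (\sum_(a | sw a) m a)%N; set q := (\sum_(a | mid a) _)%N.
rewrite mcoeff_msupp => + gm.
have -> : - p%:R * g@_m - g@_m + (- p%:R * g@_m - g@_m) + q%:R * g@_m =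
    (q%:Z - 2 * p.+1%:Z)%:~R * g@_m.
  by rewrite rmorphB rmorphM /= -(addn1 p) PoszD rmorphD /=; ring.
move/eqP; rewrite mulf_eq0 (negPf gm) orbF pchar0_intr_eq0 //; lia.
Qed.

Hypothesis odd_mid : odd #|mid|.

(** From [N = 2 #|sw| + #|mid|] one gets [lam k = 4k + 2 #|mid|]. The sum is
    [2 (i+1) (2k + #|mid| + 2i)], whose last factor is odd. *)
Lemma lamsum_neq0 k i : lamsum lam k i.+1 != 0.
Proof.
have -> : lamsum lam k i.+1 =
    ((2 * i.+1%:Z) * (2 * k + #|mid|%:Z + 2 * i%:Z))%:~R.
  rewrite /lamsum /lam -rmorph_sum /=; congr (_%:~R).
  elim: i => [|i IH]; rewrite big_ord_recr ?big_ord0 /= ?IH; have := card_mid; lia.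
rewrite pchar0_intr_eq0 // mulf_neq0 //.
have := odd_double_half #|mid|; rewrite odd_mid; lia.
Qed.

End Orthogonal.

Lemma Xmul_eq0 (F : fieldType) (N : nat) (a : 'I_N) (f : {mpoly F[N]}) :
  'X_a * f = 0 -> f = 0.
Proof.
move=> h; apply/mpolyP => m; rewrite mcoeff0.
by have := congr1 (mcoeff (m + U_(a))%MM) h; rewrite mcoeff_Xmulr mcoeff0.
Qed.

(** * The orthogonal Lie algebra acting by quadratic operators *)

Section OrthogonalAction.
Variables (F : fieldType) (N : nat) (sw : 'I_N -> bool) (inv : 'I_N -> 'I_N).
Hypothesis charF : [pchar F] =i pred0.
Hypothesis invK : involutive inv.
Hypothesis sw_inv : forall a, sw a -> ~~ sw (inv a).
Local Notation B := {mpoly F[N]}.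
Local Notation up := (@up F N sw).
Local Notation dn := (@dn F N sw).
Local Notation mid := (mid sw inv).
Local Notation lap := (@lap F N sw inv).
Local Notation colap := (@colap F N sw inv).
Local Notation lieZ := (@lieZ F N sw inv).
Local Notation dhom := (whom (dcoef sw)).
Local Notation harm := (harm sw inv).
Implicit Types (f g : B) (m : 'X_{1..N}) (a b i j : 'I_N) (A : 'M[F]_N).

Lemma degE m : deg sw m = - (\sum_(a | sw a) m a)%N%:Z
   + (\sum_(a | sw a) m (inv a))%N%:Z + (\sum_(a | mid a) m a)%N%:Z.
Proof.
rewrite /deg /wt (sum_split invK sw_inv) -!natz !natr_sum -sumrN; congr (_ + _ + _).
- by apply: eq_bigr => a sa; rewrite /dcoef sa natz; lia.
- by apply: eq_bigr => a /sw_inv/negPf sa; rewrite /dcoef sa natz; lia.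
- by apply: eq_bigr => a /andP[/negPf sa _]; rewrite /dcoef sa natz; lia.
Qed.

(** A monomial of [f] contains no dual of a swapped variable ([noq]), no swapped variable other than
    [i1] ([nopj]), and not both [i1] and a middle variable ([nomix]). Being of degree [k <= 0], it
    is a power of the variable [i1]. *)
Lemma lowest_supp (k : int) f i1 : k <= 0 -> 2 * k + #|mid|%:Z <= 3 -> sw i1 ->
  harm k f ->
  (forall i a, sw i -> mid a || sw a -> lieZ a (inv i) f = 0) ->
  (forall j, sw j -> j != i1 -> lieZ j i1 f = 0) ->
  supported (fun m => m == (U_(i1) *+ `|k|)%MM) f.
Proof.
move=> k0 kmid sw1 [hf lf] kill kill1.
(* Let [p], [q], [z] be the degrees of a monomial of [dn (inv i) f] in the swapped, dual and middle
   variables, and [d] the number of the latter. Then [z + d = 2p + 2] and [-p + q + z = k - 1], so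
   [z = 2k + d - 4 - 2q], which is negative by the bound 3. *)
have noq i : sw i -> dn (inv i) f = 0.
  move=> si; apply: msuppnil0; case E : (msupp _) => [//|m s]; exfalso.
  have mg : m \in msupp (dn (inv i) f) by rewrite E mem_head.
  have := lieZ_killed_weight charF invK sw_inv si lf (fun a => kill i a si) mg.
  have := whom_dn (sw := sw) (a := inv i) hf mg; rewrite /= swt_dcoef -/(deg sw m) degE.
  have -> : (\sum_(a | mid a) (m a).+1 = \sum_(a | mid a) m a + #|mid|)%N.
    by rewrite -sum1_card -big_split; apply: eq_bigr => a _; rewrite /= addn1.
  move: kmid; move: (\sum_(a | sw a) m a)%N (\sum_(a | sw a) m (inv a))%N (\sum_(a | mid a) m a)%N #|mid| => p q z d. lia.
have noq_supp i m : sw i -> m \in msupp f -> m (inv i) = 0%N.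
  move=> si; apply: (mderiv_eq0_supp charF).
  by have := noq i si; rewrite /dn (negPf (sw_inv si)).
(* By [noq] the relation [lieZ j i1 f = 0] reduces to [x_{i1} d_j f = 0], where [x] and [d] denote
   variables and their derivatives. *)
have nopj j m : sw j -> j != i1 -> m \in msupp f -> m j = 0%N.
  move=> sj j1; apply: (mderiv_eq0_supp charF).
  have := kill1 j sj j1; rewrite /lieZ (noq j sj) linear0 subr0 /up /dn sj sw1.
  rewrite linearN /= mderivM mderivXU (negPf j1) mul0r add0r => /eqP.
  by rewrite oppr_eq0 => /eqP; apply: Xmul_eq0.
(* By [noq] the relation [lieZ (inv a) (inv i1) f = 0] reduces to [d_{i1} d_a f = 0]. *)
have nomix a m : mid a -> m \in msupp f -> m i1 = 0%N \/ m a = 0%N.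
  move=> ma mf; have [|m10] := posnP (m i1); [by left | right].
  have inva : mid (inv a) by move: ma; rewrite /mid invK andbC.
  have := kill i1 (inv a) sw1; rewrite inva /lieZ noq // linear0 sub0r invK => /(_ isT)/eqP.
  rewrite !invK oppr_eq0 /up /dn sw1; case/andP: (ma) => /negPf-> _ /eqP h.
  apply: contraTeq mf => ma0; rewrite mcoeff_msupp negbK.
  have ai1 : a != i1 by apply: contraTneq ma => ->; rewrite /mid sw1.
  have := congr1 (mcoeff (m - U_(i1) - U_(a))%MM) h.
  rewrite mcoeff0 mcoeff_mderiv mcoeff_mderiv.
  have -> : (m - U_(i1) - U_(a) + U_(i1) + U_(a) = m)%MM.
    apply/mnmP => j; rewrite !(mnmDE, mnmBE) !mnm1E.
    have [<-|_] := eqVneq i1 j; first by rewrite (negPf ai1); lia.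
    by have [<-|_] := eqVneq a j; move: ma0; lia.
  rewrite -mulrnA -mulr_natr => /eqP; rewrite mulf_eq0 pchar0_natr_eq0 //.
  by rewrite muln_eq0 orbF.
move=> m mf; have := hf m mf; rewrite /= -/(deg sw m) degE.
rewrite [X in _ + X%:Z + _]big1 => [|i si]; last exact: noq_supp.
rewrite (bigD1 i1) //= big1 ?addn0 => [|j /andP[sj j1]]; last exact: nopj.
have [m10|m10] := posnP (m i1).
  rewrite m10 => /eqP mk.
  have /eqP : (\sum_(a | mid a) m a)%N = 0%N.
    by move: mk k0; move: (\sum_(a | mid a) m a)%N => z; lia.
  rewrite sum_nat_eq0 => /forallP z0; have -> : k = 0 by lia.
  apply/eqP/mnmP => a; rewrite mulm0n mnm0E.
  have [->//|ai1] := eqVneq a i1; have [sa|sa] := boolP (sw a); first exact: nopj.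
  have [sia|sia] := boolP (sw (inv a)); first by rewrite -[a]invK; exact: noq_supp.
  by apply/eqP; have /implyP := z0 a; apply; rewrite /mid sa.
have nomid a : mid a -> m a = 0%N by move=> ma; case: (nomix a m ma mf) => // h; rewrite h in m10.
rewrite big1 // => /eqP mk; apply/eqP/mnmP => a; rewrite mulmnE mnm1E.
have [<-|ai1] := eqVneq i1 a; first by lia.
rewrite mul0n; have [sa|sa] := boolP (sw a); first by apply: nopj; rewrite 1?eq_sym.
have [sia|sia] := boolP (sw (inv a)); first by rewrite -[a]invK; exact: noq_supp.
by apply: nomid; rewrite /mid sa.
Qed.

Definition gact A f : B := \sum_a \sum_b A a b *: up a (dn b f).

Lemma gact_is_linear A : linear (gact A).
Proof.
move=> k f g; rewrite /gact scaler_sumr -big_split; apply: eq_bigr => a _ /=.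
rewrite scaler_sumr -big_split; apply: eq_bigr => b _ /=.
by rewrite !linearP.
Qed.
HB.instance Definition _ A := GRing.isLinear.Build F B B _ (gact A) (gact_is_linear A).

Lemma gactP (k : F) A A' f : gact (k *: A + A') f = k *: gact A f + gact A' f.
Proof.
rewrite /gact scaler_sumr -big_split; apply: eq_bigr => a _ /=.
rewrite scaler_sumr -big_split; apply: eq_bigr => b _ /=.
by rewrite !mxE scalerDl scalerA.
Qed.

Lemma gact0 f : gact 0 f = 0.
Proof. by have := gactP (-1) 0 0 f; rewrite scaler0 addr0 !scaleN1r addNr. Qed.

Lemma gact_delta a b f : gact (delta_mx a b) f = up a (dn b f).
Proof.
rewrite /gact (bigD1 a) //= (bigD1 b) //= mxE !eqxx scale1r !big1 ?addr0 //.
  by move=> a' /negPf aa'; apply: big1 => b' _; rewrite mxE aa' scale0r.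
by move=> b' /negPf bb'; rewrite mxE bb' andbF scale0r.
Qed.

Lemma gact_lieZ a b f :
  gact (delta_mx a b - delta_mx (inv b) (inv a)) f = lieZ a b f.
Proof. by rewrite addrC -scaleN1r gactP !gact_delta scaleN1r addrC. Qed.

Definition antidual A := forall a b, A (inv b) (inv a) = - A a b.

(** Reindexing by [(a, b) -> (inv b, inv a)] turns the sum into its negative. The factor 2 is the
    one created by [lap_up] and [colap_dn]. *)
Lemma antidual_sum A (u : 'I_N -> 'I_N -> B) : antidual A ->
  (forall a b, u (inv b) (inv a) = u a b) ->
  2%:R *: (\sum_a \sum_b A a b *: u a b) = 0.
Proof.
move=> skA uinv; set S := \sum_a _.
have : S = - S.
  rewrite {1}/S (reindex_inj (inv_inj invK)) /=.
  under eq_bigr => a _ do rewrite (reindex_inj (inv_inj invK)) /=.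
  rewrite exchange_big -sumrN; apply: eq_bigr => a _ /=.
  rewrite -sumrN; apply: eq_bigr => b _.
  by rewrite skA uinv scaleNr.
by rewrite scaler_nat mulr2n => {1}->; rewrite addNr.
Qed.

Lemma lap_gact A f : antidual A -> lap (gact A f) = gact A (lap f).
Proof.
move=> skA.
have -> : lap (gact A f) = gact A (lap f) +
    2%:R *: (\sum_a \sum_b A a b *: dn (inv a) (dn b f)).
  rewrite /gact linear_sum scaler_sumr -big_split; apply: eq_bigr => a _ /=.
  rewrite linear_sum scaler_sumr -big_split; apply: eq_bigr => b _ /=.
  rewrite linearZ /= lap_up // lap_dn scalerDr; congr (_ + _).
  by rewrite !scalerA mulrC.
by rewrite (antidual_sum skA) ?addr0 // => a b; rewrite invK dn_comm.
Qed.

Lemma colap_gact A f : antidual A -> colap (gact A f) = gact A (colap f).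
Proof.
move=> skA.
have -> : colap (gact A f) = gact A (colap f) -
    2%:R *: (\sum_a \sum_b A a b *: up a (up (inv b) f)).
  rewrite /gact linear_sum scaler_sumr -sumrB; apply: eq_bigr => a _ /=.
  rewrite linear_sum scaler_sumr -sumrB; apply: eq_bigr => b _ /=.
  rewrite linearZ /= colap_up colap_dn // linearB linearZ /= scalerBr; congr (_ - _).
  by rewrite !scalerA mulrC.
by rewrite (antidual_sum skA) ?subr0 // => a b; rewrite invK up_comm.
Qed.

Lemma whom_gact c k A f : (forall a b, A a b != 0 -> swt sw c a = swt sw c b) ->
  whom c k f -> whom c k (gact A f).
Proof.
move=> hA hf; apply: subspace_bigsum => [|a _ _]; first exact: whom_sub.
apply: subspace_bigsum => [|b _ _]; first exact: whom_sub.
have [->|/hA hab] := eqVneq (A a b) 0.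
  by rewrite scale0r; case: (whom_sub F c k).
apply: (subspaceZ (A a b) (whom_sub F c k)).
have := whom_up (sw := sw) (a := a) (whom_dn (sw := sw) (a := b) hf).
by rewrite hab subrK.
Qed.

Lemma dhom_gact k A f : dhom k f -> dhom k (gact A f).
Proof. by apply: whom_gact => a b _; rewrite !swt_dcoef. Qed.

Lemma bform_gact A f g : bform sw (gact A f) g = bform sw f (gact A^T g).
Proof.
have H A' u v : bform sw u (gact A' v) =
    \sum_a \sum_b A' a b * bform sw u (up a (dn b v)).
  rewrite /gact linear_sum; apply: eq_bigr => a _ /=.
  by rewrite linear_sum; apply: eq_bigr => b _ /=; rewrite linearZ.
rewrite bformC !H exchange_big; apply: eq_bigr => b _ /=; apply: eq_bigr => a _ /=.
by rewrite mxE bformC bform_up bform_dn.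
Qed.

End OrthogonalAction.

(** * The modules over o(2n+1) *)

Section LinSpan.
Variables (F : fieldType) (V : lmodType F).

Lemma lin_span_sub (S : V -> Prop) : is_subspace (lin_span S).
Proof.
split=> [|c u v [s hs ->] [t ht ->]]; first by exists [::]; [move=> p; rewrite in_nil | rewrite big_nil].
exists ([seq (c * p.1, p.2) | p <- s] ++ t).
  by move=> p; rewrite mem_cat => /orP[/mapP[q sq ->]|/ht] //; exact: (hs q sq).
rewrite big_cat big_map scaler_sumr; congr (_ + _).
by apply: eq_bigr => p _; rewrite scalerA.
Qed.

Lemma mem_lin_span (S : V -> Prop) v : S v -> lin_span S v.
Proof.
move=> Sv; exists [:: (1, v)]; last by rewrite big_seq1 scale1r.
by move=> p; rewrite inE => /eqP->.
Qed.

Lemma lin_span_le (S W : V -> Prop) : is_subspace W -> (forall v, S v -> W v) ->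
  forall v, lin_span S v -> W v.
Proof.
move=> hW SW v [s hs ->]; apply: subspace_bigsum => // p sp _.
by apply: subspaceZ => //; apply/SW/hs.
Qed.

End LinSpan.

(** * Identification with the operators of the statement *)

Section Concrete.
Variables (F : fieldType) (n n1 n2 : nat).
Hypothesis le_n12 : (n1 <= n2)%N.
Local Notation N := (n + n).+1.
Local Notation B := {mpoly F[N]}.
Local Notation mat := 'M[F]_N.
Implicit Types (f g : B) (m : 'X_{1..N}) (a b : 'I_N) (i j : 'I_n) (A : mat).

Lemma ix_split0 : ix_split (ix0 n) = None.
Proof. by rewrite /ix_split unlift_none. Qed.

Lemma ix_splitx i : ix_split (ix i) = Some (inl i).
Proof.
rewrite /ix_split liftK /=; case: split_ordP => j.
  by move/lshift_inj ->.
by move/eqP; rewrite eq_lrshift.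
Qed.

Lemma ix_splity i : ix_split (iy i) = Some (inr i).
Proof.
rewrite /ix_split liftK /=; case: split_ordP => j.
  by move/eqP; rewrite eq_rlshift.
by move/rshift_inj ->.
Qed.

Variant index_spec : 'I_N -> Type :=
  | Index0 : index_spec (ix0 n)
  | Indexx i : index_spec (ix i)
  | Indexy i : index_spec (iy i).

Lemma indexP a : index_spec a.
Proof.
case: (unliftP ord0 a) => [b ->|->]; last exact: Index0.
by case: (split_ordP b) => i ->; [exact: Indexx | exact: Indexy].
Qed.

Definition dual a := match ix_split a with
  | None => ix0 n | Some (inl i) => iy i | Some (inr i) => ix i end.

Definition swapped a := match ix_split a with
  | None => false | Some (inl i) => (i < n1)%N | Some (inr i) => (n2 <= i)%N end.

Lemma dual0 : dual (ix0 n) = ix0 n. Proof. by rewrite /dual ix_split0. Qed.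
Lemma dualx i : dual (ix i) = iy i. Proof. by rewrite /dual ix_splitx. Qed.
Lemma dualy i : dual (iy i) = ix i. Proof. by rewrite /dual ix_splity. Qed.
Definition dualE := (dual0, dualx, dualy).

Lemma swapped0 : swapped (ix0 n) = false. Proof. by rewrite /swapped ix_split0. Qed.
Lemma swappedx i : swapped (ix i) = (i < n1)%N. Proof. by rewrite /swapped ix_splitx. Qed.
Lemma swappedy i : swapped (iy i) = (n2 <= i)%N. Proof. by rewrite /swapped ix_splity. Qed.
Definition swappedE := (swapped0, swappedx, swappedy).

Lemma dualK : involutive dual.
Proof. by move=> a; case: (indexP a) => [|i|i]; rewrite !dualE. Qed.

Lemma swapped_dual a : swapped a -> ~~ swapped (dual a).
Proof. by case: (indexP a) => [|i|i]; rewrite !dualE !swappedE //; lia. Qed.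

Lemma ix_inj : injective (@ix n). Proof. by move=> i j /lift_inj /lshift_inj. Qed.
Lemma iy_inj : injective (@iy n). Proof. by move=> i j /lift_inj /rshift_inj. Qed.
Lemma ix_neq_iy i j : (ix i == iy j) = false.
Proof. by rewrite (inj_eq lift_inj) eq_lrshift. Qed.
Lemma iy_neq_ix i j : (iy i == ix j) = false.
Proof. by rewrite eq_sym ix_neq_iy. Qed.
Lemma ix0_neq_ix i : (ix0 n == ix i) = false. Proof. by []. Qed.
Lemma ix0_neq_iy i : (ix0 n == iy i) = false. Proof. by []. Qed.
Lemma ix_neq_ix0 i : (ix i == ix0 n) = false. Proof. by []. Qed.
Lemma iy_neq_ix0 i : (iy i == ix0 n) = false. Proof. by []. Qed.
Lemma ix_eq i j : (ix i == ix j) = (i == j). Proof. exact: inj_eq ix_inj _ _. Qed.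
Lemma iy_eq i j : (iy i == iy j) = (i == j). Proof. exact: inj_eq iy_inj _ _. Qed.
Definition indexE := (ix_neq_iy, iy_neq_ix, ix0_neq_ix, ix0_neq_iy, ix_neq_ix0,
  iy_neq_ix0, ix_eq, iy_eq).

Lemma sum_index (V : nmodType) (u : 'I_N -> V) :
  \sum_a u a = u (ix0 n) + \sum_i u (ix i) + \sum_i u (iy i).
Proof. by rewrite big_ord_recl big_split_ord addrA. Qed.

Local Notation mid := (mid swapped dual).

Lemma mid0 : mid (ix0 n). Proof. by rewrite /mid dualE !swappedE. Qed.
Lemma midx i : mid (ix i) = (n1 <= i < n2)%N.
Proof. by rewrite /mid dualE !swappedE -leqNgt -ltnNge. Qed.
Lemma midy i : mid (iy i) = (n1 <= i < n2)%N.
Proof. by rewrite /mid dualE !swappedE -leqNgt -ltnNge andbC. Qed.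

Lemma card_range l p q : (\sum_(i < l) (p <= i < q) = minn l q - p)%N.
Proof.
elim: l => [|l IH]; first by rewrite big_ord0; lia.
rewrite big_ord_recr /= IH; case: (leqP p l); case: (ltnP l q) => /=; lia.
Qed.

Lemma card_swapped_mid : (n2 <= n)%N -> #|mid| = (n2 - n1).*2.+1.
Proof.
move=> le_n2n; rewrite -sum1_card big_mkcond sum_index.
have inE' a : (a \in mid) = mid a by [].
under [X in _ + X + _]eq_bigr => i _ do rewrite inE' midx.
under [X in _ + X]eq_bigr => i _ do rewrite inE' midy.
have e (b : bool) : (if b then 1 else 0)%N = b by case: b.
under [X in _ + X + _]eq_bigr => i _ do rewrite e.
under [X in _ + X]eq_bigr => i _ do rewrite e.
by rewrite inE' mid0 !card_range; lia.
Qed.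

Local Notation up := (@up F N swapped).
Local Notation dn := (@dn F N swapped).
Local Notation lap := (@lap F N swapped dual).
Local Notation colap := (@colap F N swapped dual).
Local Notation gact := (@gact F N swapped).
Local Notation dhom := (@whom F N (dcoef swapped)).
Local Notation harm := (@harm F N swapped dual).

Lemma opE_updn a b f : opE n1 n2 a b f = up a (dn b f).
Proof.
rewrite /opE; case: (indexP a) => [|i|i]; case: (indexP b) => [|j|j];
  rewrite ?(ix_split0, ix_splitx, ix_splity) /up /dn !swappedE //.
- by rewrite /opE0x; case: ifP => _; rewrite ?mulrN ?mulrA.
- by rewrite /opE0y ltnNge; case: (n2 <= j)%N; rewrite /= ?mulrN ?mulrA.
- by rewrite /opEx0; case: ifP => // _; rewrite mderiv_comm.
- rewrite /opEx; case: (i < n1)%N (j < n1)%N => [] [] //.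
    by rewrite linearN /= mderivM mderivXU ix_eq scaler_nat mulr_natl opprD addrC.
  by rewrite mulrN mulrA.
- rewrite /opExy [(j < n2)%N]ltnNge; case: (i < n1)%N (n2 <= j)%N => [] [] //=.
    by rewrite linearN /= mderivM mderivXU ix_neq_iy mul0r add0r.
  by rewrite mulrN mulrA.
- by rewrite /opEy0 ltnNge; case: (n2 <= i)%N => //=; rewrite mderiv_comm.
- rewrite /opEyx [(i < n2)%N]ltnNge; case: (j < n1)%N (n2 <= i)%N => [] [] //=.
  + by rewrite linearN /= mderivM mderivXU iy_neq_ix mul0r add0r.
  + by rewrite mulrN mulrCA mulrA.
  + by rewrite mderiv_comm.
- rewrite /opEy !ltnNge; case: (n2 <= i)%N (n2 <= j)%N => [] [] //=.
    by rewrite linearN /= mderivM mderivXU iy_eq scaler_nat mulr_natl opprD addrC.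
  by rewrite mulrN mulrA.
Qed.

Lemma actE A f : act n1 n2 A f = gact A f.
Proof.
by apply: eq_bigr => a _; apply: eq_bigr => b _; rewrite opE_updn.
Qed.

Lemma sum_ranges (V : nmodType) (u : 'I_n -> V) : \sum_i u i =
  \sum_(i < n | (i < n1)%N) u i + \sum_(i < n | (n1 <= i < n2)%N) u i +
  \sum_(i < n | (n2 <= i)%N) u i.
Proof.
rewrite (bigID (fun i : 'I_n => (i < n1)%N)) /= -addrA; congr (_ + _).
rewrite (bigID (fun i : 'I_n => (i < n2)%N)) /=; congr (_ + _); apply: eq_bigl => i; lia.
Qed.

Lemma lapE f : Dop n1 n2 f = lap f.
Proof.
rewrite /Dop /lap sum_index -addrA.
have -> : \sum_i dn (iy i) (dn (dual (iy i)) f) = \sum_i dn (ix i) (dn (iy i) f).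
  by apply: eq_bigr => i _; rewrite dualE dn_comm.
have -> : \sum_i dn (ix i) (dn (dual (ix i)) f) = \sum_i dn (ix i) (dn (iy i) f).
  by apply: eq_bigr => i _; rewrite dualE.
rewrite -mulr2n -scaler_nat dualE {1 2}/dn swapped0 sum_ranges !scalerDr !addrA.
rewrite -!scalerN -!sumrN; congr (_ + _ *: _ + _ *: _ + _ *: _); apply: eq_bigr => i hi.
- by rewrite /dn !swappedE hi leqNgt (leq_trans hi le_n12).
- by case/andP: hi => h1 h2; rewrite /dn !swappedE ltnNge h1 leqNgt h2.
- rewrite /dn !swappedE hi ltnNge (leq_trans le_n12 hi) linearN /=.
  by rewrite mderivM mderivXU ix_neq_iy mul0r add0r.
Qed.

Lemma colapE f : etaop n1 n2 f = colap f.
Proof.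
rewrite /etaop /colap sum_index -addrA.
have -> : \sum_i up (iy i) (up (dual (iy i)) f) = \sum_i up (ix i) (up (iy i) f).
  by apply: eq_bigr => i _; rewrite dualE up_comm.
have -> : \sum_i up (ix i) (up (dual (ix i)) f) = \sum_i up (ix i) (up (iy i) f).
  by apply: eq_bigr => i _; rewrite dualE.
rewrite -mulr2n -scaler_nat dualE {1 2}/up swapped0 sum_ranges !scalerDr !addrA.
rewrite expr2 mulrA; congr (_ + _ *: _ + _ *: _ + _ *: _); apply: eq_bigr => i hi.
- rewrite /up !swappedE hi leqNgt (leq_trans hi le_n12) /=.
  by rewrite mderivM mderivXU ix_neq_iy mul0r add0r.
- by case/andP: hi => h1 h2; rewrite /up !swappedE ltnNge h1 leqNgt h2 mulrA.
- by rewrite /up !swappedE hi ltnNge (leq_trans le_n12 hi).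
Qed.

Lemma xydegE m : xydeg n1 n2 m + (m (ix0 n))%:Z = deg swapped m.
Proof.
have hx : \sum_(i < n) dcoef swapped (ix i) * (m (ix i))%:Z =
    - (\sum_(i < n | (i < n1)%N) (m (ix i))%:Z) + \sum_(r < n | (n1 <= r)%N) (m (ix r))%:Z.
  rewrite (bigID (fun i : 'I_n => (i < n1)%N)) /= -sumrN; congr (_ + _).
    by apply: eq_bigr => i hi; rewrite /dcoef swappedx hi mulN1r.
  apply: eq_big => [i|i hi]; first by rewrite -leqNgt.
  by rewrite /dcoef swappedx (negPf hi) mul1r.
have hy : \sum_(i < n) dcoef swapped (iy i) * (m (iy i))%:Z =
    \sum_(i < n | (i < n2)%N) (m (iy i))%:Z - \sum_(r < n | (n2 <= r)%N) (m (iy r))%:Z.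
  rewrite (bigID (fun i : 'I_n => (i < n2)%N)) /= -sumrN; congr (_ + _).
    by apply: eq_bigr => i hi; rewrite /dcoef swappedy leqNgt hi mul1r.
  apply: eq_big => [i|i hi]; first by rewrite -leqNgt.
  by rewrite /dcoef swappedy leqNgt hi mulN1r.
rewrite /deg /wt sum_index hx hy /dcoef swapped0 mul1r /xydeg [LHS]addrC.
by rewrite !addrA.
Qed.

(** As [x_0] has degree 1, summing over its powers collects the monomials of total degree [k]. The
    equality of predicates, by extensionality, permits rewriting inside [image_of] and
    [direct_sum]. *)
Lemma B'kE : B'k F n n1 n2 = dhom.
Proof.
apply: functional_extensionality => k; apply: functional_extensionality => f.
apply: propositional_extensionality.
have hU (i : nat) : is_subspace
    (image_of (fun f => f * 'X_(ix0 n) ^+ i) (Bk F n n1 n2 (k - i%:Z))).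
  have hB := @lin_span_sub F B (fun p : B =>
    exists m, [/\ m (ix0 n) = 0%N, xydeg n1 n2 m = k - i%:Z & p = 'X_[m]]).
  split; first by exists 0; rewrite ?mul0r //; exact: hB.1.
  move=> c _ _ [u hu ->] [v hv ->]; exists (c *: u + v); first exact: hB.2.
  by rewrite mulrDl scalerAl.
split=> [[s [g [hg ->]]]|hf].
  apply: subspace_bigsum; first exact: whom_sub.
  move=> i /hg[h [t ht ->] ->] _; rewrite mulr_suml.
  apply: subspace_bigsum => [|p /ht[m [m0 mk ->]] _]; first exact: whom_sub.
  rewrite -scalerAl; apply: (subspaceZ _ (whom_sub F _ _)).
  rewrite mpolyXn -mpolyXD => m'; rewrite msuppX inE => /eqP->.
  rewrite -/(deg swapped _) -xydegE mnmDE mulmnE mnm1E eqxx m0 mul1n add0n.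
  suff -> : xydeg n1 n2 (m + U_(ix0 n) *+ i) = xydeg n1 n2 m by rewrite mk subrK.
  rewrite /xydeg; congr (- _ + _ + _ - _); apply: eq_bigr => j _;
    by rewrite mnmDE mulmnE mnm1E ?indexE mul0n addn0.
rewrite [f]mpolyE; apply: (subspace_sum_big hU) => m /hf /eqP mk.
apply: (@subspace_sum1 _ _ _ _ (m (ix0 n))); apply: (subspaceZ _ (hU _)).
pose m' := [multinom if a == ix0 n then 0%N else m a | a < N].
exists 'X_[m'].
  apply: mem_lin_span; exists m'; split=> //; first by rewrite mnmE.
  rewrite -mk -/(deg swapped m) -xydegE addrK /xydeg.
  by congr (- _ + _ + _ - _); apply: eq_bigr => j _; rewrite mnmE indexE.
rewrite mpolyXn -mpolyXD; congr 'X_[_]; apply/mnmP => a.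
rewrite mnmDE mnmE mulmnE mnm1E eq_sym; case: eqP => [->|_]; first by rewrite mul1n.
by rewrite mul0n addn0.
Qed.

Lemma H'kE : H'k F n n1 n2 = harm.
Proof.
apply: functional_extensionality => k; apply: functional_extensionality => f.
by rewrite /H'k B'kE lapE.
Qed.

Lemma etaopE : etaop n1 n2 = colap.
Proof. by apply: functional_extensionality => f; exact: colapE. Qed.

End Concrete.

(** * The matrices of o(2n+1) and irreducibility of the harmonic spaces *)

Section Modules.
Variables (F : fieldType) (n n1 n2 : nat).
Hypothesis charF : [pchar F] =i pred0.
Hypothesis n1_gt0 : (1 <= n1)%N.
Hypothesis le_n12 : (n1 <= n2)%N.
Hypothesis le_n2n : (n2 <= n)%N.
Local Notation N := (n + n).+1.
Local Notation B := {mpoly F[N]}.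
Local Notation mat := 'M[F]_N.
Implicit Types (f g : B) (m : 'X_{1..N}) (a b : 'I_N) (i j : 'I_n) (A : mat).
Implicit Types (G : {vspace mat}) (M S : B -> Prop).

Local Notation dual := (@dual n).
Local Notation swapped := (@swapped n n1 n2).
Local Notation mid := (mid swapped dual).
Local Notation up := (@up F N swapped).
Local Notation dn := (@dn F N swapped).
Local Notation lap := (@lap F N swapped dual).
Local Notation colap := (@colap F N swapped dual).
Local Notation gact := (@gact F N swapped).
Local Notation lieZ := (@lieZ F N swapped dual).
Local Notation dhom := (@whom F N (dcoef swapped)).
Local Notation harm := (@harm F N swapped dual).

Definition Zmx a b : mat := delta_mx a b - delta_mx (dual b) (dual a).

Lemma Zmx_antidual a b : antidual dual (Zmx a b).
Proof.
move=> c d; rewrite !mxE !(inj_eq (inv_inj (@dualK n))) !(can2_eq (@dualK n) (@dualK n)).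
by rewrite opprB; congr (_%:R - _%:R); rewrite andbC.
Qed.

Lemma Zmx_tr a b : (Zmx a b)^T = Zmx b a.
Proof. by rewrite linearB /= !trmx_delta. Qed.

Lemma Zmx_dual a b : Zmx (dual b) (dual a) = - Zmx a b.
Proof. by rewrite /Zmx !dualK opprB. Qed.

Lemma antidual_sub : is_subspace (antidual dual : mat -> Prop).
Proof.
split=> [a b|c u v hu hv a b]; first by rewrite !mxE oppr0.
by rewrite !mxE hu hv mulrN opprD.
Qed.

Lemma so_glE i j : so_gl F i j = Zmx (ix i) (ix j).
Proof. by rewrite /Zmx !dualE. Qed.
Lemma so_upE i j : so_up F i j = Zmx (ix i) (iy j).
Proof. by rewrite /Zmx !dualE. Qed.
Lemma so_dnE i j : so_dn F i j = Zmx (iy j) (ix i).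
Proof. by rewrite /Zmx !dualE. Qed.
Lemma so_0xE i : so_0x F i = Zmx (ix0 n) (ix i).
Proof. by rewrite /Zmx !dualE. Qed.
Lemma so_0yE i : so_0y F i = Zmx (ix0 n) (iy i).
Proof. by rewrite /Zmx !dualE. Qed.

Lemma sumv_ind (I : finType) (P : pred I) (U : I -> {vspace mat}) (W : mat -> Prop) :
  is_subspace W -> (forall i : I, P i -> forall A, A \in U i -> W A) ->
  forall A, A \in (\sum_(i | P i) U i)%VS -> W A.
Proof.
move=> hW hU A /memv_sumP[u hu ->].
by apply: subspace_bigsum => // i _ Pi; apply: (hU i Pi); apply: hu.
Qed.

Lemma addv_ind (U V : {vspace mat}) (W : mat -> Prop) : is_subspace W ->
  (forall A, A \in U -> W A) -> (forall A, A \in V -> W A) ->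
  forall A, A \in (U + V)%VS -> W A.
Proof.
by move=> hW hU hV A /memv_addP[u /hU Wu [v /hV Wv ->]]; apply: subspaceD.
Qed.

Lemma line_ind (A0 : mat) (W : mat -> Prop) : is_subspace W -> W A0 ->
  forall A, A \in <[A0]>%VS -> W A.
Proof. by move=> hW h A /vlineP[k ->]; apply: subspaceZ. Qed.

Lemma Kalg_ind (W : mat -> Prop) : is_subspace W ->
  (forall i j, W (Zmx (ix i) (ix j))) -> forall A, A \in Kalg F n -> W A.
Proof.
move=> hW hZ; apply: sumv_ind => // i _; apply: sumv_ind => // j _.
by apply: line_ind => //; rewrite so_glE.
Qed.

Lemma so_odd_ind (W : mat -> Prop) : is_subspace W ->
  (forall a b, W (Zmx a b)) -> forall A, A \in so_odd F n -> W A.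
Proof.
move=> hW hZ; apply: addv_ind => //; last first.
  apply: sumv_ind => // i _; apply: addv_ind => //; apply: line_ind => //.
    by rewrite so_0xE.
  by rewrite so_0yE.
apply: addv_ind => //; first exact: Kalg_ind.
apply: sumv_ind => // i _; apply: sumv_ind => // j _; apply: addv_ind => //;
  apply: line_ind => //.
  by rewrite so_upE.
by rewrite so_dnE.
Qed.

Lemma Zmx_Kalg i j : Zmx (ix i) (ix j) \in Kalg F n.
Proof.
rewrite -so_glE; apply: (subvP (sumv_sup i isT (subvv _))).
exact: (subvP (sumv_sup j isT (subvv _))) (memv_line _).
Qed.

Lemma Kalg_so_odd A : A \in Kalg F n -> A \in so_odd F n.
Proof. by move=> hA; apply: (subvP (addvSl _ _)); apply: (subvP (addvSl _ _)). Qed.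

Lemma Zmx_so_odd a b : Zmx a b \in so_odd F n.
Proof.
(* The generators have [i < j]. Duality exchanges [i] and [j] up to sign, and for [i = j] both
   matrices are zero. *)
have inUp i j : Zmx (ix i) (iy j) \in so_odd F n /\ Zmx (iy i) (ix j) \in so_odd F n.
  wlog ltij : i j / (i < j)%N => [hw|].
    case: (ltngtP i j) => [ij|ji|/ord_inj ->]; first exact: hw.
      have [h1 h2] := hw _ _ ji.
      have := Zmx_dual (ix j) (iy i); have := Zmx_dual (iy j) (ix i); rewrite !dualE.
      by move=> -> ->; rewrite !memvN.
    have e a' : Zmx a' (dual a') = 0 by rewrite /Zmx dualK subrr.
    by have := e (ix j); have := e (iy j); rewrite !dualE => -> ->; rewrite mem0v.
  split; apply: (subvP (addvSl _ _)); apply: (subvP (addvSr _ _));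
    apply: (subvP (sumv_sup i isT (subvv _)));
    apply: (subvP (sumv_sup j ltij (subvv _))).
    by apply: (subvP (addvSl _ _)); rewrite -so_upE memv_line.
  apply: (subvP (addvSr _ _)); rewrite -[Zmx _ _]opprK -Zmx_dual !dualE memvN.
  by rewrite -so_dnE memv_line.
have in0 i : Zmx (ix0 n) (ix i) \in so_odd F n /\ Zmx (ix0 n) (iy i) \in so_odd F n.
  split; apply: (subvP (addvSr _ _)); apply: (subvP (sumv_sup i isT (subvv _))).
    by apply: (subvP (addvSl _ _)); rewrite -so_0xE memv_line.
  by apply: (subvP (addvSr _ _)); rewrite -so_0yE memv_line.
case: (indexP a) => [|i|i]; case: (indexP b) => [|j|j].
- by rewrite /Zmx dualE subrr mem0v.
- exact: (in0 j).1.
- exact: (in0 j).2.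
- by rewrite -memvN -Zmx_dual !dualE; exact: (in0 i).2.
- exact/Kalg_so_odd/Zmx_Kalg.
- exact: (inUp i j).1.
- by rewrite -memvN -Zmx_dual !dualE; exact: (in0 i).1.
- exact: (inUp i j).2.
- by rewrite -memvN -Zmx_dual !dualE; exact/Kalg_so_odd/Zmx_Kalg.
Qed.

Lemma mem_tr_sub G : is_subspace (fun A => A^T \in G).
Proof.
split=> [|c u v hu hv]; first by rewrite linear0 mem0v.
by rewrite linearP memvD // memvZ.
Qed.

Lemma so_odd_tr A : A \in so_odd F n -> A^T \in so_odd F n.
Proof.
move: A; apply: so_odd_ind; first exact: mem_tr_sub.
by move=> a b; rewrite Zmx_tr; exact: Zmx_so_odd.
Qed.

Lemma Kalg_tr A : A \in Kalg F n -> A^T \in Kalg F n.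
Proof.
move: A; apply: Kalg_ind; first exact: mem_tr_sub.
by move=> i j; rewrite Zmx_tr; exact: Zmx_Kalg.
Qed.

Lemma so_odd_antidual A : A \in so_odd F n -> antidual dual A.
Proof. by move: A; apply: so_odd_ind; [exact: antidual_sub | exact: Zmx_antidual]. Qed.

Definition act_op G (r : B -> B) := exists2 A, A \in G & r = gact A.

Lemma submoduleP G M : is_submodule n1 n2 G M <-> stable (act_op G) M.
Proof.
split=> [[hM hA]|[hM hr]]; split=> //.
  by move=> _ f [A GA ->] Mf; rewrite -actE; exact: hA.
by move=> A f GA Mf; rewrite actE; apply: hr => //; exists A.
Qed.

Lemma irreducibleI G M (T : mat) (tau : 'X_{1..N} -> F) :
  (forall A, A \in G -> A^T \in G) -> is_submodule n1 n2 G M ->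
  (exists2 f, M f & f != 0) ->
  T \in G -> (forall f m, (gact T f)@_m = tau m * f@_m) ->
  (forall c, exists K, forall f m, M f -> m \in msupp f -> tau m = c -> (mdeg m < K)%N) ->
  (forall S1 S2, is_submodule n1 n2 G S1 -> is_submodule n1 n2 G S2 ->
     (forall f, S1 f -> M f) -> (forall f, S2 f -> M f) ->
     (exists2 f, S1 f & f != 0) -> (exists2 f, S2 f & f != 0) ->
     exists v, [/\ S1 v, S2 v & bform swapped v v != 0]) ->
  irreducible_module n1 n2 G M.
Proof.
move=> Gtr subM M0 GT tauP bound meet; split=> // S subS SM.
apply: (@stable_irreducible F N swapped (act_op G) (gact T) tau) => //.
- move=> _ [A GA ->]; exists (gact A^T); first by exists A^T => //; exact: Gtr.
  exact: bform_gact.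
- by exists T.
- exact/submoduleP.
- move=> S1 S2 /submoduleP h1 /submoduleP h2; exact: meet.
- exact/submoduleP.
Qed.

Lemma irreducible_image G M (phi : {linear B -> B}) :
  (forall A f, A \in G -> M f -> phi (act n1 n2 A f) = act n1 n2 A (phi f)) ->
  (forall f, M f -> phi f = 0 -> f = 0) ->
  irreducible_module n1 n2 G M -> irreducible_module n1 n2 G (image_of phi M).
Proof.
move=> equiv inj [[hM MA] [f0 Mf0 f00] irr]; split.
- split; first exact: image_subspace.
  move=> A _ GA [f Mf ->]; exists (act n1 n2 A f); first exact: MA.
  by rewrite equiv.
- exists (phi f0); first by exists f0.
  by apply: contraNneq f00 => /(inj _ Mf0) ->.
move=> S [hS SA] SM; pose S' f := M f /\ S (phi f).
have [|f []//|S0|MS] := irr S'.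
- split; first split=> [|c u v [Mu Su] [Mv Sv]].
  + by split; [case: hM | rewrite linear0; case: hS].
  + by split; [apply: hM.2 | rewrite linearP; apply: hS.2].
  move=> A f GA [Mf Sf]; split; first exact: MA.
  by rewrite equiv //; apply: SA.
- left=> _f Sf; have [f Mf ef] := SM _ Sf.
  by rewrite ef (S0 f) ?linear0 //; split; rewrite -?ef.
- by right=> _ [f /MS[_ Sf] ->].
Qed.

Lemma harm_sub k : is_subspace (harm k).
Proof.
split=> [|c u v [hu lu] [hv lv]].
  by split; [case: (whom_sub F (dcoef swapped) k) | rewrite linear0].
split; first exact: (whom_sub F (dcoef swapped) k).2.
by rewrite linearP /= lu lv scaler0 addr0.
Qed.

Lemma harm_submodule k : is_submodule n1 n2 (so_odd F n) (harm k).
Proof.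
split; first exact: harm_sub.
move=> A f GA [hf lf]; rewrite actE; split; first exact: dhom_gact.
by rewrite lap_gact //; [rewrite lf linear0 | exact: dualK | exact: so_odd_antidual].
Qed.

Lemma gact_sum (I : finType) (P : pred I) (A : I -> mat) f :
  gact (\sum_(i | P i) A i) f = \sum_(i | P i) gact (A i) f.
Proof.
elim/big_rec2: _ => [|i u v _ <-]; last by rewrite -[A i]scale1r gactP !scale1r.
exact: gact0.
Qed.

Definition i1 : 'I_n := Ordinal (leq_trans n1_gt0 (leq_trans le_n12 le_n2n)).

Lemma swapped_i1 : swapped (ix i1).
Proof. by rewrite swappedx. Qed.

Local Notation m1 k := (U_(ix i1) *+ `|k|)%MM.

Lemma harm_lowest (k : int) : k <= 0 -> harm k 'X_[m1 k].
Proof.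
move=> k0; have wtm c : wt c (m1 k) = c (ix i1) * `|k|%:Z.
  rewrite /wt (bigD1 (ix i1)) //= mulmnE mnm1E eqxx mul1n big1 ?addr0 // => a.
  by rewrite eq_sym mulmnE mnm1E => /negPf->; rewrite mulr0.
split=> [m|]; first by rewrite msuppX inE => /eqP->; rewrite wtm /dcoef swapped_i1; lia.
(* In this weight the monomial has degree 0, so it is strictly bounded by 1; [lap] lowers the bound
   to 0, which forces zero. *)
pose c a : int := (~~ swapped a)%:Z.
apply: (@wbound0 F N c) => [a|]; first by rewrite /c; case: (swapped a).
apply: (@lap_lowers F N swapped dual (@swapped_dual _ _ _ le_n12) 1).
by move=> m; rewrite msuppX inE => /eqP->; rewrite wtm /c swapped_i1.
Qed.

Lemma harm_irreducible (k : int) : k <= 0 -> 2 * k + #|mid|%:Z <= 3 ->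
  irreducible_module n1 n2 (so_odd F n) (harm k).
Proof.
(* The eigenvalue of [\sum_a Zmx a a] over swapped [a]: the term [up a dn a] gives [-(m a + 1)] and
   its dual gives [- m (dual a)]. *)
move=> k0 kmid; pose tau m : F := - (\sum_(a | swapped a) (m a + m (dual a) + 1))%N%:R.
have swd a := @swapped_dual _ _ _ le_n12 a.
apply: (@irreducibleI _ _ (\sum_(a | swapped a) Zmx a a) tau).
- exact: so_odd_tr.
- exact: harm_submodule.
- exists 'X_[m1 k]; first exact: harm_lowest.
  by rewrite -msupp_eq0 msuppX.
- by apply: memv_suml => a _; exact: Zmx_so_odd.
- move=> f m; rewrite gact_sum raddf_sum /= /tau natr_sum -sumrN mulr_suml.
  apply: eq_bigr => a sa; rewrite gact_lieZ mcoeffB !mcoeff_up_dn sa (negPf (swd a sa)).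
  by rewrite !natrD -natr1; ring.
(* A fixed eigenvalue bounds the exponents of the swapped variables and of their duals; the fixed
   degree [k] then bounds the middle exponents too. *)
- move=> c; have [[s cs]|nc] := classic (exists s : nat, c = - s%:R); last first.
    by exists 0%N => f m _ _ tm; case: nc; exists (\sum_(a | swapped a) (m a + m (dual a) + 1))%N.
  exists (2 * s + `|k|).+1%N => f m [hf _] mf.
  rewrite cs /tau => /oppr_inj /(natr_inj_char0 charF).
  have /eqP := hf m mf; rewrite -/(deg swapped m) (degE (@dualK n) swd).
  rewrite mdegE (sum_split (@dualK n) swd) !big_split /=.
  move: (\sum_(a | swapped a) m a)%N (\sum_(a | swapped a) m (dual a))%N => p q.
  by move: (\sum_(a | mid a) m a)%N (\sum_(a | swapped a) 1)%N k0 => z t; lia.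
- move=> S1 S2 sub1 sub2 S1M S2M S10 S20.
  have low S : is_submodule n1 n2 (so_odd F n) S -> (forall f, S f -> harm k f) ->
      (exists2 f, S f & f != 0) -> S 'X_[m1 k].
    move=> [hS SA] SM S0.
    (* Under [swt] this becomes [-1] at [ix i1], [-2] at the other swapped indices, 0 at the middle
       ones, and the opposite values at the duals. All root vectors required by [lowest_supp] then
       lower the weight; the value 2 is there to separate the other swapped indices from [ix i1]. *)
    pose c a : int := if (a == ix i1) || (a == iy i1) then 1 else if mid a then 0 else 2.
    have c_dual a : swt swapped c (dual a) = - swt swapped c a.
      have cd : c (dual a) = c a.
        rewrite /c !(can2_eq (@dualK n) (@dualK n)) !dualE orbC.
        by rewrite (mid_inv _ (@dualK n)).
      rewrite /swt cd; have [sa|sa] := boolP (swapped a).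
        by rewrite (negPf (swd a sa)) opprK.
      have [//|sda] := boolP (swapped (dual a)).
      rewrite /c; case: ifP => [|_]; last by rewrite /mid sa sda.
      case/orP=> /eqP ea; move: sa sda; rewrite ea !dualE swapped_i1 //.
    have c_pos a : swapped a -> 0 < c a.
      by rewrite /c /mid => ->; case: ifP.
    have [|f [Sf f0 killf]] := @lowest_vector F N c S _ S0.
      by move=> a; rewrite /c; case: ifP => // _; case: ifP.
    have kill a b : swt swapped c a < swt swapped c b -> lieZ a b f = 0.
      move=> hab; apply: killf; first exact: lieZ_lowers.
      by rewrite -gact_lieZ -actE; apply: SA => //; exact: Zmx_so_odd.
    have supp := lowest_supp charF (@dualK n) swd k0 kmid swapped_i1 (SM f Sf).
    have {}supp : supported (fun m => m == m1 k) f.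
      apply: supp => [i a si ma|j sj j1]; apply: kill.
        rewrite c_dual {2}/swt si opprK; apply: le_lt_trans (c_pos i si).
        rewrite /swt; have [sa|sa] := boolP (swapped a).
          by rewrite oppr_le0 ltW // c_pos.
        move: ma; rewrite (negPf sa) orbF /c => ma.
        rewrite ma; case: ifP => // /orP[]/eqP ea; move: ma.
          by rewrite ea /mid swapped_i1.
        by rewrite ea /mid dualE swapped_i1 andbF.
      rewrite /swt sj swapped_i1 /c eqxx /= (negPf j1).
      case: eqP => [ej|_] /=.
        by have := swd _ sj; rewrite ej dualE swapped_i1.
      by rewrite /mid sj.
    have ef : f = f@_(m1 k) *: 'X_[m1 k].
      apply/mpolyP => m; rewrite mcoeffZ mcoeffX eq_sym.
      have [->|mm1] := eqVneq m (m1 k); first by rewrite mulr1.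
      by rewrite mulr0; apply: memN_msupp_eq0; apply: contra mm1 => /supp.
    have fm : f@_(m1 k) != 0 by apply: contraNneq f0 => h; rewrite ef h scale0r.
    have -> : 'X_[m1 k] = (f@_(m1 k))^-1 *: f.
      by rewrite {2}ef scalerA mulVf // scale1r.
    exact: subspaceZ.
  exists 'X_[m1 k]; split; [exact: low | exact: low |].
  by rewrite bformX mcoeffX eqxx mulr1; exact: mweightF_neq0.
Qed.

End Modules.

(** * The decomposition of the homogeneous spaces and the highest-weight criterion *)

Section Decomposition.
Variables (F : fieldType) (n n1 n2 : nat).
Hypothesis charF : [pchar F] =i pred0.
Hypothesis n1_gt0 : (1 <= n1)%N.
Hypothesis le_n12 : (n1 <= n2)%N.
Hypothesis le_n2n : (n2 <= n)%N.
Local Notation N := (n + n).+1.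
Local Notation B := {mpoly F[N]}.

Local Notation dual := (@dual n).
Local Notation swapped := (@swapped n n1 n2).
Local Notation lap := (@lap F N swapped dual).
Local Notation colap := (@colap F N swapped dual).
Local Notation dhom := (@whom F N (dcoef swapped)).
Local Notation harm := (@harm F N swapped dual).

Lemma lap_colap_pieces (k : int) : k <= 0 ->
  [/\ direct_sum (dhom k) (fun i : nat => image_of (iter i colap) (harm (k - 2 * i%:Z))),
      direct_sum (dhom k) (fun b : bool => if b then harm k else image_of colap (dhom (k - 2)))
    & forall (i : nat) f, harm (k - 2 * i%:Z) f -> iter i colap f = 0 -> f = 0].
Proof.
have swd := @swapped_dual n n1 n2 le_n12.
have W_sub := @whom_sub F N (dcoef swapped).
have D_W := @dhom_lap F N swapped dual.
have E_W := @dhom_colap F N swapped dual.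
have comm := @lap_colap F N swapped dual (@dualK n).
have nilp (j : int) f (_ : dhom j f) := lap_nilp swd f.
have odd_mid : odd #|mid swapped dual|.
  by rewrite card_swapped_mid //= odd_double.
have l0 (j : int) (i : nat) (_ : j <= 0) :=
  lamsum_neq0 charF (@dualK n) swd odd_mid (j - 2 * i.+1%:Z) i.
move=> k0; split.
- exact: (iterE_pieces_direct W_sub D_W E_W comm nilp l0 k0).
- exact: (ker_in_image_direct W_sub D_W E_W comm nilp l0 k0).
- by move=> i f; exact: (iterE_inj E_W comm l0 k0).
Qed.

Lemma iter_colap_act A i f : A \in so_odd F n ->
  iter i colap (act n1 n2 A f) = act n1 n2 A (iter i colap f).
Proof.
move=> hA; elim: i => //= i ->; rewrite !actE // colap_gact //.
  exact: dualK.
exact: so_odd_antidual.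
Qed.

Lemma harm_image_irreducible (k : int) (i : nat) :
  k <= 0 -> 2 * k + #|mid swapped dual|%:Z <= 3 ->
  irreducible_module n1 n2 (so_odd F n)
    (image_of (iter i colap) (harm (k - 2 * i%:Z))).
Proof.
move=> k0 kmid; have [_ _ inj] := lap_colap_pieces k0.
apply: irreducible_image.
- by move=> A f hA _; exact: iter_colap_act.
- exact: inj.
- by apply: harm_irreducible => //; lia.
Qed.

(* For [n2 <= s], the root vector [so_0y s] acts as [- x_0 y_s - x_s d_0];
   the first term raises the degree in [x_0], so this operator is injective. *)
Lemma act_so_0y_inj (s : 'I_n) (v : B) : (n2 <= s)%N -> act n1 n2 (so_0y F s) v = 0 -> v = 0.
Proof.
move=> hs; rewrite actE so_0yE gact_lieZ /lieZ !dualE /up /dn !swappedE hs.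
rewrite ltnNge (leq_trans le_n12 hs) /= => /eqP; rewrite subr_eq0 => /eqP h.
pose c a : int := (a == ix0 n)%:Z.
have c0 a : 0 <= c a by [].
have [L hL] := wbound_ex c v.
elim: L hL => [|L IH] hL; first exact: (wbound0 c0 hL).
apply: IH => m mv; have e : ('X_(ix0 n) * - ('X_(iy s) * v))@_(m + U_(iy s) + U_(ix0 n)) != 0.
  by rewrite mcoeff_Xmulr mcoeffN mcoeff_Xmulr oppr_eq0 -mcoeff_msupp.
have hd : wbound c L%:Z (mderiv (ix0 n) v).
  apply: supported_deriv hL _ => m' /=; rewrite wtU /c eqxx; lia.
have hr : wbound c L%:Z ('X_(ix s) * mderiv (ix0 n) v).
  by apply: supported_Xmul hd _ => m' /=; rewrite wtU /c indexE addr0.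
have := hr (m + U_(iy s) + U_(ix0 n))%MM; rewrite mcoeff_msupp -h e => /(_ isT).
by rewrite !wtU /c eqxx indexE; lia.
Qed.

Lemma highest_weight_full M : highest_weight_type (F := F) (n := n) n1 n2 M -> n2 = n.
Proof.
case=> _ [v [_ [/eqP v0 _] [_ _ sing] _]]; apply/eqP; rewrite eqn_leq le_n2n leqNgt.
by apply/negP => lt; case: v0; apply: (@act_so_0y_inj (Ordinal lt)).
Qed.

End Decomposition.

(** * The case n1 = n2 = n *)

Lemma mproj_up (F : fieldType) (N : nat) (sw : 'I_N -> bool) (S : pred 'X_{1..N})
    (a : 'I_N) (f : {mpoly F[N]}) :
  (forall m, S (m + U_(a))%MM = S m) -> mproj S (up sw a f) = up sw a (mproj S f).
Proof.
move=> hS; apply/mpolyP => m; rewrite mcoeff_mproj /up; case: (sw a).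
  by rewrite !mcoeff_mderiv mcoeff_mproj hS; case: ifP => //; rewrite mul0rn.
rewrite !mcoeff_Xmul; case: (ltnP 0 (m a)) => ma; last by rewrite if_same.
rewrite mcoeff_mproj -(hS (m - U_(a))%MM); congr (if S _ then _ else _); apply/mnmP => i.
by rewrite mnmDE mnmBE mnm1E; case: eqP => [<-|]; lia.
Qed.

Lemma mproj_dn (F : fieldType) (N : nat) (sw : 'I_N -> bool) (S : pred 'X_{1..N})
    (a : 'I_N) (f : {mpoly F[N]}) :
  (forall m, S (m + U_(a))%MM = S m) -> mproj S (dn sw a f) = dn sw a (mproj S f).
Proof.
move=> hS; have := mproj_up (fun b => ~~ sw b) f hS; rewrite /up /dn.
by case: (sw a) => //= h; rewrite linearN /= h.
Qed.

Lemma supported_indep (F : fieldType) (N : nat) (T I : eqType) (h : 'X_{1..N} -> T)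
    (r : I -> T) (s : seq I) (g : I -> {mpoly F[N]}) :
  uniq s -> {in s &, injective r} ->
  (forall i, i \in s -> supported (fun m => h m == r i) (g i)) ->
  \sum_(i <- s) g i = 0 -> forall i, i \in s -> g i = 0.
Proof.
move=> us rinj hg s0 i si.
have := congr1 (mproj (fun m => h m == r i)) s0.
rewrite linear0 linear_sum /= (bigD1_seq i) //= (mproj_id (hg i si)).
rewrite big_seq_cond big1 ?addr0 // => j /andP[sj ji].
apply/mpolyP => m; rewrite mcoeff_mproj mcoeff0; case: eqP => // hm.
apply: memN_msupp_eq0; apply/negP => /(hg j sj); rewrite /= hm => /eqP/rinj e.
by move: ji; rewrite e ?eqxx.
Qed.

(** * The sl2 of polarization operators commuting with K *)

Section Polarization.
Variables (F : fieldType) (n : nat).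
Hypothesis charF : [pchar F] =i pred0.
Local Notation N := (n + n).+1.
Local Notation B := {mpoly F[N]}.
Local Notation mat := 'M[F]_N.
Implicit Types (f g : B) (m : 'X_{1..N}) (a b : 'I_N) (i j : 'I_n) (A : mat).

Local Notation dual := (@dual n).
Local Notation swapped := (@swapped n n n).
Local Notation up := (@up F N swapped).
Local Notation dn := (@dn F N swapped).
Local Notation lap := (@lap F N swapped dual).
Local Notation gact := (@gact F N swapped).
Local Notation lieZ := (@lieZ F N swapped dual).
Local Notation dhom := (@whom F N (dcoef swapped)).
Local Notation harm := (@harm F N swapped dual).
Local Notation x0 := (ix0 n).

Lemma swx i : swapped (ix i). Proof. by rewrite swappedx. Qed.
Lemma swy i : swapped (iy i) = false. Proof. by rewrite swappedy leqNgt ltn_ord. Qed.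
Lemma sw0 : swapped x0 = false. Proof. exact: swapped0. Qed.

Definition polP f : B := \sum_i dn (ix i) (dn (iy i) f).
Definition polQ f : B := \sum_i up (ix i) (up (iy i) f).

Lemma polP_is_linear : linear polP.
Proof.
move=> k f g; rewrite /polP scaler_sumr -big_split; apply: eq_bigr => a _ /=.
by rewrite !linearP.
Qed.
HB.instance Definition _ := GRing.isLinear.Build F B B _ polP polP_is_linear.

Lemma polQ_is_linear : linear polQ.
Proof.
move=> k f g; rewrite /polQ scaler_sumr -big_split; apply: eq_bigr => a _ /=.
by rewrite !linearP.
Qed.
HB.instance Definition _ := GRing.isLinear.Build F B B _ polQ polQ_is_linear.

Lemma lap_polP f : lap f = dn x0 (dn x0 f) + 2%:R *: polP f.
Proof.
rewrite /lap sum_index dualE -addrA scaler_nat mulr2n; congr (_ + (_ + _)).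
  by apply: eq_bigr => i _; rewrite dualE.
by apply: eq_bigr => i _; rewrite dualE dn_comm.
Qed.

Lemma sum_delta_ord (V : lmodType F) i (u : 'I_n -> V) :
  \sum_j (j == i)%:R *: u j = u i.
Proof.
rewrite (bigD1 i) //= eqxx scale1r big1 ?addr0 // => j /negPf->.
by rewrite scale0r.
Qed.

Lemma polP_upx i f : polP (up (ix i) f) = up (ix i) (polP f) + dn (iy i) f.
Proof.
rewrite /polP linear_sum -(sum_delta_ord i (fun j => dn (iy j) f)) -big_split.
by apply: eq_bigr => j _ /=; rewrite dn_up indexE scale0r addr0 dn_up indexE.
Qed.

Lemma polP_upy i f : polP (up (iy i) f) = up (iy i) (polP f) + dn (ix i) f.
Proof.
rewrite /polP linear_sum -(sum_delta_ord i (fun j => dn (ix j) f)) -big_split.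
apply: eq_bigr => j _ /=.
by rewrite dn_up linearD linearZ /= dn_up !indexE scale0r addr0.
Qed.

Lemma polP_up0 f : polP (up x0 f) = up x0 (polP f).
Proof.
rewrite /polP linear_sum; apply: eq_bigr => j _ /=.
by rewrite dn_up indexE scale0r addr0 dn_up indexE scale0r addr0.
Qed.

Lemma polP_dn a f : polP (dn a f) = dn a (polP f).
Proof.
rewrite /polP linear_sum; apply: eq_bigr => j _ /=.
by rewrite [RHS]dn_comm [dn a (dn _ f)]dn_comm.
Qed.

Lemma polQ_up a f : polQ (up a f) = up a (polQ f).
Proof.
rewrite /polQ linear_sum; apply: eq_bigr => j _ /=.
by rewrite [RHS]up_comm [up a (up _ f)]up_comm.
Qed.

Lemma dnx_polQ i f : dn (ix i) (polQ f) = polQ (dn (ix i) f) + up (iy i) f.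
Proof.
rewrite /polQ linear_sum -(sum_delta_ord i (fun j => up (iy j) f)) -big_split.
apply: eq_bigr => j _ /=.
by rewrite dn_up dn_up !indexE scale0r addr0 eq_sym.
Qed.

Lemma dny_polQ i f : dn (iy i) (polQ f) = polQ (dn (iy i) f) + up (ix i) f.
Proof.
rewrite /polQ linear_sum -(sum_delta_ord i (fun j => up (ix j) f)) -big_split.
apply: eq_bigr => j _ /=.
by rewrite dn_up dn_up !indexE scale0r addr0 linearD linearZ /= eq_sym.
Qed.

Lemma Kalg_comm (phi : {linear B -> B}) :
  (forall i j f, phi (lieZ (ix i) (ix j) f) = lieZ (ix i) (ix j) (phi f)) ->
  forall A f, A \in Kalg F n -> phi (gact A f) = gact A (phi f).
Proof.
move=> h A f; move: A; apply: Kalg_ind.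
  split=> [|c A A' hA hA']; first by rewrite !gact0 linear0.
  by rewrite !gactP linearP /= hA hA'.
by move=> i j; rewrite !gact_lieZ.
Qed.

Lemma polP_gact A f : A \in Kalg F n -> polP (gact A f) = gact A (polP f).
Proof.
apply: Kalg_comm => i j g; rewrite /lieZ !dualE linearB /=.
by rewrite polP_upx polP_upy !polP_dn dn_comm opprD addrACA subrr addr0.
Qed.

Lemma polQ_gact A f : A \in Kalg F n -> polQ (gact A f) = gact A (polQ f).
Proof.
apply: Kalg_comm => i j g; rewrite /lieZ !dualE linearB /= !polQ_up.
by rewrite dnx_polQ dny_polQ !linearD /= [up (iy j) (up _ _)]up_comm addrACA subrr addr0.
Qed.

Lemma up0_gact A f : A \in Kalg F n -> up x0 (gact A f) = gact A (up x0 f).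
Proof.
apply: Kalg_comm => i j g; rewrite /lieZ !dualE linearB /=.
rewrite up_comm [up x0 (up (iy _) _)]up_comm !dn_up !indexE !scale0r !addr0.
by [].
Qed.

Definition cdeg0 a : int := (a == x0)%:Z.
Definition cdegq a : int := if ix_split a is Some (inr _) then 1 else 0.

Lemma cdegqx i : cdegq (ix i) = 0. Proof. by rewrite /cdegq ix_splitx. Qed.
Lemma cdegqy i : cdegq (iy i) = 1. Proof. by rewrite /cdegq ix_splity. Qed.
Lemma cdegq0 : cdegq x0 = 0. Proof. by rewrite /cdegq ix_split0. Qed.
Lemma cdegq_ge0 a : 0 <= cdegq a.
Proof. by rewrite /cdegq; case: ix_split => [[]|]. Qed.

Lemma whom_polP c d k f : (forall i, swt swapped c (ix i) + swt swapped c (iy i) = d) ->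
  whom c k f -> whom c (k - d) (polP f).
Proof.
move=> hc h; apply: subspace_bigsum => [|i _ _]; first exact: whom_sub.
have := whom_dn (sw := swapped) (a := ix i) (whom_dn (sw := swapped) (a := iy i) h).
by congr (whom _ _ _); have := hc i; lia.
Qed.

Lemma whom_polQ c d k f : (forall i, swt swapped c (ix i) + swt swapped c (iy i) = d) ->
  whom c k f -> whom c (k + d) (polQ f).
Proof.
move=> hc h; apply: subspace_bigsum => [|i _ _]; first exact: whom_sub.
have := whom_up (sw := swapped) (a := ix i) (whom_up (sw := swapped) (a := iy i) h).
by congr (whom _ _ _); have := hc i; lia.
Qed.

Lemma dcoef_pair i : swt swapped (dcoef swapped) (ix i) + swt swapped (dcoef swapped) (iy i) = 2.
Proof. by rewrite !swt_dcoef. Qed.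
Lemma cdeg0_pair i : swt swapped cdeg0 (ix i) + swt swapped cdeg0 (iy i) = 0.
Proof. by rewrite /swt /cdeg0 swx swy !indexE. Qed.
Lemma cdegq_pair i : swt swapped cdegq (ix i) + swt swapped cdegq (iy i) = 1.
Proof. by rewrite /swt swx swy cdegqx cdegqy. Qed.

(** Polynomials free of [x_0]; on these the degree [k] is also the weight for the sl2 of [polP] and
    [polQ]. *)
Definition flat (k : int) f := dhom k f /\ whom cdeg0 0 f.

Lemma flat_sub k : is_subspace (flat k).
Proof.
have [h1 h2] := whom_sub F (dcoef swapped) k; have [h3 h4] := whom_sub F cdeg0 0.
by split=> [|c u v [hu hu'] [hv hv']]; split; auto.
Qed.

Lemma flat_polP k f : flat k f -> flat (k - 2) (polP f).
Proof.
move=> [h h']; split; first exact: whom_polP dcoef_pair h.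
by have := whom_polP cdeg0_pair h'; rewrite subr0.
Qed.

Lemma flat_polQ k f : flat k f -> flat (k + 2) (polQ f).
Proof.
move=> [h h']; split; first exact: whom_polQ dcoef_pair h.
by have := whom_polQ cdeg0_pair h'; rewrite addr0.
Qed.

Lemma wt_cdeg0 m : wt cdeg0 m = m x0.
Proof.
rewrite /wt (bigD1 x0) //= big1 ?addr0 /cdeg0 ?eqxx ?mul1r // => a /negPf->.
by rewrite mul0r.
Qed.

Lemma wt_cdegq m : wt cdegq m = (\sum_i m (iy i))%N.
Proof.
rewrite /wt sum_index cdegq0 mul0r add0r big1 => [|i _]; last by rewrite cdegqx mul0r.
by rewrite add0r -natz natr_sum; apply: eq_bigr => i _; rewrite cdegqy mul1r natz.
Qed.

Lemma deg_flat m : m x0 = 0%N ->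
  deg swapped m = (\sum_i m (iy i))%N%:Z - (\sum_i m (ix i))%N%:Z.
Proof.
move=> m0; rewrite /deg /wt sum_index m0 mulr0 add0r addrC -!natz !natr_sum -sumrN.
congr (_ + _); apply: eq_bigr => i _; rewrite natz /dcoef ?swx ?swy; lia.
Qed.

(** In the commutator, [x_i] contributes [-(m (ix i) + 1)] and [y_i] contributes [m (iy i) + 1]. The
    shifts cancel, leaving the degree. *)
Lemma polP_polQ k f : flat k f -> polP (polQ f) = polQ (polP f) + k%:~R *: f.
Proof.
move=> [hk h0]; have -> : polP (polQ f) = polQ (polP f) +
    \sum_i (up (ix i) (dn (ix i) f) + dn (iy i) (up (iy i) f)).
  rewrite {1}/polQ linear_sum /= -big_split; apply: eq_bigr => i _ /=.
  by rewrite polP_upx polP_upy linearD addrA.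
congr (_ + _); apply/mpolyP => m; rewrite mcoeffZ raddf_sum /=.
have [mf|mf] := boolP (m \in msupp f); last first.
  rewrite memN_msupp_eq0 // mulr0 big1 // => i _.
  by rewrite mcoeffD mcoeff_up_dn mcoeff_dn_up memN_msupp_eq0 // !mulr0 addr0.
move/eqP: (hk m mf) => <-; move/eqP: (h0 m mf); rewrite wt_cdeg0 => -[m0].
rewrite -/(deg swapped m) deg_flat // rmorphB /= -!pmulrn !natr_sum -sumrB mulr_suml.
apply: eq_bigr => i _; rewrite mcoeffD mcoeff_up_dn mcoeff_dn_up swx swy -mulrDl.
by congr (_ * _); rewrite -!natr1; ring.
Qed.

Lemma polP_nilp f : exists L, iter L polP f = 0.
Proof.
apply: (@lowers_nilp F N cdegq) => [|L g hg]; first exact: cdegq_ge0.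
apply: subspace_bigsum => [|i _ _]; first exact: wbound_sub.
have := wbound_dn (sw := swapped) (a := ix i) (wbound_dn (sw := swapped) (a := iy i) hg).
by congr (wbound _ _ _); have := cdegq_pair i; lia.
Qed.

(** The arithmetic progression sums to [(i+1) (k - i - 2)], whose second factor is negative for
    [k <= 0]. *)
Lemma polarization_lamsum_neq0 (k : int) (i : nat) : k <= 0 ->
  lamsum (fun k : int => k%:~R : F) (k - 2 * i.+1%:Z) i.+1 != 0.
Proof.
move=> k0; have -> : lamsum (fun k : int => k%:~R : F) (k - 2 * i.+1%:Z) i.+1 =
    (i.+1%:Z * (k - i%:Z - 2))%:~R.
  have H (l : nat) (x : int) : \sum_(j < l) (x + 2 * j%:Z) = l%:Z * (x + l%:Z - 1).
    by elim: l => [|l IH]; rewrite ?big_ord0 ?big_ord_recr /= ?IH; lia.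
  by rewrite /lamsum -rmorph_sum H; congr (_%:~R); lia.
by rewrite pchar0_intr_eq0 // mulf_neq0 //; lia.
Qed.

Lemma polarization_pieces (k : int) : k <= 0 ->
  direct_sum (flat k) (fun i : nat => image_of (iter i polQ) (ker_in flat polP (k - 2 * i%:Z)))
  /\ forall (i : nat) f, ker_in flat polP (k - 2 * i%:Z) f -> iter i polQ f = 0 -> f = 0.
Proof.
have nilp (j : int) f (_ : flat j f) := polP_nilp f.
move=> k0; split.
  exact: (iterE_pieces_direct flat_sub flat_polP flat_polQ polP_polQ nilp polarization_lamsum_neq0 k0).
move=> i f; exact: (iterE_inj flat_polQ polP_polQ polarization_lamsum_neq0 k0).
Qed.

End Polarization.

(** * The Cauchy problem along the hyperplane x_0 = 0 *)

Section Lift.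
Variables (F : fieldType) (n : nat).
Hypothesis charF : [pchar F] =i pred0.
Local Notation N := (n + n).+1.
Local Notation B := {mpoly F[N]}.
Implicit Types (f g : B) (m : 'X_{1..N}) (k : int).

Local Notation dual := (@dual n).
Local Notation swapped := (@swapped n n n).
Local Notation up := (@up F N swapped).
Local Notation dn := (@dn F N swapped).
Local Notation lap := (@lap F N swapped dual).
Local Notation gact := (@gact F N swapped).
Local Notation dhom := (@whom F N (dcoef swapped)).
Local Notation harm := (@harm F N swapped dual).
Local Notation x0 := (ix0 n).
Local Notation polP := (@polP F n).
Local Notation polQ := (@polQ F n).
Local Notation flat := (@flat F n).

(** Multiplication by the divided power of [x_0], so that [dn x0] lowers the index without a scalar
    when [f] is free of [x_0]. *)
Definition divpow (a : nat) f : B := (a`!)%:R^-1 *: iter a (up x0) f.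

Lemma divpow_is_linear a : linear (divpow a).
Proof. by move=> k f g; rewrite /divpow linearP scalerDr !scalerA mulrC. Qed.
HB.instance Definition _ a := GRing.isLinear.Build F B B _ (divpow a) (divpow_is_linear a).

Lemma dn0_iter_up0 (a : nat) f : dn x0 f = 0 ->
  dn x0 (iter a.+1 (up x0) f) = a.+1%:R *: iter a (up x0) f.
Proof.
move=> f0; elim: a => [|a IH]; first by rewrite /= dn_up eqxx f0 linear0 add0r.
rewrite iterS dn_up eqxx IH linearZ /=.
by rewrite -scalerDl natr1.
Qed.

Lemma dn0_divpowS (a : nat) f : dn x0 f = 0 -> dn x0 (divpow a.+1 f) = divpow a f.
Proof.
move=> f0; rewrite /divpow linearZ /= -/(iter a.+1 (up x0) f) dn0_iter_up0 // scalerA.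
congr (_ *: _); rewrite factS natrM invfM -mulrA [X in _ * X]mulrC mulrA mulVf ?mul1r //.
by rewrite pchar0_natr_eq0.
Qed.

Lemma divpow0 f : divpow 0 f = f.
Proof. by rewrite /divpow fact0 invr1 scale1r. Qed.

Lemma flat_dn0 k f : flat k f -> dn x0 f = 0.
Proof.
move=> [_ h]; rewrite /dn sw0; apply/mpolyP => m.
rewrite mcoeff_mderiv mcoeff0 memN_msupp_eq0 ?mul0rn //.
by apply/negP => /h; rewrite /= wt_cdeg0 mnmDE mnm1E eqxx; lia.
Qed.

Definition trace f : B := mproj (fun m => m x0 == 0%N) f.

Lemma trace_is_linear : linear trace.
Proof. by move=> k f g; rewrite /trace linearP. Qed.
HB.instance Definition _ := GRing.isLinear.Build F B B _ trace trace_is_linear.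

Lemma flat_trace k f : dhom k f -> flat k (trace f).
Proof.
move=> h; split=> m /mproj_supp[/eqP m0 /h //].
by rewrite wt_cdeg0 m0.
Qed.

Lemma trace_id k f : flat k f -> trace f = f.
Proof. by move=> [_ h]; apply: mproj_id => m /h; rewrite /= wt_cdeg0. Qed.

Lemma trace_up0 f : trace (up x0 f) = 0.
Proof.
apply/mpolyP => m; rewrite mcoeff_mproj mcoeff0 /up sw0 mcoeff_Xmul.
by case: eqP => // ->.
Qed.

(** The normal derivative of order [e] on the hyperplane [x_0 = 0]; orders 0 and 1 are the Cauchy
    data. *)
Definition jet (e : nat) f : B := trace (iter e (dn x0) f).

Lemma jet_is_linear e : linear (jet e).
Proof. by move=> k f g; rewrite /jet !linearP. Qed.
HB.instance Definition _ e := GRing.isLinear.Build F B B _ (jet e) (jet_is_linear e).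

Lemma jet_divpow k (e a : nat) f : flat k f -> jet e (divpow a f) = if a == e then f else 0.
Proof.
move=> hf; have f0 := flat_dn0 hf; rewrite /jet.
elim: e a => [|e IH] [|a] //=.
- by rewrite divpow0 (trace_id hf).
- by rewrite /divpow linearZ /= trace_up0 scaler0.
- by rewrite divpow0 -iterS iterSr f0 linear0 linear0.
- by rewrite -iterS iterSr dn0_divpowS // IH.
Qed.

Lemma dhom_iter_dn0 (e : nat) k f : dhom k f -> dhom (k - e%:Z) (iter e (dn x0) f).
Proof.
elim: e => [|e IH] hf /=; first by rewrite subr0.
have := whom_dn (sw := swapped) (a := x0) (IH hf).
by rewrite swt_dcoef; congr (whom _ _ _); lia.
Qed.

Lemma flat_jet (e : nat) k f : dhom k f -> flat (k - e%:Z) (jet e f).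
Proof. by move=> hf; apply: flat_trace; apply: dhom_iter_dn0. Qed.

(** Scaled so that [lap f = 0] is the evolution equation in which the second [x_0]-derivative of [f]
    equals [polR f]. *)
Definition polR f : B := - 2%:R *: polP f.
Lemma polR_is_linear : linear polR.
Proof. by move=> k f g; rewrite /polR linearP scalerDr !scalerA mulrC. Qed.
HB.instance Definition _ := GRing.isLinear.Build F B B _ polR polR_is_linear.

Lemma lap_polR f : lap f = dn x0 (dn x0 f) - polR f.
Proof. by rewrite lap_polP /polR scaleNr opprK. Qed.

Lemma polR_divpow a f : polR (divpow a f) = divpow a (polR f).
Proof.
have H g : polR (up x0 g) = up x0 (polR g) by rewrite /polR polP_up0 linearZ.
by rewrite /divpow linearZ /=; congr (_ *: _); elim: a => //= a IH; rewrite H IH.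
Qed.

Lemma trace_polP f : trace (polP f) = polP (trace f).
Proof.
rewrite /polP linear_sum; apply: eq_bigr => i _ /=.
rewrite /trace mproj_dn => [|m]; last by rewrite mnmDE mnm1E !indexE addn0.
by rewrite mproj_dn // => m; rewrite mnmDE mnm1E !indexE addn0.
Qed.

Lemma jet_polR e f : jet e (polR f) = polR (jet e f).
Proof.
rewrite /jet /polR -trace_polP.
have -> : iter e (dn x0) (- 2%:R *: polP f) = - 2%:R *: polP (iter e (dn x0) f).
  by elim: e => //= e ->; rewrite linearZ /= polP_dn.
by rewrite linearZ.
Qed.

Lemma jet_eq0 f : (forall e, jet e f = 0) -> f = 0.
Proof.
move=> f0; apply/mpolyP => m; rewrite mcoeff0.
move Ea : (m x0) => a; elim: a m f f0 Ea => [|a IH] m f f0 ma.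
  by have := congr1 (mcoeff m) (f0 0%N); rewrite mcoeff_mproj ma eqxx mcoeff0.
have f0' e : jet e (dn x0 f) = 0 by rewrite /jet -iterSr; exact: f0.
have := IH (m - U_(x0))%MM _ f0'; rewrite mnmBE mnm1E eqxx ma subn1 => /(_ erefl).
rewrite /dn sw0 mcoeff_mderiv.
have -> : (m - U_(x0) + U_(x0) = m)%MM.
  by apply/mnmP => i; rewrite mnmDE mnmBE mnm1E; case: eqP => [<-|]; lia.
by rewrite -mulr_natr => /eqP; rewrite mulf_eq0 pchar0_natr_eq0 // orbF => /eqP.
Qed.

(** The evolution equation yields [jet (e+2) f = polR (jet e f)], so all jets vanish with the Cauchy
    data. *)
Lemma harm_jet_eq0 f : lap f = 0 -> jet 0 f = 0 -> jet 1 f = 0 -> f = 0.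
Proof.
move=> lf f0 f1; apply: jet_eq0 => e; elim/ltn_ind: e => -[|[|e]] IH //.
have -> : jet e.+2 f = jet e (dn x0 (dn x0 f)) by rewrite /jet !iterSr.
have /eqP := lap_polR f; rewrite lf eq_sym subr_eq0 => /eqP->.
by rewrite jet_polR IH ?linear0 //; lia.
Qed.

(* The Cauchy-Kovalevskaya solution of [lap f = dn x0 (dn x0 f) - polR f = 0];
   truncating at [L] is exact as soon as [iter L.+1 polR g = 0]. *)
Definition jetlift (e L : nat) g : B := \sum_(j < L.+1) divpow (j.*2 + e) (iter j polR g).

Lemma lift_is_linear e L : linear (jetlift e L).
Proof.
move=> k f g; rewrite /jetlift scaler_sumr -big_split; apply: eq_bigr => j _ /=.
by rewrite !linearP.
Qed.
HB.instance Definition _ e L := GRing.isLinear.Build F B B _ (jetlift e L) (lift_is_linear e L).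

Lemma flat_polR k f : flat k f -> flat (k - 2) (polR f).
Proof. by move=> h; apply: (subspaceZ _ (@flat_sub F n (k - 2))); exact: flat_polP. Qed.

Lemma flat_iter_polR (j : nat) k f : flat k f -> flat (k - 2 * j%:Z) (iter j polR f).
Proof.
move=> hf; elim: j => [|j IH] /=; first by rewrite mulr0 subr0.
by have := flat_polR IH; congr (flat _ _); lia.
Qed.

Lemma dhom_divpow (a : nat) k f : dhom k f -> dhom (k + a%:Z) (divpow a f).
Proof.
move=> hf; apply: (subspaceZ _ (whom_sub F _ _)); elim: a => [|a IH] /=; first by rewrite addr0.
have := whom_up (sw := swapped) (a := x0) IH.
by rewrite swt_dcoef; congr (whom _ _ _); lia.
Qed.

Lemma dhom_lift (e L : nat) k g : flat k g -> dhom (k + e%:Z) (jetlift e L g).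
Proof.
move=> hg; apply: subspace_bigsum => [|j _ _]; first exact: whom_sub.
have [h _] := flat_iter_polR j hg.
by have := dhom_divpow (a := (j.*2 + e)%N) h; congr (whom _ _ _); lia.
Qed.

(** The sum telescopes: two [x_0]-derivatives of a term cancel [polR] of the preceding one, and only
    [polR] of the last term is left. The condition [e <= 1] makes the second derivative of the
    initial term vanish. *)
Lemma lap_lift (e L : nat) k g : (e <= 1)%N -> flat k g -> iter L.+1 polR g = 0 ->
  lap (jetlift e L g) = 0.
Proof.
move=> e1 hg gL.
suff -> : lap (jetlift e L g) = - divpow (L.*2 + e) (iter L.+1 polR g) by rewrite gL linear0 oppr0.
elim: L {gL} => [|L IH].
  rewrite /jetlift big_ord1 lap_polR polR_divpow add0n /=.
  have g0 := flat_dn0 hg; case: e e1 => [|[]] // _.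
    by rewrite divpow0 g0 linear0 sub0r.
  by rewrite dn0_divpowS // divpow0 g0 sub0r.
rewrite /jetlift big_ord_recr /= linearD /= -[\sum_(_ < _) _]/(jetlift e L g) IH.
rewrite lap_polR polR_divpow doubleS !addSn.
have h := flat_dn0 (flat_iter_polR L.+1 hg).
by rewrite !dn0_divpowS // addrA addNr sub0r.
Qed.

Lemma jet_lift k (e e' L : nat) g : (e <= 1)%N -> (e' <= 1)%N -> flat k g ->
  jet e' (jetlift e L g) = if e == e' then g else 0.
Proof.
move=> he he' hg; rewrite /jetlift big_ord_recl linearD linear_sum /=.
rewrite (jet_divpow _ _ hg) add0n big1 ?addr0 // => j _.
rewrite -/(iter _.+1 _ g) (jet_divpow _ _ (flat_iter_polR j.+1 hg)).
by case: eqP => //; rewrite /bump /=; lia.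
Qed.

Lemma lift_gact e L A f : A \in Kalg F n -> jetlift e L (gact A f) = gact A (jetlift e L f).
Proof.
move=> hA; rewrite /jetlift linear_sum; apply: eq_bigr => j _ /=.
have -> : iter j polR (gact A f) = gact A (iter j polR f).
  elim: (j : nat) => //= i ->.
  by rewrite /polR polP_gact // linearZ.
rewrite /divpow linearZ /=; congr (_ *: _).
by elim: (j.*2 + e)%N => //= i ->; rewrite up0_gact.
Qed.

End Lift.

(** * Bihomogeneous pieces of ker P and their lowest vectors *)

Section PolarizationKernel.
Variables (F : fieldType) (n : nat).
Hypothesis charF : [pchar F] =i pred0.
Local Notation N := (n + n).+1.
Local Notation B := {mpoly F[N]}.
Implicit Types (f g : B) (m : 'X_{1..N}) (k : int) (i j : 'I_n) (c : nat).

Local Notation dual := (@dual n).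
Local Notation swapped := (@swapped n n n).
Local Notation up := (@up F N swapped).
Local Notation dn := (@dn F N swapped).
Local Notation gact := (@gact F N swapped).
Local Notation lieZ := (@lieZ F N swapped dual).
Local Notation x0 := (ix0 n).
Local Notation polP := (@polP F n).
Local Notation flat := (@flat F n).
Local Notation cdegq := (@cdegq n).

(** Here [c] is the degree in the [y_i], so the degree in the [x_i] is [c - k]; fixing both leaves
    finitely many monomials. *)
Definition piece k c f := ker_in flat polP k f /\ whom cdegq c%:Z f.

Lemma piece_sub k c : is_subspace (piece k c).
Proof.
have [h1 h2] := ker_in_sub polP (@flat_sub F n) k.
have [h3 h4] := whom_sub F cdegq c%:Z.
by split=> [|a u v [hu hu'] [hv hv']]; split; auto.
Qed.

Lemma whom_Kalg_gact (w : 'I_N -> int) k A f : A \in Kalg F n ->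
  (forall i j, w (ix i) = w (ix j)) -> (forall i j, w (iy i) = w (iy j)) ->
  whom w k f -> whom w k (gact A f).
Proof.
move=> hA wx wy hf; move: A hA; apply: Kalg_ind.
  split=> [|a A A' hA hA']; first by rewrite gact0; case: (whom_sub F w k).
  by rewrite gactP; apply: (whom_sub F w k).2.
move=> i j; rewrite gact_lieZ /lieZ !dualE; apply: (subspaceB (whom_sub F w k)).
  have := whom_up (sw := swapped) (a := ix i) (whom_dn (sw := swapped) (a := ix j) hf).
  by rewrite /swt !swx (wx i j) subrK.
have := whom_up (sw := swapped) (a := iy j) (whom_dn (sw := swapped) (a := iy i) hf).
by rewrite /swt !swy (wy i j) subrK.
Qed.

Lemma piece_submodule k c : is_submodule n n (Kalg F n) (piece k c).
Proof.
split; first exact: piece_sub.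
move=> A f hA [[[hk h0] Pf] hc]; rewrite actE; split; [split; [split|]|].
- exact: dhom_gact.
- by apply: whom_Kalg_gact hA _ _ h0 => i j; rewrite /cdeg0 !indexE.
- by rewrite /= polP_gact // Pf linear0.
- by apply: whom_Kalg_gact hA _ _ hc => i j; rewrite ?cdegqx ?cdegqy.
Qed.

Lemma piece_supp k c f m : piece k c f -> m \in msupp f ->
  [/\ m x0 = 0%N, (\sum_i m (iy i) = c)%N & (\sum_i m (ix i))%N%:Z = c%:Z - k].
Proof.
move=> [[[hk h0] _] hc] mf.
have m0 : m x0 = 0%N by move/eqP: (h0 m mf); rewrite wt_cdeg0 => -[].
have mc : (\sum_i m (iy i) = c)%N by move/eqP: (hc m mf); rewrite wt_cdegq => -[].
split=> //; move/eqP: (hk m mf); rewrite -/(deg swapped m) deg_flat // mc; lia.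
Qed.

Lemma mdeg_index m : mdeg m = (m x0 + \sum_i m (ix i) + \sum_i m (iy i))%N.
Proof. by rewrite mdegE sum_index. Qed.

Hypothesis n_ge2 : (2 <= n)%N.

Definition o0 : 'I_n := Ordinal (leq_trans (isT : (0 < 2)%N) n_ge2).
Definition o1 : 'I_n := Ordinal n_ge2.
Local Notation p0 := (ix o0).
Local Notation p1 := (ix o1).
Local Notation q0 := (iy o0).
Local Notation q1 := (iy o1).

Definition det2 : B := 'X_p0 * 'X_q1 - 'X_p1 * 'X_q0.

Lemma det2_neq0 : det2 != 0.
Proof.
apply: contraTneq isT => /(congr1 (mcoeff (U_(p0) + U_(q1))%MM)).
rewrite mcoeffB -!mpolyXD !mcoeffX mcoeff0 eqxx; case: eqP => [/mnmP/(_ p0)|_].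
  by rewrite !mnmDE !mnm1E !indexE.
by rewrite subr0 => /eqP; rewrite oner_eq0.
Qed.

Lemma sum_ord2 (u : 'I_n -> nat) : (forall j : 'I_n, (2 <= j)%N -> u j = 0%N) ->
  (\sum_i u i = u o0 + u o1)%N.
Proof.
move=> u0; rewrite (bigD1 o0) //= (bigD1 o1) //= big1 ?addn0 // => j /andP[j0 j1].
by apply: u0; move: j0 j1; rewrite -!val_eqE /=; lia.
Qed.

(* The monomials of weight (a, c, 0, ..., 0), up to a shift by the trace. *)
Definition wmon (a c t : nat) : 'X_{1..N} :=
  (U_(p0) *+ (a - t) + U_(p1) *+ t + U_(q0) *+ t + U_(q1) *+ (c - t))%MM.

Section Singular.
Variables (k : int) (c : nat) (f : B).
Hypothesis k_le0 : k <= 0.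
Hypothesis hf : piece k c f.
Hypothesis kill : forall i j, (i < j)%N -> lieZ (ix j) (ix i) f = 0.
Local Notation a := (c + `|k|)%N.

Lemma killE i j : (i < j)%N -> 'X_(ix i) * mderiv (ix j) f = - ('X_(iy i) * mderiv (iy j) f).
Proof.
move=> ij; have := kill ij; rewrite /lieZ !dualE /up /dn !swx !swy /=.
rewrite linearN /= mderivM mderivXU indexE.
rewrite -val_eqE /= gtn_eqF // mul0r add0r => /eqP.
by rewrite subr_eq0 eqr_oppLR => /eqP.
Qed.

(** Cramer's rule: [killE] for the first two indices is a homogeneous linear system for the
    derivatives of [f] in [x_i] and [y_i], with determinant [det2] up to sign. *)
Lemma singular_high i m : (2 <= i)%N -> m \in msupp f -> m (ix i) = 0%N /\ m (iy i) = 0%N.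
Proof.
move=> i2 mf; have k0 := @killE o0 i (ltnW i2); have k1 := @killE o1 i i2.
have dx0 : mderiv (ix i) f = 0.
  apply/eqP; have : det2 * mderiv (ix i) f == 0.
    rewrite /det2 mulrBl subr_eq0 mulrAC k0 [X in _ == X]mulrAC k1; apply/eqP; ring.
  by rewrite mulf_eq0 (negPf det2_neq0).
have dy0 : mderiv (iy i) f = 0.
  move: k0; rewrite dx0 mulr0 => /esym/eqP; rewrite oppr_eq0 => /eqP.
  exact: Xmul_eq0.
by split; [exact: mderiv_eq0_supp dx0 mf | exact: mderiv_eq0_supp dy0 mf].
Qed.

Lemma singular_polP : 'X_p0 * mderiv q0 f = - ('X_p1 * mderiv q1 f).
Proof.
have [[_ Pf] _] := hf; move: Pf; rewrite /= /polP.
rewrite (bigD1 o0) //= (bigD1 o1) //= big1 => [|i /andP[i0 i1]]; last first.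
  have i2 : (2 <= i)%N by move: i0 i1; rewrite -!val_eqE /=; lia.
  have -> : dn (iy i) f = 0; last by rewrite linear0.
  rewrite /dn swy; apply/mpolyP => m; rewrite mcoeff_mderiv mcoeff0 memN_msupp_eq0 ?mul0rn //.
  by apply/negP => /(singular_high i2)[_]; rewrite mnmDE mnm1E eqxx; lia.
rewrite addr0 /dn !swx !swy /= => /eqP; rewrite addr_eq0 opprK eqr_oppLR.
by move/eqP.
Qed.

Lemma mcoeff_Xderiv b g m : ('X_b * mderiv b g)@_m = (m b)%:R * g@_m.
Proof. by have := mcoeff_up_dn (fun=> false) b g m. Qed.

Lemma singular_supp m : m \in msupp f -> m = wmon a c (m q0) /\ (m q0 <= c)%N.
Proof.
move=> mf; have [m0 my mx] := piece_supp hf mf.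
have e : m p1 = m q0.
  (* After multiplication by ['X_p0], both sides equal [- 'X_p1 * 'X_q0 * mderiv q1 f], the left by
     [killE] and the right by [singular_polP]. On coefficients the identity compares the two
     exponents. *)
  have H : 'X_p1 * mderiv p1 f = 'X_q0 * mderiv q0 f.
    have p0n : ('X_p0 : B) != 0.
      by apply: contraTneq isT => h; have := @Xmul_eq0 F N p0 1; rewrite mulr1 => /(_ h)/eqP; rewrite oner_eq0.
    apply: (mulfI p0n); rewrite mulrCA killE // [RHS]mulrCA singular_polP; ring.
  have := congr1 (mcoeff m) H; rewrite !mcoeff_Xderiv.
  have fm : f@_m != 0 by rewrite -mcoeff_msupp.
  by move/(mulIf fm)/(natr_inj_char0 charF).
have hi j (j2 : (2 <= j)%N) := singular_high j2 mf.
rewrite (sum_ord2 (fun j hj => (hi j hj).2)) in my.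
rewrite (sum_ord2 (fun j hj => (hi j hj).1)) in mx.
split; last by lia.
apply/mnmP => b; rewrite /wmon !mnmDE !mulmnE !mnm1E.
case: (indexP b) => [|i|i]; rewrite !indexE ?m0 //.
- have [<-|i0] := eqVneq o0 i; first by rewrite /=; lia.
  have [<-|i1] := eqVneq o1 i; first by rewrite /=; lia.
  rewrite (hi i _).1 //; move: i0 i1; rewrite -!val_eqE /=; lia.
- have [<-|i0] := eqVneq o0 i; first by rewrite /=; lia.
  have [<-|i1] := eqVneq o1 i; first by rewrite /=; lia.
  rewrite (hi i _).2 //; move: i0 i1; rewrite -!val_eqE /=; lia.
Qed.

(** Writing [f_t] for the coefficient at [wmon a c t], [singular_polP] gives
    [(t+1) f_{t+1} = - (c-t) f_t]. Thus [f] is a multiple of the expansion of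
    [det2^c * 'X_p0^|k|]. *)
Lemma singular_coef t : (t <= c)%N ->
  f@_(wmon a c t) = (-1) ^+ t * 'C(c, t)%:R * f@_(wmon a c 0).
Proof.
elim: t => [_|t IH tc]; first by rewrite expr0 bin0 !mul1r.
pose mm := (U_(p0) *+ (a - t.+1) + U_(p1) *+ t + U_(q0) *+ t + U_(q1) *+ (c - t.+1))%MM.
have e1 : wmon a c t.+1 = (mm + U_(p1) + U_(q0))%MM.
  apply/mnmP => b; rewrite /wmon /mm !mnmDE !mulmnE !mnm1E; lia.
have e0 : wmon a c t = (mm + U_(p0) + U_(q1))%MM.
  apply/mnmP => b; rewrite /wmon /mm !mnmDE !mulmnE !mnm1E; lia.
have := congr1 (mcoeff (mm + U_(p0) + U_(p1))%MM) singular_polP.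
have eM : (mm + U_(p0) + U_(p1) = mm + U_(p1) + U_(p0))%MM.
  by apply/mnmP => b; rewrite !mnmDE addnAC.
rewrite mcoeffN mcoeff_Xmulr {1}eM mcoeff_Xmulr !mcoeff_mderiv -e1 -e0.
have -> : (mm + U_(p1))%MM q0 = t.
  by rewrite !mnmDE !mulmnE !mnm1E !indexE /=; lia.
have -> : ((mm + U_(p0))%MM q1).+1 = (c - t)%N.
  by rewrite !mnmDE !mulmnE !mnm1E !indexE /=; lia.
rewrite -[_ *+ t.+1]mulr_natl -[_ *+ (c - t)]mulr_natl (IH (ltnW tc)) => h.
have t0 : t.+1%:R != 0 :> F by rewrite pchar0_natr_eq0.
apply: (mulfI t0); rewrite h exprS.
have := congr1 (fun x : nat => x%:R : F) (mul_bin_left c t); rewrite !natrM => hb.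
set u := (-1) ^+ t; set v := f@__.
have -> : t.+1%:R * (-1 * u * 'C(c, t.+1)%:R * v) = - (t.+1%:R * 'C(c, t.+1)%:R * (u * v)).
  by ring.
by rewrite hb; ring.
Qed.

End Singular.

End PolarizationKernel.

Lemma mweightF_sign (F : fieldType) (N : nat) (sw : 'I_N -> bool) (m : 'X_{1..N}) :
  mweightF F sw m = (-1) ^+ (\sum_(i | sw i) m i) * (\prod_i (m i)`!)%N%:R.
Proof.
rewrite /mweightF big_split natr_prod; congr (_ * _) => /=.
rewrite [RHS](big_morph _ (exprD (-1)) (expr0 (-1))) [RHS]big_mkcond /=.
by apply: eq_bigr => i _; case: (sw i); rewrite ?expr1 // expr0 expr1n.
Qed.

(** * Irreducibility of the pieces under K *)

Section PieceIrreducible.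
Variables (F : fieldType) (n : nat).
Hypothesis charF : [pchar F] =i pred0.
Hypothesis n_ge2 : (2 <= n)%N.
Local Notation N := (n + n).+1.
Local Notation B := {mpoly F[N]}.
Implicit Types (f g : B) (m : 'X_{1..N}) (k : int) (i j : 'I_n) (c : nat).

Local Notation dual := (@dual n).
Local Notation swapped := (@swapped n n n).
Local Notation up := (@up F N swapped).
Local Notation dn := (@dn F N swapped).
Local Notation gact := (@gact F N swapped).
Local Notation lieZ := (@lieZ F N swapped dual).
Local Notation x0 := (ix0 n).
Local Notation polP := (@polP F n).
Local Notation flat := (@flat F n).
Local Notation cdegq := (@cdegq n).
Local Notation piece := (@piece F n).
Local Notation p0 := (ix (o0 n_ge2)).
Local Notation p1 := (ix (o1 n_ge2)).
Local Notation q0 := (iy (o0 n_ge2)).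
Local Notation q1 := (iy (o1 n_ge2)).

Definition singular f := forall i j, (i < j)%N -> lieZ (ix j) (ix i) f = 0.

Lemma singular_coef0_neq0 k c f : k <= 0 -> piece k c f -> singular f -> f != 0 ->
  f@_(wmon n_ge2 (c + `|k|) c 0) != 0.
Proof.
move=> k0 hf sf; rewrite -msupp_eq0; case E : (msupp f) => [//|m s] _.
have mf : m \in msupp f by rewrite E mem_head.
have [em tc] := singular_supp charF n_ge2 k0 hf sf mf.
move: mf; rewrite mcoeff_msupp em (singular_coef charF n_ge2 k0 hf sf tc).
by apply: contraNneq => ->; rewrite mulr0.
Qed.

Lemma singular_proportional k c f g : k <= 0 -> piece k c f -> piece k c g ->
  singular f -> singular g -> let M := wmon n_ge2 (c + `|k|) c 0 in
  g@_M *: f = f@_M *: g.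
Proof.
move=> k0 hf hg sf sg; pose W := wmon n_ge2 (c + `|k|) c.
have supp h m : piece k c h -> singular h -> m \in msupp h -> m = W (m q0) /\ (m q0 <= c)%N.
  by move=> ph sh; exact: singular_supp.
have coef h t : piece k c h -> singular h -> (t <= c)%N ->
    h@_(W t) = (-1) ^+ t * 'C(c, t)%:R * h@_(W 0%N).
  by move=> ph sh; exact: singular_coef.
apply/mpolyP => m; rewrite !mcoeffZ.
have [/andP[/eqP em tc]|nm] := boolP ((m == W (m q0)) && (m q0 <= c)%N).
  by rewrite em (coef f) // (coef g) // -/(W 0%N); ring.
have nsupp h : piece k c h -> singular h -> h@_m = 0.
  move=> ph sh; apply: memN_msupp_eq0; apply: contra nm => /(supp _ _ ph sh)[<- ->].
  by rewrite eqxx.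
by rewrite !nsupp // !mulr0.
Qed.

(** The sign of the form depends only on the degree in the [x_i], which is constant on a piece, and
    the signs of the coefficients are squared away. What remains is a positive sum of factorials
    times squared binomials, nonzero in characteristic 0. *)
Lemma singular_anisotropic k c f : k <= 0 -> piece k c f -> singular f -> f != 0 ->
  bform swapped f f != 0.
Proof.
move=> k0 hf sf f0; pose a := (c + `|k|)%N; pose W := wmon n_ge2 a c.
have supp m : m \in msupp f -> m = W (m q0) /\ (m q0 <= c)%N by exact: singular_supp.
have coef t : (t <= c)%N -> f@_(W t) = (-1) ^+ t * 'C(c, t)%:R * f@_(W 0%N).
  exact: singular_coef.
pose w m := ((\prod_i (m i)`!) * 'C(c, m q0) ^ 2)%N.
have fW : f@_(W 0%N) != 0 by exact: singular_coef0_neq0.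
have -> : bform swapped f f =
    (-1) ^+ a * f@_(W 0%N) ^+ 2 * (\sum_(m <- msupp f) w m)%N%:R.
  rewrite /bform natr_sum mulr_sumr; apply: eq_big_seq => m mf.
  have [em tc] := supp m mf.
  have -> : f@_m = (-1) ^+ m q0 * 'C(c, m q0)%:R * f@_(W 0%N) by rewrite {1}em coef.
  have -> : mweightF F swapped m = (-1) ^+ a * (\prod_i (m i)`!)%N%:R.
    rewrite mweightF_sign; congr ((-1) ^+ _ * _).
    have [_ _ mx] := piece_supp hf mf.
    have -> : (\sum_(b | swapped b) m b = \sum_i m (ix i))%N.
      rewrite big_mkcond sum_index sw0 add0r [X in _ + X]big1 => [|i _]; last by rewrite swy.
      by rewrite addr0; apply: eq_bigr => i _; rewrite swx.
    rewrite /a; lia.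
  rewrite /w natrM natrX; set u := (-1) ^+ m q0.
  have uu : u * u = 1 by rewrite -expr2 sqrr_sign.
  set p := (\prod_i _)%N%:R; set b := 'C(_, _)%:R; set x := f@__.
  transitivity ((-1) ^+ a * x ^+ 2 * (p * b ^+ 2) * (u * u)); first by ring.
  by rewrite uu mulr1.
rewrite !mulf_neq0 ?expf_neq0 ?oppr_eq0 ?oner_eq0 //.
rewrite pchar0_natr_eq0 // -lt0n.
move: f0; rewrite -msupp_eq0; case E : (msupp f) => [//|m s] _.
have mf : m \in msupp f by rewrite E mem_head.
have [_ tc] := supp m mf; rewrite big_cons addn_gt0 /w muln_gt0 expn_gt0 bin_gt0 tc.
by rewrite prodn_gt0 // => i; exact: fact_gt0.
Qed.

(** Multiplication by [det2], expressed through [up] and [dn] so that the commutation rules of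
    [polP] and the weight shifts apply. *)
Definition delta2 f : B := dn p1 (up q0 f) - dn p0 (up q1 f).

Lemma delta2E f : delta2 f = det2 F n_ge2 * f.
Proof.
by rewrite /delta2 /det2 /up /dn !swx !swy mulrBl opprK addrC !mulrA.
Qed.

Lemma piece_delta2 k c f : piece k c f -> piece k c.+1 (delta2 f).
Proof.
move=> [[[hk h0] Pf] hc]; rewrite /= in Pf.
have wB w (kk kk' : int) : whom w kk f ->
    kk' = kk + swt swapped w q0 - swt swapped w p1 ->
    kk' = kk + swt swapped w q1 - swt swapped w p0 -> whom w kk' (delta2 f).
  move=> hw e1 e2; apply: (subspaceB (whom_sub F w kk')).
    by rewrite e1; do 2!(apply: whom_dn || apply: whom_up).
  by rewrite e2; do 2!(apply: whom_dn || apply: whom_up).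
split; [split; [split|]|].
- by apply: wB hk _ _; rewrite !swt_dcoef addrK.
- by apply: wB h0 _ _; rewrite /swt /cdeg0 !indexE !swx !swy.
- rewrite /= /delta2 linearB /= !polP_dn !polP_upy Pf !linear0 !add0r.
  by rewrite dn_comm subrr.
- by apply: wB hc _ _; rewrite /swt !swx !swy !cdegqx !cdegqy; lia.
Qed.

(** The vector constructed is [det2^c * 'X_p0^|k|]. *)
Lemma piece_neq0 k c : k <= 0 -> exists2 f, piece k c f & f != 0.
Proof.
move=> k0; elim: c => [|c [f hf f0]]; last first.
  exists (delta2 f); first exact: piece_delta2.
  by rewrite delta2E mulf_neq0 // det2_neq0.
pose m := (U_(p0) *+ `|k|)%MM; have mE b : m b = ((p0 == b) * `|k|)%N.
  by rewrite /m mulmnE mnm1E.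
exists 'X_[m]; last by rewrite -msupp_eq0 msuppX.
have mx0 : m x0 = 0%N by rewrite mE indexE.
have my i : m (iy i) = 0%N by rewrite mE indexE.
have sx : (\sum_i m (ix i) = `|k|)%N.
  rewrite (bigD1 (o0 n_ge2)) //= big1 ?addn0 => [|i]; first by rewrite mE eqxx mul1n.
  by rewrite eq_sym mE indexE => /negPf->.
split; [split; [split|]|] => /=; try by move=> m'; rewrite msuppX inE => /eqP->;
  rewrite ?wt_cdeg0 ?mx0 ?wt_cdegq ?big1.
- move=> m'; rewrite msuppX inE => /eqP->; rewrite -/(deg swapped m) deg_flat // sx big1 //; lia.
- rewrite /polP big1 // => i _; rewrite [X in dn _ X](_ : _ = 0) ?linear0 //.
  by rewrite /dn swy mderivX my scale0r.
Qed.

Lemma piece_irreducible k c : k <= 0 -> irreducible_module n n (Kalg F n) (piece k c).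
Proof.
(* A piece has bounded degree, so the zero matrix can serve as grading element: its single
   eigenspace is everything. *)
move=> k0; apply: (@irreducibleI F n n n (Kalg F n) (piece k c) 0 (fun=> 0)).
- exact: Kalg_tr.
- exact: piece_submodule.
- exact: piece_neq0.
- exact: mem0v.
- by move=> f m; rewrite gact0 mcoeff0 mul0r.
- move=> e; exists (c + (c + `|k|)).+1%N => f m hf mf _.
  by have [m0 my mx] := piece_supp hf mf; rewrite mdeg_index m0 my; lia.
move=> S1 S2 sub1 sub2 S1M S2M S10 S20.
have sing S : is_submodule n n (Kalg F n) S -> (exists2 f, S f & f != 0) ->
    exists f, [/\ S f, f != 0 & singular f].
  move=> [hS SA] S0.
  (* Under [swt] this is [-(i+1)] at [ix i] and [i+1] at [iy i], so [lieZ (ix j) (ix i)] lowers the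
     weight for [i < j]. *)
  pose w (b : 'I_N) : int := if ix_split b is Some s then
    match s with inl i => i.+1%:Z | inr i => i.+1%:Z end else 0.
  have [|f [Sf f0 killf]] := @lowest_vector F N w S _ S0.
    by move=> b; rewrite /w; case: ix_split => [[]|].
  exists f; split=> // i j ij; apply: killf.
    apply: lieZ_lowers => [b|]; last by rewrite /swt !swx /w !ix_splitx; lia.
    case: (indexP b) => [|l|l]; rewrite dualE /swt ?sw0 ?swx ?swy /w ?ix_split0 //;
      by rewrite !(ix_splitx, ix_splity) ?opprK.
  by rewrite -gact_lieZ -actE; apply: SA => //; exact: Zmx_Kalg.
have [f [S1f f0 sf]] := sing S1 sub1 S10; have [g [S2g g0 sg]] := sing S2 sub2 S20.
have hf := S1M f S1f; have hg := S2M g S2g.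
have /= fg := singular_proportional k0 hf hg sf sg.
have gM := singular_coef0_neq0 k0 hg sg g0; move: fg gM; set M := wmon _ _ _ _ => fg gM.
exists f; split=> //; last exact: singular_anisotropic hf sf f0.
have -> : f = (g@_M)^-1 *: (f@_M *: g) by rewrite -fg scalerA mulVf // scale1r.
by have [hS _] := sub2; exact: (subspaceZ _ hS (subspaceZ _ hS S2g)).
Qed.

End PieceIrreducible.

(** * The decomposition of the harmonic space into K-modules *)

Section FiniteType.
Variables (F : fieldType) (n : nat).
Hypothesis charF : [pchar F] =i pred0.
Hypothesis n_ge2 : (2 <= n)%N.
Local Notation N := (n + n).+1.
Local Notation B := {mpoly F[N]}.
Implicit Types (f g : B) (m : 'X_{1..N}) (k : int).

Local Notation dual := (@dual n).
Local Notation swapped := (@swapped n n n).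
Local Notation dn := (@dn F N swapped).
Local Notation lap := (@lap F N swapped dual).
Local Notation dhom := (@whom F N (dcoef swapped)).
Local Notation harm := (@harm F N swapped dual).
Local Notation polP := (@polP F n).
Local Notation polQ := (@polQ F n).
Local Notation flat := (@flat F n).
Local Notation cdegq := (@cdegq n).
Local Notation piece := (@piece F n).
Local Notation jetlift := (@jetlift F n).
Local Notation jet := (@jet F n).

Lemma finite_dim_bounded (W : B -> Prop) : finite_dim W ->
  exists K, forall f, W f -> (msize f <= K)%N.
Proof.
move=> [s hs]; exists (\sum_(g <- s) msize g)%N => f /hs hf.
set K := (\sum_(g <- s) _)%N.
have : supported (fun m => mdeg m < K)%N f.
  apply: (lin_span_le (S := fun g => g \in s) (supported_sub F _)) hf => g gs m mg.
  apply: leq_trans (msize_mdeg_lt mg) _.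
  by rewrite /K (big_rem g gs) /= leq_addr.
by move=> h; rewrite msizeE; apply/bigmax_leqP_seq => m mf _; exact: h.
Qed.

Lemma image_finite_dim (phi : {linear B -> B}) (W : B -> Prop) K :
  (forall f, W f -> (msize f <= K)%N) -> finite_dim (image_of phi W).
Proof.
move=> WK; exists [seq phi 'X_[m] | m : 'X_{1..N < K}] => _ [f Wf ->].
exists [seq (f@_m, phi 'X_[m]) | m <- msupp f].
  move=> _ /mapP[m mf ->] /=.
  have mK : (mdeg m < K)%N by apply: leq_trans (msize_mdeg_lt mf) (WK f Wf).
  by apply/mapP; exists (BMultinom mK); rewrite ?mem_enum.
rewrite big_map {1}(mpolyE f) linear_sum; apply: eq_bigr => m _.
by rewrite linearZ.
Qed.

Lemma piece_msize k c f : piece k c f -> (msize f <= (c + (c + `|k|)).+1)%N.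
Proof.
move=> hf; rewrite msizeE; apply/bigmax_leqP_seq => m mf _.
by have [m0 my mx] := piece_supp hf mf; rewrite mdeg_index m0 my; lia.
Qed.

Lemma piece_harm k c f : piece k c f -> harm k f.
Proof.
move=> [[hf Pf] _]; split; first exact: hf.1.
by rewrite lap_polP (flat_dn0 hf) Pf linear0 scaler0 addr0.
Qed.

(** For every [c] the space contains a nonzero piece, whose monomials have degree [2c - k]; the
    degrees are unbounded. *)
Lemma harm_infinite k : k <= 0 -> ~ finite_dim (harm k).
Proof.
move=> k0 /finite_dim_bounded[K hK].
have [f hf f0] := piece_neq0 F n_ge2 K k0.
move: f0; rewrite -msupp_eq0; case E : (msupp f) => [//|m s] _.
have mf : m \in msupp f by rewrite E mem_head.
have := leq_trans (msize_mdeg_lt mf) (hK f (piece_harm hf)).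
by have [m0 my mx] := piece_supp hf mf; rewrite mdeg_index m0 my; lia.
Qed.

Lemma whom_iter_polQ c (i : nat) f :
  whom cdegq c f -> whom cdegq (c + i%:Z) (iter i polQ f).
Proof.
move=> hf; elim: i => [|i IH] /=; first by rewrite addr0.
by have := whom_polQ (@cdegq_pair n) IH; congr (whom _ _ _); lia.
Qed.

Lemma iter_polR_eq0 c (i : nat) f : whom cdegq c%:Z f -> (c < i)%N ->
  iter i (@polR F n) f = 0.
Proof.
move=> hf ci; have h : whom cdegq (c%:Z - i%:Z) (iter i (@polR F n) f).
  elim: i {ci} => [|i IH] /=; first by rewrite subr0.
  apply: (subspaceZ _ (whom_sub F _ _)).
  by have := whom_polP (@cdegq_pair n) IH; congr (whom _ _ _); lia.
apply/mpolyP => m; rewrite mcoeff0 memN_msupp_eq0 //.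
by apply/negP => /h /=; rewrite wt_cdegq; lia.
Qed.

Lemma iter_polQ_gact (i : nat) A f : A \in Kalg F n ->
  iter i polQ (gact swapped A f) = gact swapped A (iter i polQ f).
Proof. by move=> hA; elim: i => //= i ->; rewrite polQ_gact. Qed.

(** [polP] lowers the degree in the [y_i] by exactly one, so the images of components of different
    degrees cannot cancel. *)
Lemma polP_ker_split k f : ker_in flat polP k f ->
  exists2 s : seq (nat * B), (forall p, p \in s -> piece k p.1 p.2) &
    f = \sum_(p <- s) p.2.
Proof.
move=> [hf Pf]; pose h m := (\sum_i m (iy i))%N.
pose s := undup [seq h m | m <- msupp f].
pose pi c := mproj (fun m => h m == c) f.
have wpi c : whom cdegq c%:Z (pi c).
  by move=> m /mproj_supp[/eqP hm _]; rewrite /= wt_cdegq -/(h m) hm.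
have fpi c : flat k (pi c) by case: hf => h1 h2; split=> m /mproj_supp[_]; [exact: h1|exact: h2].
have sumP : \sum_(c <- s) polP (pi c) = 0 by rewrite -linear_sum -[RHS]Pf -mproj_sum.
exists [seq (c, pi c) | c <- s]; last by rewrite big_map /= -mproj_sum.
move=> _ /mapP[c cs ->] /=; split=> //; split=> //.
apply: (@supported_indep F N int nat (wt cdegq) (fun c => c%:Z - 1) s) sumP _ cs.
- exact: undup_uniq.
- by move=> c1 c2 _ _ /addIr[].
- by move=> c' _; exact: whom_polP (@cdegq_pair n) (wpi c').
Qed.

(** For [t = (e, j, c)], a vector of a piece with [y]-degree [c] is raised by [polQ^j] and becomes
    the Cauchy datum of order [e]. Its [y]-degree is then [c + j] and each [polR] lowers it by one,
    so truncation at [c + j] is exact. In degree [k] the piece must have degree [k - e - 2j]. *)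
Definition summand (t : bool * nat * nat) : B -> B :=
  jetlift t.1.1 (t.2 + t.1.2) \o iter t.1.2 polQ.
HB.instance Definition _ t := GRing.Linear.copy (summand t)
  (jetlift t.1.1 (t.2 + t.1.2) \o iter t.1.2 polQ).

Local Notation base k t := (piece (k - (nat_of_bool t.1.1)%:Z - 2 * t.1.2%:Z) t.2).

Lemma summand_gact t A f : A \in Kalg F n ->
  summand t (gact swapped A f) = gact swapped A (summand t f).
Proof. by move=> hA; rewrite /summand /= iter_polQ_gact // lift_gact. Qed.

Lemma base_iter k t f : base k t f ->
  flat (k - (nat_of_bool t.1.1)%:Z) (iter t.1.2 polQ f) /\
  whom cdegq (t.2 + t.1.2)%N%:Z (iter t.1.2 polQ f).
Proof.
move=> [[hf _] hc]; split; last by have := whom_iter_polQ (i := t.1.2) hc; rewrite PoszD.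
have := iterE_W (@flat_polQ F n) t.1.2 hf.
by rewrite subrK.
Qed.

Lemma jet_summand k t (e : bool) f : base k t f ->
  jet e (summand t f) = if t.1.1 == e then iter t.1.2 polQ f else 0.
Proof.
move=> /base_iter[h _]; rewrite /summand /= (jet_lift charF _ _ _ h) ?leq_b1 //.
by congr (if _ then _ else _); case: (t.1.1) (e) => [] [].
Qed.

Lemma summand_inj k t f : k <= 0 -> base k t f -> summand t f = 0 -> f = 0.
Proof.
move=> k0 hf f0; have := jet_summand t.1.1 hf; rewrite f0 linear0 eqxx => /esym.
have k1 : k - (nat_of_bool t.1.1)%:Z <= 0 :> int by lia.
by have [_] := polarization_pieces n charF k1; apply; case: hf.
Qed.

Lemma summand_harm k t f : base k t f -> harm k (summand t f).
Proof.
move=> hf; have [h hc] := base_iter hf; split.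
  by have := dhom_lift (e := t.1.1) (L := (t.2 + t.1.2)%N) h; rewrite subrK.
by apply: (lap_lift charF _ h); rewrite ?leq_b1 // (iter_polR_eq0 hc).
Qed.

Lemma summand_irreducible k t : k <= 0 ->
  irreducible_module n n (Kalg F n) (image_of (summand t) (base k t)).
Proof.
move=> k0; apply: irreducible_image.
- by move=> A f hA _; rewrite /= !actE // summand_gact.
- by move=> f; exact: summand_inj.
- by apply: piece_irreducible => //; lia.
Qed.

Lemma flat_split k f : k <= 0 -> flat k f ->
  exists2 s : seq (nat * nat * B),
    (forall p, p \in s -> piece (k - 2 * p.1.1%:Z) p.1.2 p.2) &
    f = \sum_(p <- s) iter p.1.1 polQ p.2.
Proof.
move=> k0 hf; have [[hU hsum _] _] := polarization_pieces n charF k0.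
have [s [g [hg ->]]] := (hsum f).1 hf.
elim: s hg => [|i s IH] hg; first by exists [::] => //; rewrite !big_nil.
have [|t ht et] := IH; first by move=> j js; apply: hg; rewrite inE js orbT.
have [h /polP_ker_split[u hu eh] eg] := hg i (mem_head _ _).
exists ([seq ((i, p.1), p.2) | p <- u] ++ t).
  by move=> p; rewrite mem_cat => /orP[/mapP[q /hu hq ->] //|/ht].
by rewrite big_cat big_map big_cons -et eg eh linear_sum.
Qed.

(** Each Cauchy datum of [f] is flat, so it splits under the polarization sl2, and its parts lift to
    harmonic polynomials. The lifts of both data add up to [f] because the difference has zero
    Cauchy data. *)
Lemma harm_split k f : k <= 0 -> harm k f ->
  subspace_sum (fun t => image_of (summand t) (base k t)) f.
Proof.
move=> k0 [hf lf].
have hU t : is_subspace (image_of (summand t) (base k t)).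
  by apply: image_subspace; exact: piece_sub.
have Uharm t g : image_of (summand t) (base k t) g -> harm k g.
  by move=> [h hh ->]; exact: summand_harm.
have H (e : bool) : exists2 g, subspace_sum (fun t => image_of (summand t) (base k t)) g &
    harm k g /\ forall e' : bool, jet e' g = if e == e' then jet e f else 0.
  have ke : k - (nat_of_bool e)%:Z <= 0 :> int by lia.
  have [s hs es] := flat_split ke (flat_jet e hf).
  have hs' p : p \in s -> base k (e, p.1.1, p.1.2) p.2 by move/hs.
  exists (\sum_(p <- s) summand (e, p.1.1, p.1.2) p.2).
    apply: subspace_sum_big => // p ps; apply: (@subspace_sum1 _ _ _ _ (e, p.1.1, p.1.2)).
    by exists p.2 => //; exact: hs'.
  split.
    apply: subspace_bigsum => [|p ps _]; first exact: harm_sub.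
    by apply: summand_harm; exact: hs'.
  move=> e'; rewrite linear_sum es big_seq /=.
  under eq_bigr => p ps do rewrite (jet_summand e' (hs' p ps)) /=.
  by case: eqP => _; rewrite -big_seq // big1.
have [g0 sg0 [hg0 jg0]] := H false; have [g1 sg1 [hg1 jg1]] := H true.
suff -> : f = g0 + g1 by apply: subspace_sumD.
apply/eqP; rewrite -subr_eq0; apply/eqP; apply: (harm_jet_eq0 charF).
- by rewrite linearB linearD /= hg0.2 hg1.2 lf addr0 subr0.
- by have := (jg0 false, jg1 false); rewrite linearB linearD /= => -[-> ->]; rewrite addr0 subrr.
- by have := (jg0 true, jg1 true); rewrite linearB linearD /= => -[-> ->]; rewrite add0r subrr.
Qed.

(** The three indices are separated in turn: [jet e] keeps only the summands with first index [e],
    independence of the polarization pieces separates the powers of [polQ], and the degree in the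
    [y_i] separates the last index. *)
Lemma harm_indep k : k <= 0 ->
  independent (fun t : bool * nat * nat => image_of (summand t) (base k t)).
Proof.
move=> k0 s g us hg s0 t ts.
have [f hf gt] := hg t ts.
suff : jet t.1.1 (g t) = 0.
  rewrite gt (jet_summand _ hf) eqxx => h.
  suff -> : f = 0 by rewrite linear0.
  by apply: (summand_inj k0 hf); rewrite /summand /= h linear0.
pose e := t.1.1.
have ke : k - (nat_of_bool e)%:Z <= 0 :> int by lia.
have [[hU _ ind] _] := polarization_pieces n charF ke.
pose s' := [seq u <- s | u.1.1 == e].
have hjet u : u \in s -> image_of (iter u.1.2 polQ)
    (ker_in flat polP (k - (nat_of_bool e)%:Z - 2 * u.1.2%:Z)) (jet e (g u)).
  move=> us_; have [h hh ->] := hg u us_; rewrite (jet_summand _ hh).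
  case: eqP => [ue|_]; first by exists h => //; rewrite -ue; case: hh.
  by exists 0; [case: (ker_in_sub polP (@flat_sub F n) (k - (nat_of_bool e)%:Z - 2 * u.1.2%:Z)) | rewrite linear0].
pose G j := \sum_(u <- s' | u.1.2 == j) jet e (g u).
have G0 j : j \in undup [seq u.1.2 | u <- s'] -> G j = 0.
  apply: (ind _ G (undup_uniq _)) => [i _|].
    apply: subspace_bigsum (hU i) _ => u us' /eqP <-; apply: hjet.
    by move: us'; rewrite mem_filter => /andP[].
  rewrite /G (exchange_big_dep predT) //=.
  have J0 : \sum_(u <- s) jet e (g u) = 0 by rewrite -linear_sum s0 linear0.
  rewrite -[RHS]J0 {1}/s' big_filter [LHS]big_mkcond /=.
  apply: eq_big_seq => u us_; case: eqP => ue; last first.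
    by have [h hh ->] := hg u us_; rewrite (jet_summand _ hh); case: eqP.
  rewrite big_mkcond (bigD1_seq u.1.2) ?undup_uniq //=; last first.
    rewrite mem_undup; apply: (map_f (fun v : bool * nat * nat => v.1.2)).
    by rewrite mem_filter ue eqxx.
  by rewrite eqxx big1 ?addr0 // => i; rewrite eq_sym => /negPf->.
have ts' : t \in s' by rewrite mem_filter eqxx.
have := G0 t.1.2; rewrite mem_undup (map_f (fun v : bool * nat * nat => v.1.2) ts').
move=> /(_ isT).
rewrite /G -big_filter => sumG.
apply: (@supported_indep F N int _ (wt cdegq) (fun u : bool * nat * nat => (u.2 + u.1.2)%N%:Z)
  [seq u <- s' | u.1.2 == t.1.2] (fun u => jet e (g u))) sumG _ _.
- by rewrite !filter_uniq.
- move=> [[e1 j1] c1] [[e2 j2] c2]; rewrite !mem_filter /=.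
  by move=> /and3P[/eqP-> /eqP-> _] /and3P[/eqP-> /eqP-> _] [/addIn->].
- move=> u; rewrite !mem_filter => /and3P[_ /eqP ue us_].
  have [h hh ->] := hg u us_; rewrite (jet_summand _ hh) ue eqxx.
  exact: (base_iter hh).2.
- by rewrite mem_filter eqxx.
Qed.

Lemma harm_GK k : k <= 0 -> GK_type n n (harm k).
Proof.
move=> k0; split.
- exact: harm_infinite.
- apply: harm_irreducible => //; [exact: ltnW | ].
  by rewrite card_swapped_mid //; lia.
exists (bool * nat * nat)%type, (fun t => image_of (summand t) (base k t)); split.
  move=> t; split; last exact: summand_irreducible.
  exact: image_finite_dim (fun f => piece_msize (f := f)).
split.
- by move=> t; apply: image_subspace; exact: piece_sub.
- move=> f; split; first exact: harm_split.
  move=> [s [g [hg ->]]]; apply: subspace_bigsum; first exact: harm_sub.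
  by move=> t /hg[h hh ->] _; exact: summand_harm.
- exact: harm_indep.
Qed.

End FiniteType.

Theorem theorem3 (F : fieldType) (n n1 n2 : nat)
    (charF : [pchar F] =i pred0) (n_ge2 : (2 <= n)%N)
    (n1_gt0 : (1 <= n1)%N) (le_n12 : (n1 <= n2)%N) (le_n2n : (n2 <= n)%N) :
  (forall k : int, k <= n1%:Z - n2%:Z + 1 - (n1 == n2)%:Z ->
     [/\ irreducible_module n1 n2 (so_odd F n) (H'k F n n1 n2 k),
         direct_sum (B'k F n n1 n2 k)
           (fun i : nat => image_of (iter i (etaop n1 n2))
                             (H'k F n n1 n2 (k - 2 * i%:Z)))
         /\ (forall i : nat, irreducible_module n1 n2 (so_odd F n)
               (image_of (iter i (etaop n1 n2))
                  (H'k F n n1 n2 (k - 2 * i%:Z)))),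
         direct_sum (B'k F n n1 n2 k)
           (fun b : bool => if b then H'k F n n1 n2 k
                            else image_of (etaop n1 n2) (B'k F n n1 n2 (k - 2)))
       & highest_weight_type n1 n2 (H'k F n n1 n2 k) -> n2 = n])
  /\ (n1 = n -> n2 = n ->
      forall k : int, k <= 0 -> GK_type n1 n2 (H'k F n n1 n2 k)).
Proof.
split=> [k hk|e1 e2 k k0]; last by rewrite H'kE // e1 e2; exact: harm_GK.
(* For [n1 = n2] the hypothesis is [k <= 0]. Otherwise it is [k <= n1 - n2 + 1], which is at most 0
   and, with [#|mid| = 2(n2 - n1) + 1], amounts to [kmid]. *)
have k0 : k <= 0 by move: hk; case: eqP; lia.
have kmid : 2 * k + #|mid (swapped n1 n2) (@dual n)|%:Z <= 3.
  by rewrite card_swapped_mid //; move: hk; case: eqP; lia.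
rewrite H'kE // B'kE // etaopE //.
have [hpieces hbool _] := lap_colap_pieces charF le_n12 le_n2n k0.
split=> //.
- exact: harm_irreducible.
- by split=> // i; exact: harm_image_irreducible.
- exact: highest_weight_full.
Qed.
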